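(* Let $m\in\mathbb{R}$ and let $T_\sigma$ be the pseudo-differential operator with symbol $\sigma\in M^{m}_{\rho,\Lambda}(\mathbb{Z}^n\times\mathbb{T}^n)$. Then the transpose operator $T_\sigma^t$ of $T_\sigma$ is also a pseudo-differential operator, with symbol $\sigma^t\in M^{m}_{\rho,\Lambda}(\mathbb{Z}^n\times\mathbb{T}^n)$. Moreover, it has the asymptotic expansion $$\sigma^t(k,x)\sim\sum_{\alpha}\frac{1}{\alpha!}\Delta_k^\alpha D_x^{(\alpha)}\sigma(k,-x),$$ meaning that for every $N\in\mathbb{N}$, $$\sigma^t(k,x)-\sum_{|\alpha|<N}\frac{1}{\alpha!}\Delta_k^\alpha D_x^{(\alpha)}\sigma(k,-x)\in M^{m-\rho N}_{\rho,\Lambda}(\mathbb{Z}^n\times\mathbb{T}^n).$$ Here $D_x^{(\alpha)}\sigma(k,-x)$ denotes $D_x^{(\alpha)}$ applied to the function $x\mapsto\sigma(k,-x)$.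
   Context: Write $\mathbb{T}^n=\mathbb{R}^n/\mathbb{Z}^n$ and $\mathbb{N}_0=\{0,1,2,\dots\}$. For $f$ on $\mathbb{Z}^n$ set $\Delta_{k_j}f(k)=f(k+e_j)-f(k)$ ($e_j$ the $j$-th unit vector) and $\Delta_k^\alpha=\Delta_{k_1}^{\alpha_1}\cdots\Delta_{k_n}^{\alpha_n}$ for $\alpha\in\mathbb{N}_0^n$. On smooth functions on $\mathbb{T}^n$ set $D_x^{(\beta)}=D_{x_1}^{(\beta_1)}\cdots D_{x_n}^{(\beta_n)}$, where $D_{x_j}^{(0)}=I$ and $D_{x_j}^{(\ell)}=\prod_{m=0}^{\ell-1}\big(\frac{1}{2\pi i}\frac{\partial}{\partial x_j}-m\big)$ for $\ell\ge1$. Write $k^\gamma=k_1^{\gamma_1}\cdots k_n^{\gamma_n}$. Weight function: $\Lambda:\mathbb{Z}^n\to(0,\infty)$ is a weight function if there are positive constants $\mu_0\le\mu_1\le\mu$ and $C_0,C_1$ with $C_0(1+|k|)^{\mu_0}\le\Lambda(k)\le C_1(1+|k|)^{\mu_1}$ for all $k\in\mathbb{Z}^n$, and for all $\alpha\in\mathbb{N}_0^n$, $\gamma\in\{0,1\}^n$ there is $C_{\alpha,\gamma}>0$ with $|k^\gamma\Delta_k^{\alpha+\gamma}\Lambda(k)|\le C_{\alpha,\gamma}\Lambda(k)^{1-|\alpha|/\mu}$ for all $k\in\mathbb{Z}^n$. Fix such a $\Lambda$ (with its constants) and $\rho\in(0,1/\mu]$. Symbol classes: for $m\in\mathbb{R}$,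 $S^m_{\rho,\Lambda}(\mathbb{Z}^n\times\mathbb{T}^n)$ is the set of $\sigma:\mathbb{Z}^n\times\mathbb{T}^n\to\mathbb{C}$, smooth in $x$ for every $k$, such that for all $\alpha,\beta\in\mathbb{N}_0^n$ there is a constant $C>0$ with $|D_x^{(\beta)}\Delta_k^\alpha\sigma(k,x)|\le C\Lambda(k)^{m-\rho|\alpha|}$ for all $(k,x)$. $M^m_{\rho,\Lambda}(\mathbb{Z}^n\times\mathbb{T}^n)$ is the set of $\sigma:\mathbb{Z}^n\times\mathbb{T}^n\to\mathbb{C}$, smooth in $x$ for every $k$, such that $k^\gamma\Delta_k^\gamma\sigma(k,x)\in S^m_{\rho,\Lambda}(\mathbb{Z}^n\times\mathbb{T}^n)$ for all $\gamma\in\{0,1\}^n$. Operators: $\mathcal{S}(\mathbb{Z}^n)$ is the space of rapidly decreasing functions on $\mathbb{Z}^n$. For $f\in\mathcal{S}(\mathbb{Z}^n)$ put $\widehat f(x)=\sum_{k\in\mathbb{Z}^n}e^{-2\pi i k\cdot x}f(k)$ and $T_\sigma f(k)=\int_{\mathbb{T}^n}e^{2\pi i k\cdot x}\sigma(k,x)\widehat f(x)\,dx$. The transpose $T^t$ of a linear operator $T$ on $\mathcal{S}(\mathbb{Z}^n)$ is determined by $\sum_{k}(T^tf)(k)g(k)=\sum_{k}f(k)(Tg)(k)$ for all $f,g\in\mathcal{S}(\mathbb{Z}^n)$ (no complex conjugation). *)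

(* Defs.v *)
From mathcomp Require Import all_boot all_order all_algebra complex.
From mathcomp Require Import all_classical all_reals all_analysis.

Set Implicit Arguments.
Unset Strict Implicit.
Unset Printing Implicit Defensive.

Import Order.TTheory GRing.Theory Num.Theory.
Import numFieldTopology.Exports numFieldNormedType.Exports.

Local Open Scope ring_scope.
Local Open Scope complex_scope.

(* Elements of Z^n are row vectors ['rV[int]_n].  A function on the torus
   T^n = R^n / Z^n is a function on ['rV[R]_n] that is [Zperiodic]. *)

Section Defs.
Context {R : realType} {n : nat}.
Implicit Types (k p : 'rV[int]_n) (x : 'rV[R]_n) (a b : 'I_n -> nat)
  (g : 'I_n -> bool) (u : 'rV[R]_n -> R[i]) (f : 'rV[int]_n -> R[i])
  (sigma : 'rV[int]_n -> 'rV[R]_n -> R[i]).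

(* [`|z|] has type R[i]; this is the modulus as an element of R. *)
Definition cmod (z : R[i]) : R := ComplexField.Normc.normc z.

Definition mlen a : nat := (\sum_j a j)%N.
Definition mfact a : nat := (\prod_j (a j)`!)%N.

Definition enormZ k : R := Num.sqrt (\sum_j (k 0 j)%:~R ^+ 2).
Definition kpow k g : int := \prod_j k 0 j ^+ g j.

Definition diff1 {V : zmodType} (j : 'I_n) (h : 'rV[int]_n -> V) :
    'rV[int]_n -> V :=
  fun k => h (k + delta_mx 0 j) - h k.

Definition diffs {V : zmodType} a (h : 'rV[int]_n -> V) : 'rV[int]_n -> V :=
  foldr (fun j => iter (a j) (diff1 j)) h (enum 'I_n).

Definition Zperiodic u : Prop :=
  forall p x, u (x + map_mx intr p) = u x.

Definition partial (j : 'I_n) u : 'rV[R]_n -> R[i] := fun x =>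
  'D_(delta_mx 0 j) (fun y => complex.Re (u y)) x
    +i* 'D_(delta_mx 0 j) (fun y => complex.Im (u y)) x.

(* C^infinity: every iterated partial derivative is continuous and can be
   differentiated further in every coordinate direction. *)
Definition smooth u : Prop :=
  forall s : seq 'I_n, let v := foldr partial u s in
  [/\ continuous (fun x => complex.Re (v x)), continuous (fun x => complex.Im (v x)) &
      forall (j : 'I_n) x,
        derivable (fun y => complex.Re (v y)) x (delta_mx 0 j) /\
        derivable (fun y => complex.Im (v y)) x (delta_mx 0 j)].

Fixpoint Dfall1 (j : 'I_n) (l : nat) u : 'rV[R]_n -> R[i] :=
  if l is l'.+1 then
    fun x => (0 +i* (2 * pi))^-1 * partial j (Dfall1 j l' u) x
             - l'%:R * Dfall1 j l' u x
  else u.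

Definition Dfall b u : 'rV[R]_n -> R[i] :=
  foldr (fun j => Dfall1 j (b j)) u (enum 'I_n).

Definition weight_function (mu : R) (Lambda : 'rV[int]_n -> R) : Prop :=
  (forall k, 0 < Lambda k) /\
  exists mu0 mu1 C0 C1 : R,
    [/\ [/\ 0 < mu0, mu0 <= mu1, mu1 <= mu, 0 < C0 & 0 < C1],
        forall k, C0 * (1 + enormZ k) `^ mu0 <= Lambda k
                  <= C1 * (1 + enormZ k) `^ mu1 &
        forall a g, exists2 C : R, 0 < C & forall k,
          `|(kpow k g)%:~R * diffs (fun j => a j + g j)%N Lambda k|
            <= C * Lambda k `^ (1 - (mlen a)%:R / mu)].

Definition torus_symbol sigma : Prop :=
  forall k, Zperiodic (sigma k) /\ smooth (sigma k).

Definition Sclass (rho : R) (Lambda : 'rV[int]_n -> R) (m : R) sigma : Prop :=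
  torus_symbol sigma /\
  forall a b, exists2 C : R, 0 < C & forall k x,
    cmod (Dfall b (fun y => diffs a (sigma^~ y) k) x)
      <= C * Lambda k `^ (m - rho * (mlen a)%:R).

Definition Mclass (rho : R) (Lambda : 'rV[int]_n -> R) (m : R) sigma : Prop :=
  torus_symbol sigma /\
  forall g, Sclass rho Lambda m
    (fun k x => (kpow k g)%:~R * diffs (fun j => g j : nat) (sigma^~ x) k).

Definition rapidly_decreasing f : Prop :=
  forall N : nat, exists C : R,
    forall k, cmod (f k) <= C / (1 + enormZ k) ^+ N.

(* Sum of an absolutely summable family over Z^n, through the nonnegative and
   nonpositive parts. *)
Definition sumZr (h : 'rV[int]_n -> R) : R :=
  fine (\esum_(k in [set: 'rV[int]_n]) (Num.max (h k) 0)%:E)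
  - fine (\esum_(k in [set: 'rV[int]_n]) (Num.max (- h k) 0)%:E).

Definition sumZ f : R[i] :=
  sumZr (fun k => complex.Re (f k)) +i* sumZr (fun k => complex.Im (f k)).

(* e^{2 pi i k.x} *)
Definition echar k x : R[i] :=
  let t := 2 * pi * \sum_j (k 0 j)%:~R * x 0 j in cos t +i* sin t.

Definition fourier f x : R[i] := sumZ (fun k => echar k (- x) * f k).

End Defs.

(* The integral over T^n, as an iterated Lebesgue integral over the fundamental
   domain [0,1]^n; it is only applied to continuous integrands. *)
Fixpoint torus_int_r {R : realType} (n : nat) : ('rV[R]_n -> R) -> R :=
  match n return ('rV[R]_n -> R) -> R with
  | 0 => fun h => h 0
  | n'.+1 => fun h =>
      \int[@lebesgue_measure R]_(t in `[0, 1]%classic)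
        torus_int_r (fun y : 'rV[R]_n' =>
          h (row_mx (const_mx t : 'rV[R]_1) y : 'rV[R]_(1 + n')))
  end.

Definition torus_int {R : realType} {n : nat} (u : 'rV[R]_n -> R[i]) : R[i] :=
  torus_int_r (fun x => complex.Re (u x)) +i* torus_int_r (fun x => complex.Im (u x)).

Definition psdo {R : realType} {n : nat}
    (sigma : 'rV[int]_n -> 'rV[R]_n -> R[i]) (f : 'rV[int]_n -> R[i]) :
    'rV[int]_n -> R[i] :=
  fun k => torus_int (fun x => echar k x * sigma k x * fourier f x).

(* [T'] is the transpose of [T] for the bilinear pairing on S(Z^n).  Both map
   S(Z^n) to itself, so that both sums converge absolutely. *)
Definition is_transpose {R : realType} {n : nat}
    (T T' : ('rV[int]_n -> R[i]) -> ('rV[int]_n -> R[i])) : Prop :=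
  [/\ forall f, rapidly_decreasing f -> rapidly_decreasing (T f),
      forall f, rapidly_decreasing f -> rapidly_decreasing (T' f) &
      forall f g, rapidly_decreasing f -> rapidly_decreasing g ->
        sumZ (fun k => T' f k * g k) = sumZ (fun k => f k * T g k)].

(* Main.v *)
Require Import Defs.
From mathcomp Require Import all_boot all_order all_algebra complex.
From mathcomp Require Import all_classical all_reals all_analysis.
From mathcomp Require Import ring lra zify.

Set Implicit Arguments.
Unset Strict Implicit.
Unset Printing Implicit Defensive.

Import Order.TTheory GRing.Theory Num.Theory.
Import numFieldTopology.Exports numFieldNormedType.Exports.

Local Open Scope ring_scope.

(** In Fourier coefficients the theorem is a statement about matrices. Let
   [c p k] be the [p]-th Fourier coefficient of [sigma k]. Integrating the series
   of the Fourier transform of [f] term by term shows that the operator of symbol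
   [sigma] is the matrix with entries [c (l - k) k] ([psdo_kernel]). The
   transposed matrix has entries [c (k - l) l], hence comes from the symbol
   [sigma^t] whose [p]-th coefficient at [k] is [c (- p) (k + p)]
   ([transpose_symbol]); that the pairing identity holds is Fubini's theorem for
   double series ([transpose_pairing]).

   The asymptotic expansion is Newton's formula for the shift by [p],
   [[f (k + p) = sum_(|a| < N) p^(a) / a! * D^a f k + remainder]], applied to
   [f = c (- p)]: the falling power [p^(a)] is exactly the factor by which the
   operator [Dfall a] multiplies the [p]-th Fourier coefficient. The remainder
   obeys a Pascal recursion under unit steps of [p] ([newton_remS]), which bounds
   it by differences of order [N] at translates [k + q], with a polynomial loss in
   [p] ([newton_rem_bound]). The rapid decay of [c p k] in [p] absorbs that loss,
   and also the loss in comparing the weight at [k + q] and at [k], which is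
   polynomial in [q] because a root of the weight is Lipschitz
   ([Lambda_temperate]). This gives the gain of [rho] per order
   ([Minner_remainder]); order [N = 0] is the assertion that [sigma^t] is in the
   class of [sigma].

   The monomials in the definition of class M are moved across differences by the
   Leibniz rule ([Mouter_Minner]), after which they are harmless.

   What remains is the passage between symbols and coefficients. Bounds on the
   derivatives [Dfall b] give rapidly decaying coefficients by integration by
   parts ([fcoef_decay]); conversely rapidly decaying families sum to smooth
   functions that are differentiated term by term ([cderiv_fseries]). Fourier
   inversion ([fseries_fcoef]) then reduces to the uniqueness of Fourier
   coefficients of continuous functions ([torus_uniqueness]), which follows from
   the one-dimensional case, proved with powers of a trigonometric polynomial that
   peak at a point ([null_moments_le0]). *)

(** * Words of difference operators *)

Lemma stepE {A : pzRingType} {n : nat} (q : 'rV[A]_n) i j :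
  (q + delta_mx 0 i) 0 j = q 0 j + (j == i)%:R.
Proof. by rewrite !mxE eqxx. Qed.

Lemma unstepE {A : pzRingType} {n : nat} (q : 'rV[A]_n) i j :
  (q - delta_mx 0 i) 0 j = q 0 j - (j == i)%:R.
Proof. by rewrite !mxE eqxx. Qed.

Section Words.
Context {n : nat}.
Implicit Types (s t : seq 'I_n) (a : 'I_n -> nat).

Definition diffw {V : zmodType} s (h : 'rV[int]_n -> V) : 'rV[int]_n -> V :=
  foldr (@diff1 n V) h s.

(** Multi-indices are turned into words of unit differences: words can be
   concatenated and permuted freely, and the estimates only see their length. *)
Definition word a : seq 'I_n := flatten [seq nseq (a j) j | j <- enum 'I_n].

Section Zmod.
Context {V : zmodType}.
Implicit Types (h : 'rV[int]_n -> V).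

Lemma diff1C i j h : diff1 i (diff1 j h) = diff1 j (diff1 i h).
Proof.
apply/funext => k; rewrite /diff1 [k + _ + delta_mx 0 j]addrAC !opprB.
by rewrite addrACA [in RHS]addrACA; congr (_ + _); rewrite addrC.
Qed.

Lemma diff1_diffw i s h : diff1 i (diffw s h) = diffw s (diff1 i h).
Proof. by elim: s => //= j s IH; rewrite diff1C IH. Qed.

Lemma diffw_cat s t h : diffw (s ++ t) h = diffw s (diffw t h).
Proof. by rewrite /diffw foldr_cat. Qed.

Lemma diffw_rem i t h : i \in t -> diffw t h = diff1 i (diffw (rem i t) h).
Proof.
elim: t => //= j t IH; rewrite inE; have [<- //|ij /= it] := eqVneq i j.
by rewrite IH // diff1C.
Qed.

Lemma diffw_perm s t h : perm_eq s t -> diffw s h = diffw t h.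
Proof.
elim: s t => [|i s IH] t st.
  by have := perm_size st; case: t st.
have it : i \in t by rewrite -(perm_mem st) mem_head.
rewrite (diffw_rem _ it) /= (IH (rem i t)) //.
by rewrite -(perm_cons i) (perm_trans st) // perm_to_rem.
Qed.

Lemma diffsE a h : diffs a h = diffw (word a) h.
Proof.
rewrite /diffs /word; elim: (enum 'I_n) => //= j e IH.
by rewrite diffw_cat -IH; elim: (a j) => //= m ->.
Qed.

End Zmod.

Lemma count_word a j : count_mem j (word a) = a j.
Proof.
rewrite /word count_flatten -map_comp sumnE big_map -[RHS](big_pred1_eq addn j a).
rewrite big_enum /= [RHS]big_mkcond /=; apply: eq_bigr => i _ /=.
by rewrite count_nseq /= eq_sym; case: eqP => _; rewrite ?mul1n ?mul0n.
Qed.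

Lemma perm_word s t : (forall j, count_mem j s = count_mem j t) -> perm_eq s t.
Proof. by move=> st; apply/allP => j _ /=; rewrite st. Qed.

Lemma size_word a : size (word a) = mlen a.
Proof.
rewrite /word size_flatten /shape -map_comp sumnE big_map big_enum /=.
by apply: eq_bigr => i _ /=; rewrite size_nseq.
Qed.

Lemma diffw_count {V : zmodType} s (h : 'rV[int]_n -> V) :
  diffw s h = diffs (fun j => count_mem j s) h.
Proof. by rewrite diffsE; apply/diffw_perm/perm_word => j; rewrite count_word. Qed.

Lemma uniq_word (g : 'I_n -> bool) : uniq (word (fun j => g j : nat)).
Proof.
apply: count_mem_uniq => j.
by rewrite count_word -has_pred1 has_count count_word lt0b.
Qed.

Section Ring.
Context {A : comNzRingType}.
Implicit Types (f h : 'rV[int]_n -> A).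

Lemma diffwD s f h :
  diffw s (fun k => f k + h k) = fun k => diffw s f k + diffw s h k.
Proof.
elim: s => //= i s ->; apply/funext => k; rewrite /diff1; ring.
Qed.

Lemma diffwB s f h :
  diffw s (fun k => f k - h k) = fun k => diffw s f k - diffw s h k.
Proof.
elim: s => //= i s ->; apply/funext => k; rewrite /diff1; ring.
Qed.

Lemma diffwZ s (c : A) f : diffw s (fun k => c * f k) = fun k => c * diffw s f k.
Proof.
elim: s => //= i s ->; apply/funext => k; rewrite /diff1; ring.
Qed.

Lemma diffw_sum s (I : Type) (r : seq I) (P : pred I) (F : I -> 'rV[int]_n -> A) :
  diffw s (fun k => \sum_(i <- r | P i) F i k) =
  fun k => \sum_(i <- r | P i) diffw s (F i) k.
Proof.
elim: s => //= i s ->; apply/funext => k; rewrite /diff1.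
by rewrite -sumrB.
Qed.

Lemma diffw_shift s q f : diffw s (fun k => f (k + q)) = fun k => diffw s f (k + q).
Proof.
by elim: s => //= i s ->; apply/funext => k; rewrite /diff1 addrAC.
Qed.

Definition kmon t (k : 'rV[int]_n) : A := \prod_(j <- t) (k 0 j)%:~R.

Lemma kmon_word (g : 'I_n -> bool) k :
  kmon (word (fun j => g j : nat)) k = (kpow k g)%:~R.
Proof.
rewrite /kmon /kpow rmorph_prod /word /=.
rewrite big_flatten /= big_map big_enum; apply: eq_bigr => j _ /=.
by case: (g j); rewrite ?big_seq1 ?big_nil.
Qed.

Lemma kmon_rem i t k : i \in t -> kmon t k = (k 0 i)%:~R * kmon (rem i t) k.
Proof. by move=> it; rewrite /kmon (perm_big _ (perm_to_rem it)) big_cons. Qed.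

Lemma kmon_shift_notin i t k : i \notin t -> kmon t (k + delta_mx 0 i) = kmon t k.
Proof.
move=> it; rewrite /kmon !big_seq; apply: eq_bigr => j jt.
rewrite stepE; case: eqP => [ji|_]; last by rewrite addr0.
by rewrite -ji jt in it.
Qed.

(** Leibniz rule. The extra term has a shorter monomial, so that exchanging
   differences and monomials is an induction on its length. *)
Lemma diff1_kmon i t h : uniq t ->
  diff1 i (fun k => kmon t k * h k) =
  fun k => kmon t k * diff1 i h k +
           (if i \in t then kmon (rem i t) k * (h k + diff1 i h k) else 0).
Proof.
move=> ut; apply/funext => k; rewrite /diff1; case: ifPn => it; last first.
  by rewrite kmon_shift_notin //; ring.
rewrite !(kmon_rem _ it) kmon_shift_notin ?mem_rem_uniqF //.
by rewrite stepE eqxx (intrD _ _ 1) mulr1z; ring.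
Qed.

End Ring.
End Words.

(** * Newton's formula *)

Section Newton.
Context {F : numFieldType} {n : nat}.
Implicit Types (p q k : 'rV[int]_n) (f : 'rV[int]_n -> F).

Definition falling (z : F) (l : nat) : F := \prod_(m < l) (z - m%:R).

Definition pfall p (a : 'I_n -> nat) : F := \prod_j falling (p 0 j)%:~R (a j).

Definition newton_coef p (a : 'I_n -> nat) : F := (mfact a)%:R^-1 * pfall p a.

(** The exponents range over a box of side [K >= N], so that the formulas of
   order [N] and [N.+1] below can share one index type. *)
Definition newton (K N : nat) p f k : F :=
  \sum_(a : {ffun 'I_n -> 'I_K} | (mlen (fun j => a j) < N)%N)
     newton_coef p (fun j => a j) * diffs (fun j => a j) f k.

Definition newton_rem (K N : nat) p f k : F := f (k + p) - newton K N p f k.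

Lemma fallingS z l : falling z l.+1 = falling z l * (z - l%:R).
Proof. by rewrite /falling big_ord_recr. Qed.

Lemma falling1S z l : falling (z + 1) l.+1 = (z + 1) * falling z l.
Proof.
rewrite /falling big_ord_recl /= subr0; congr (_ * _); apply: eq_bigr => m _.
by rewrite /bump leq0n add1n -natr1; ring.
Qed.

Lemma pascal z l :
  falling (z + 1) l.+1 / l.+1`!%:R =
  falling z l.+1 / l.+1`!%:R + falling z l / l`!%:R.
Proof.
have l0 : l`!%:R != 0 :> F by rewrite pnatr_eq0 -lt0n fact_gt0.
have l1 : l.+1%:R != 0 :> F by rewrite pnatr_eq0.
rewrite -natr1 in l1; rewrite falling1S fallingS factS natrM -natr1; field.
by rewrite l0 l1.
Qed.

Lemma newton_coefE p a :
  newton_coef p a = \prod_j (falling (p 0 j)%:~R (a j) / (a j)`!%:R).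
Proof. by rewrite /newton_coef /mfact /pfall natr_prod -prodfV mulrC -big_split. Qed.

Lemma newton_coef_pascal p a j :
  newton_coef (p + delta_mx 0 j) a =
  newton_coef p a +
  (if (0 < a j)%N then newton_coef p (fun i => a i - (i == j))%N else 0).
Proof.
rewrite !newton_coefE.
rewrite (bigD1 j) //=.
rewrite [in RHS](bigD1 j) //=.
rewrite [X in (if _ then X else _)](bigD1 j) //=.
set X := \prod_(i | _) _; set Y := \prod_(i | _) _; set Z := \prod_(i | _) _.
have -> : X = Y.
  by apply: eq_bigr => i /negPf ij; rewrite stepE ij addr0.
have -> : Z = Y.
  by apply: eq_bigr => i /negPf ij; rewrite ij subn0.
rewrite stepE eqxx (intrD _ _ 1) mulr1z; case: (a j) => [|l] /=.
  by rewrite /falling !big_ord0 addr0.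
by rewrite subn1 /= pascal mulrDl.
Qed.

Lemma newtonS K N p f k j : (N <= K)%N ->
  newton K.+1 N.+1 (p + delta_mx 0 j) f k =
  newton K.+1 N.+1 p f k + newton K.+1 N p (diff1 j f) k.
Proof.
move=> NK; rewrite /newton.
under eq_bigr do rewrite newton_coef_pascal mulrDl.
rewrite big_split /=; congr (_ + _).
under eq_bigr => a _ do rewrite (fun_if ( *%R^~ _)) mul0r.
rewrite -big_mkcondr /=.
pose up (b : {ffun 'I_n -> 'I_K.+1}) : {ffun 'I_n -> 'I_K.+1} :=
  [ffun i => inord (b i + (i == j))].
pose dn (a : {ffun 'I_n -> 'I_K.+1}) : {ffun 'I_n -> 'I_K.+1} :=
  [ffun i => inord (a i - (i == j))].
have dnE (a : {ffun 'I_n -> 'I_K.+1}) i : dn a i = (a i - (i == j))%N :> nat.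
  by rewrite ffunE inordK // (leq_ltn_trans (leq_subr _ _)).
have upE (b : {ffun 'I_n -> 'I_K.+1}) i : (b j < K)%N -> up b i = (b i + (i == j))%N :> nat.
  move=> bK; rewrite ffunE inordK //; case: eqP => [->|_].
    by rewrite addn1.
  by rewrite addn0.
have mlen_up (b : {ffun 'I_n -> 'I_K.+1}) : (b j < K)%N -> mlen (fun i => up b i) = (mlen (fun i => b i)).+1.
  move=> bK; rewrite /mlen; under eq_bigr do rewrite upE //.
  rewrite big_split /= -[RHS]addn1; congr (_ + _)%N.
  by rewrite -[RHS](big_pred1_eq addn j (fun=> 1%N)) [RHS]big_mkcond.
rewrite (reindex_onto up dn) /=; last first.
  move=> a /andP[_ aj]; apply/ffunP => i; apply/val_inj => /=.
  rewrite ffunE dnE inordK; first by case: eqP => [->|_]; lia.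
  by have := ltn_ord (a i); case: eqP => [->|_]; lia.
apply: eq_big => [b|b /andP[/andP[_ u0] /eqP ub]].
  have [bK|Kb] := ltnP (b j) K.
    rewrite mlen_up // upE // eqxx addn1 /= andbT ltnS.
    have -> : dn (up b) = b.
      by apply/ffunP => i; apply/val_inj => /=; rewrite dnE upE // addnK.
    by rewrite eqxx andbT.
  have -> : (up b j : nat) = 0%N.
    rewrite ffunE eqxx /inord /insubd insubF //.
    by apply/negbTE; rewrite -leqNgt addn1.
  rewrite ltnn andbF /=; apply/esym/negbTE; rewrite -leqNgt (leq_trans NK) //.
  by rewrite (leq_trans Kb) // /mlen (bigD1 j) //= leq_addr.
have bK : (b j < K)%N.
  rewrite ltnNge; apply/negP => Kb; move: u0.
  rewrite ffunE eqxx /inord /insubd insubF //.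
  by apply/negbTE; rewrite -leqNgt addn1.
have -> : (fun i => (up b i - (i == j))%N) = (fun i => b i : nat).
  by apply/funext => i; rewrite upE // addnK.
congr (_ * _); have -> : diff1 j f = diffw [:: j] f by [].
rewrite !diffsE -diffw_cat; congr (_ k); apply/diffw_perm/perm_word => i.
by rewrite count_cat !count_word /= addn0 upE // eq_sym.
Qed.

(** Newton's formula replaces the Taylor expansion: passing from [p] to
   [p + e_j] changes the remainder of order [N.+1] by a remainder of order [N]
   of a difference of [f]. *)
Lemma newton_remS K N p f k j : (N <= K)%N ->
  newton_rem K.+1 N.+1 (p + delta_mx 0 j) f k =
  newton_rem K.+1 N.+1 p f k + newton_rem K.+1 N p (diff1 j f) k.
Proof.
move=> NK; rewrite /newton_rem newtonS // addrA.
by rewrite -[diff1 j f (k + p)]/(f (k + p + delta_mx 0 j) - f (k + p)); ring.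
Qed.

Lemma newton_rem0 K p f k : newton_rem K 0 p f k = f (k + p).
Proof. by rewrite /newton_rem /newton big_pred0 ?subr0. Qed.

Lemma newton_rem_origin K N f k : newton_rem K.+1 N.+1 0 f k = 0.
Proof.
rewrite /newton_rem /newton (bigD1 [ffun=> ord0]) /=; last first.
  by rewrite /mlen big1 // => i _; rewrite ffunE.
rewrite big1 => [|a /andP[_ a0]].
  rewrite !addr0 newton_coefE big1 => [|i _]; last first.
    by rewrite ffunE /falling big_ord0 fact0 divr1.
  rewrite mul1r diffsE [word _]size0nil ?subrr // size_word /mlen big1 // => i _.
  by rewrite ffunE.
have [i ai] : exists i, a i != ord0.
  apply/existsP; rewrite -negb_forall; apply: contra a0 => /forallP a0.
  by apply/eqP/ffunP => i; rewrite ffunE; apply/eqP.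
rewrite newton_coefE (bigD1 i) //= mxE.
have : (a i != 0%N :> nat) by apply: contra ai => /eqP ai; apply/eqP/val_inj.
case: (nat_of_ord (a i)) => // l _.
by rewrite /falling big_ord_recl /= subrr !mul0r.
Qed.

End Newton.

(** * Moduli, and polynomial weights on the lattice *)

Lemma ler_expn {F : numDomainType} (x y : F) (M : nat) :
  0 <= x -> x <= y -> x ^+ M <= y ^+ M.
Proof. by move=> x0 xy; apply: lerXn2r; rewrite ?nnegrE // (le_trans x0). Qed.

Section Modulus.
Context {R : realType}.
Implicit Types (z w : R[i]).

Lemma cmod_ge0 z : 0 <= cmod z.
Proof. by case: z => a b; rewrite sqrtr_ge0. Qed.

Lemma cmod0 : cmod (0 : R[i]) = 0. Proof. exact: ComplexField.Normc.normc0. Qed.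
Lemma cmodM z w : cmod (z * w) = cmod z * cmod w.
Proof. exact: ComplexField.Normc.normcM. Qed.
Lemma cmodD z w : cmod (z + w) <= cmod z + cmod w.
Proof. exact: le_normcD. Qed.
Lemma cmodN z : cmod (- z) = cmod z.
Proof. exact: normcN. Qed.
Lemma cmodB z w : cmod (z - w) <= cmod z + cmod w.
Proof. by rewrite (le_trans (cmodD _ _)) // cmodN. Qed.
Lemma cmod1 : cmod (1 : R[i]) = 1. Proof. exact: ComplexField.Normc.normc1. Qed.
Lemma cmod_real (x : R) : cmod (x%:C)%C = `|x|.
Proof. by rewrite /cmod /= expr0n addr0 sqrtr_sqr. Qed.
Lemma intrC (z : int) : z%:~R = ((z%:~R : R)%:C)%C.
Proof. exact/esym/(rmorph_int (real_complex R)). Qed.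
Lemma cmod_int (z : int) : cmod (z%:~R : R[i]) = `|z%:~R|.
Proof. by rewrite intrC cmod_real. Qed.
Lemma cmod_nat (m : nat) : cmod (m%:R : R[i]) = m%:R.
Proof. by rewrite -[m%:R]/(m%:~R) cmod_int ger0_norm // ler0n. Qed.

Lemma cmod_prod (I : Type) (r : seq I) (P : pred I) (F : I -> R[i]) :
  cmod (\prod_(i <- r | P i) F i) = \prod_(i <- r | P i) cmod (F i).
Proof.
by elim/big_rec2: _ => [|i y x _ <-]; rewrite ?cmod1 ?cmodM.
Qed.

Lemma cmod_sum (I : Type) (r : seq I) (P : pred I) (F : I -> R[i]) :
  cmod (\sum_(i <- r | P i) F i) <= \sum_(i <- r | P i) cmod (F i).
Proof.
elim/big_rec2: _ => [|i y x _ h]; first by rewrite cmod0.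
by rewrite (le_trans (cmodD _ _)) // lerD2l.
Qed.

Lemma normRe z : `|complex.Re z| <= cmod z.
Proof.
by case: z => a b /=; rewrite -sqrtr_sqr ler_wsqrtr // lerDl sqr_ge0.
Qed.

Lemma normIm z : `|complex.Im z| <= cmod z.
Proof.
by case: z => a b /=; rewrite -sqrtr_sqr ler_wsqrtr // lerDr sqr_ge0.
Qed.

Lemma cmod_le z : cmod z <= `|complex.Re z| + `|complex.Im z|.
Proof.
case: z => a b /=; rewrite -[leRHS]ger0_norm ?addr_ge0 // -[leRHS]sqrtr_sqr.
rewrite /cmod /=; apply: ler_wsqrtr; rewrite sqrrD !real_normK ?num_real //.
by rewrite lerD2r lerDl mulrn_wge0 // mulr_ge0.
Qed.

Lemma ReD z w : complex.Re (z + w) = complex.Re z + complex.Re w.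
Proof. by case: z; case: w. Qed.
Lemma ImD z w : complex.Im (z + w) = complex.Im z + complex.Im w.
Proof. by case: z; case: w. Qed.
Lemma ReN z : complex.Re (- z) = - complex.Re z. Proof. by case: z. Qed.
Lemma ImN z : complex.Im (- z) = - complex.Im z. Proof. by case: z. Qed.
Lemma ReM z w : complex.Re (z * w) =
  complex.Re z * complex.Re w - complex.Im z * complex.Im w.
Proof. by case: z; case: w. Qed.
Lemma ImM z w : complex.Im (z * w) =
  complex.Re z * complex.Im w + complex.Im z * complex.Re w.
Proof. by case: z => a b; case: w => c d /=; rewrite addrC. Qed.

End Modulus.

Section Weight.
Context {R : realType} {n : nat}.
Implicit Types (k p q : 'rV[int]_n).

(** A product of one-dimensional weights: it is submultiplicative, comparable to
   a power of the Euclidean weight, and summable coordinate by coordinate. *)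
Definition Psi k : R := \prod_j (1 + `|(k 0 j)%:~R|).

Lemma Psi_ge1 k : 1 <= Psi k.
Proof.
by apply: (big_ind (fun x : R => 1 <= x)) => // [x y|j _];
   [exact: mulr_ege1 | rewrite lerDl].
Qed.

Lemma Psi_gt0 k : 0 < Psi k. Proof. exact: lt_le_trans (Psi_ge1 k). Qed.

Lemma PsiX_gt0 k (N : nat) : 0 < Psi k ^+ N. Proof. by rewrite exprn_gt0 // Psi_gt0. Qed.

Lemma PsiN k : Psi (- k) = Psi k.
Proof. by apply: eq_bigr => j _; rewrite mxE intrN normrN. Qed.

Lemma PsiD p q : Psi (p + q) <= Psi p * Psi q.
Proof.
rewrite /Psi -big_split /=; apply: ler_prod => j _.
rewrite addr_ge0 //= !mxE intrD (le_trans (_ : _ <= 1 + (`|(p 0 j)%:~R| + `|(q 0 j)%:~R|))) //.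
  by rewrite lerD2l ler_normD.
have := normr_ge0 ((p 0 j)%:~R : R); have := normr_ge0 ((q 0 j)%:~R : R).
set x := `|_|; set y := `|_| => x0 y0; have : 0 <= x * y by exact: mulr_ge0.
lra.
Qed.

Lemma PsiB p q : Psi (p - q) <= Psi p * Psi q.
Proof. by rewrite (le_trans (PsiD _ _)) // PsiN. Qed.

Lemma Psi0 : Psi 0 = 1.
Proof. by rewrite /Psi big1 // => j _; rewrite mxE normr0 addr0. Qed.

Lemma Psi_coord k j : 1 + `|(k 0 j)%:~R| <= Psi k.
Proof.
rewrite /Psi (bigD1 j) //= ler_peMr ?addr_ge0 //.
by apply: (big_ind (fun x : R => 1 <= x)) => // [x y|i _];
   [exact: mulr_ege1 | rewrite lerDl].
Qed.

Lemma Psi_step_abs k q j : `|(q 0 j)%:~R| = 1 + `|(k 0 j)%:~R| :> R ->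
  (forall i, i != j -> q 0 i = k 0 i) -> Psi k + 1 <= Psi q.
Proof.
move=> qj qi; rewrite /Psi (bigD1 j) //= [leRHS](bigD1 j) //= qj.
under [X in _ <= _ * X]eq_bigr => i ij do rewrite qi //.
set X := \prod_(i | _) _.
have X1 : 1 <= X.
  by apply: (big_ind (fun x : R => 1 <= x)) => // [x y|i _];
   [exact: mulr_ege1 | rewrite lerDl].
by rewrite [leRHS]mulrDl mul1r addrC lerD2r.
Qed.

Lemma Psi_up k j : 0 <= k 0 j -> Psi k + 1 <= Psi (k + delta_mx 0 j).
Proof.
move=> k0; apply: (@Psi_step_abs _ _ j) => [|i /negPf ij]; last first.
  by rewrite stepE ij addr0.
by rewrite stepE eqxx !ger0_norm ?ler0z ?addr_ge0 // intrD addrC.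
Qed.

Lemma Psi_down k j : k 0 j <= 0 -> Psi k + 1 <= Psi (k - delta_mx 0 j).
Proof.
move=> k0; have := @Psi_up (- k) j; rewrite mxE oppr_ge0 => /(_ k0).
by rewrite [- k + _]addrC -opprB !PsiN.
Qed.

(** Every lattice point is reached from the origin by unit steps that move each
   coordinate away from zero. *)
Lemma lattice_ind (P : 'rV[int]_n -> Prop) : P 0 ->
  (forall q j, 0 <= q 0 j -> P q -> P (q + delta_mx 0 j)) ->
  (forall q j, q 0 j <= 0 -> P q -> P (q - delta_mx 0 j)) ->
  forall q, P q.
Proof.
move=> P0 Pu Pd q.
have [m] := ubnP (\sum_j `|q 0%R j|)%N; elim: m q => // m IH q qm.
have [/eqP q0|] := boolP (q == 0); first by rewrite q0.
move=> qn0; have [j qj] : exists j, q 0 j != 0.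
  apply/existsP; rewrite -negb_forall; apply: contra qn0 => /forallP q0.
  by apply/eqP/rowP => i; rewrite mxE; apply/eqP.
have lt_sum (r : 'rV[int]_n) : (`|r 0%R j| < `|q 0%R j|)%N ->
    (forall i, i != j -> r 0 i = q 0 i) -> (\sum_j `|r 0%R j| < m)%N.
  move=> rj ri; rewrite -ltnS (leq_trans _ qm) // ltnS (bigD1 j) //=.
  rewrite [X in (_ <= X)%N](bigD1 j) //= -addSn leq_add //.
  by apply: leq_sum => i ij; rewrite ri.
have [q0|q0] := leP 0 (q 0 j).
- have q1 : 1 <= q 0 j by lia.
  rewrite -[q](subrK (delta_mx 0 j)); apply: Pu.
    by rewrite unstepE eqxx subr_ge0.
  apply: IH; apply: lt_sum => [|i /negPf ij]; last by rewrite unstepE ij subr0.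
  rewrite unstepE eqxx; move: (q 0 j) q1 => z z1.
  by have -> : z - true%:R = z - 1%Z by []; lia.
- rewrite -[q](addrK (delta_mx 0 j)); apply: Pd.
    rewrite stepE eqxx; move: (q 0 j) q0 => z z0.
    by have -> : z + true%:R = z + 1%Z by []; lia.
  apply: IH; apply: lt_sum => [|i /negPf ij]; last by rewrite stepE ij addr0.
  rewrite stepE eqxx; move: (q 0 j) q0 => z z0.
  by have -> : z + true%:R = z + 1%Z by []; lia.
Qed.

Lemma Psi_enorm k : 1 + enormZ k <= Psi k.
Proof.
suff H : \sum_j (k 0 j)%:~R ^+ 2 <= (Psi k - 1) ^+ 2.
  rewrite -lerBrDl /enormZ -[leRHS]ger0_norm ?subr_ge0 ?Psi_ge1 //.
  by rewrite -sqrtr_sqr ler_wsqrtr.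
suff [_] : 1 <= Psi k /\ \sum_j (k 0 j)%:~R ^+ 2 <= (Psi k - 1) ^+ 2 by [].
rewrite /Psi; apply: (big_ind2 (fun (x y : R) => 1 <= x /\ y <= (x - 1) ^+ 2)).
- by rewrite subrr expr0n.
- move=> x1 x2 y1 y2 [x11 h1] [y11 h2]; split; first exact: mulr_ege1.
  apply: le_trans (lerD h1 h2) _; have : 0 <= (x1 - 1) * (y1 - 1).
    by rewrite mulr_ge0 // subr_ge0.
  set a := x1 - 1; set b := y1 - 1 => ab0.
  have -> : x1 * y1 - 1 = a + b + a * b by rewrite /a /b; ring.
  have a0 : 0 <= a by rewrite subr_ge0.
  have b0 : 0 <= b by rewrite subr_ge0.
  rewrite -subr_ge0 (_ : _ - _ = a * b * (2 + 2 * (a + b) + a * b)); last by ring.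
  by rewrite mulr_ge0 // addr_ge0 // addr_ge0 // mulr_ge0 // addr_ge0.
- move=> j _; split; first by rewrite lerDl.
  by rewrite [1 + _]addrC addrK real_normK // num_real.
Qed.

Lemma enorm_Psi k : Psi k <= (1 + enormZ k) ^+ n.
Proof.
have -> : (1 + enormZ k : R) ^+ n = \prod_(j < n) (1 + enormZ k).
  by rewrite prodr_const card_ord.
apply: ler_prod => j _; rewrite addr_ge0 //= lerD2l -sqrtr_sqr ler_wsqrtr //.
by rewrite (bigD1 j) //= lerDl sumr_ge0 // => i _; rewrite sqr_ge0.
Qed.

(** This is the rapid decrease of the Schwartz space; the Euclidean weight is
   only replaced by [Psi]. *)
Definition rapid (f : 'rV[int]_n -> R[i]) : Prop :=
  forall M : nat, exists C : R, forall k, cmod (f k) <= C / Psi k ^+ M.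

Lemma rapidP f : rapidly_decreasing f <-> rapid f.
Proof.
split=> rf M.
  have [C hC] := rf (n * M)%N; exists C => k; rewrite (le_trans (hC k)) //.
  have C0 : 0 <= C.
    have := le_trans (cmod_ge0 _) (hC 0); rewrite pmulr_lge0 // invr_gt0.
    by rewrite exprn_gt0 // ltr_pwDl // sqrtr_ge0.
  rewrite ler_wpM2l // lef_pV2 ?posrE ?PsiX_gt0 ?exprn_gt0 //; last first.
    by rewrite ltr_pwDl // sqrtr_ge0.
  by rewrite exprM ler_expn ?enorm_Psi // ltW // Psi_gt0.
have [C hC] := rf M; exists C => k; rewrite (le_trans (hC k)) //.
have C0 : 0 <= C.
  have := le_trans (cmod_ge0 _) (hC 0); rewrite pmulr_lge0 // invr_gt0.
  exact: PsiX_gt0.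
rewrite ler_wpM2l // lef_pV2 ?posrE ?PsiX_gt0 ?exprn_gt0 //; last first.
  by rewrite ltr_pwDl // sqrtr_ge0.
by rewrite ler_expn ?Psi_enorm // addr_ge0 // sqrtr_ge0.
Qed.

(** Each unit step away from the origin costs one remainder of lower order, and
   the weight absorbs it since it grows by at least one along the step. *)
Lemma newton_rem_bound (K N L : nat) (B : R) k (f : 'rV[int]_n -> R[i]) :
  0 <= B -> (N <= K)%N ->
  (forall s q, size s = N -> cmod (diffw s f (k + q)) <= B * Psi q ^+ L) ->
  forall p, cmod (newton_rem K.+1 N p f k) <= B * Psi p ^+ (L + N).
Proof.
move=> B0; elim: N f => [|N IH] f NK hf p.
  by rewrite newton_rem0 addn0; exact: (hf [::]).
have hstep j q : cmod (newton_rem K.+1 N q (diff1 j f) k) <= B * Psi q ^+ (L + N).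
  apply: IH => [|s r sN]; first exact: ltnW.
  by rewrite -diff1_diffw; apply: (hf (j :: s)); rewrite /= sN.
have grow q q' : Psi q + 1 <= Psi q' ->
    Psi q ^+ (L + N.+1) + Psi q' ^+ (L + N) <= Psi q' ^+ (L + N.+1).
  move=> qq'; rewrite addnS !exprS -lerBrDr -[X in _ - X]mul1r -mulrBl.
  apply: ler_pM; rewrite ?exprn_ge0 ?(ltW (Psi_gt0 _)) ?lerBrDr //.
  rewrite ler_expn ?(ltW (Psi_gt0 _)) //.
  by rewrite (le_trans _ qq') // lerDl.
elim/lattice_ind: p => [|q j qj hq|q j qj hq].
- by rewrite newton_rem_origin cmod0 mulr_ge0 // ltW // PsiX_gt0.
- rewrite newton_remS; last exact: ltnW.
  rewrite (le_trans (cmodD _ _)) // (le_trans (lerD hq (hstep j q))) // -mulrDr.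
  have Pq := Psi_up qj.
  rewrite ler_wpM2l // (le_trans _ (grow _ _ Pq)) // lerD2l.
  rewrite ler_expn ?(ltW (Psi_gt0 _)) //.
  by rewrite (le_trans _ Pq) // lerDl.
- have := newton_remS (q - delta_mx 0 j) f k j (ltnW NK).
  rewrite subrK => E; have {E}-> : newton_rem K.+1 N.+1 (q - delta_mx 0 j) f k =
      newton_rem K.+1 N.+1 q f k - newton_rem K.+1 N (q - delta_mx 0 j) (diff1 j f) k.
    by rewrite E addrK.
  rewrite (le_trans (cmodB _ _)) // (le_trans (lerD hq (hstep j _))) // -mulrDr.
  by rewrite ler_wpM2l // grow // Psi_down.
Qed.

End Weight.

(** * Temperance of the weight function *)

Section Peetre.
Context {R : realType} {n : nat}.
Variables (mu : R) (Lambda : 'rV[int]_n -> R).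
Hypothesis hL : weight_function mu Lambda.

Lemma Lambda_gt0 k : 0 < Lambda k. Proof. by case: hL. Qed.

Lemma mu_gt0 : 0 < mu.
Proof.
have [_ [mu0 [mu1 [C0 [C1 [[h1 h2 h3 _ _] _ _]]]]]] := hL.
by rewrite (lt_le_trans h1) // (le_trans h2).
Qed.

Lemma Lambda_lb : exists2 c : R, 0 < c & forall k, c <= Lambda k.
Proof.
have [_ [mu0 [mu1 [C0 [C1 [[h1 h2 h3 h4 _] hb _]]]]]] := hL.
exists C0 => // k; have /andP[h _] := hb k; apply: le_trans h.
rewrite ler_peMr ?(ltW h4) // -[leLHS](powRr0 (1 + enormZ k)).
by apply: ler_powR; rewrite ?(ltW h1) // lerDl sqrtr_ge0.
Qed.

Lemma Lambda_step : exists2 C : R, 0 < C & forall (k : 'rV[int]_n) (j : 'I_n),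
  `|Lambda (k + delta_mx 0 j) - Lambda k| <= C * Lambda k `^ (1 - mu^-1).
Proof.
have [_ [mu0 [mu1 [C0 [C1 [_ _ hd]]]]]] := hL.
have {}hd (j : 'I_n) : exists C : R, 0 < C /\ forall k,
    `|Lambda (k + delta_mx 0 j) - Lambda k| <= C * Lambda k `^ (1 - mu^-1).
  have [C C_gt0 hC] := hd (fun i => (i == j) : nat) (fun=> false).
  exists C; split=> // k; have := hC k.
  have -> : kpow k (fun=> false) = 1 by rewrite /kpow big1.
  rewrite mul1r diffsE (@diffw_perm _ _ _ [:: j]) /=; last first.
    apply: perm_word => i; rewrite count_word /= addn0 addn0.
    by rewrite eq_sym.
  have -> : mlen (fun i => (i == j) : nat) = 1%N.
    by rewrite /mlen (bigD1 j) //= eqxx big1 // => i /negPf ->.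
  by rewrite div1r.
have [C hC] := choice hd.
exists (1 + \sum_j C j) => [|k j].
  by rewrite ltr_pwDl // sumr_ge0 // => j _; have [/ltW] := hC j.
have [_ h] := hC j; rewrite (le_trans (h k)) // ler_wpM2r ?powR_ge0 //.
rewrite (bigD1 j) //= addrCA lerDl addr_ge0 // sumr_ge0 // => i _.
by have [/ltW] := hC i.
Qed.

(** A root of the weight of integral order is Lipschitz along unit steps: from
   [a ^+ K - b ^+ K] one factors out [a - b], and what remains is at least
   [b ^+ K.-1]. *)
Lemma Lambda_root : exists K : nat, exists2 w : 'rV[int]_n -> R,
  [/\ forall k, 0 < w k, forall k, w k ^+ K = Lambda k &
      exists2 d : R, 0 < d & forall k, d <= w k] &
  exists2 C : R, 0 < C & forall (k : 'rV[int]_n) (j : 'I_n), `|w (k + delta_mx 0 j) - w k| <= C.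
Proof.
have [c c0 hc] := Lambda_lb; have [C C0 hC] := Lambda_step.
(* an integral exponent above [mu]: the weight is bounded below, so that roots
   of higher order remain Lipschitz *)
pose K := (Num.truncn mu).+1.
have K0 : (0 : R) < K%:R by rewrite ltr0n.
have muK : K%:R^-1 <= mu^-1.
  rewrite lef_pV2 ?posrE ?mu_gt0 // ltW //.
  by have := truncnS_gt mu.
pose w k := Lambda k `^ K%:R^-1.
have w0 k : 0 < w k by rewrite powR_gt0 ?Lambda_gt0.
have wK k : w k ^+ K = Lambda k.
  rewrite -powR_mulrn ?ltW // -powRrM mulVf ?gt_eqF // powRr1 //.
  exact/ltW/Lambda_gt0.
exists K; exists w.
  split=> //; exists (c `^ K%:R^-1) => [|k]; first by rewrite powR_gt0.
  by apply: ge0_ler_powR; rewrite ?nnegrE ?invr_ge0 // ltW // Lambda_gt0.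
pose D := c `^ (K%:R^-1 - mu^-1).
exists (C * D) => [|k j]; first by rewrite mulr_gt0 // powR_gt0.
have := hC k j; rewrite -!wK subrXX normrM.
have wl : Lambda k `^ (1 - mu^-1) <= D * w k ^+ K.-1.
  rewrite -powR_mulrn ?(ltW (w0 k)) // -powRrM.
  have -> : (1 : R) - mu^-1 = (K%:R^-1 - mu^-1) + K%:R^-1 * K.-1%:R.
    have -> : K.-1%:R = K%:R - 1 :> R by rewrite -(natrB _ (ltn0Sn _)) subn1.
    by rewrite mulrBr mulVf ?gt_eqF // mulr1; ring.
  rewrite powRD; last by rewrite (gt_eqF (Lambda_gt0 k)) implybT.
  rewrite ler_wpM2r ?powR_ge0 //.
  have le2 : c `^ (mu^-1 - K%:R^-1) <= Lambda k `^ (mu^-1 - K%:R^-1).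
    apply: ge0_ler_powR; rewrite ?nnegrE ?subr_ge0 //; first exact: ltW.
    exact/ltW/Lambda_gt0.
  by rewrite /D -opprB (powRN (Lambda k)) (powRN c) lef_pV2 // posrE powR_gt0 ?Lambda_gt0.
move=> h; rewrite -(ler_pM2r (exprn_gt0 K.-1 (w0 k))) -[leRHS]mulrA.
have h2 : C * (w k ^+ K) `^ (1 - mu^-1) <= C * (D * w k ^+ K.-1).
  by rewrite wK ler_wpM2l // ltW.
apply: le_trans (le_trans h h2); rewrite ler_wpM2l // ger0_norm; last first.
  by rewrite sumr_ge0 // => i _; rewrite mulr_ge0 ?exprn_ge0 // ltW.
rewrite big_ord_recr /= subnn expr0 mul1r lerDr sumr_ge0 // => i _.
by rewrite mulr_ge0 ?exprn_ge0 // ltW.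
Qed.

Lemma Lambda_temperate_pos : exists K : nat, exists2 C : R, 1 <= C &
  forall k q : 'rV[int]_n, Lambda (k + q) <= C * Psi q ^+ K * Lambda k.
Proof.
have [K [w [w0 wK [d d0 hd]] [C C0 hC]]] := Lambda_root.
have lip (k q : 'rV[int]_n) : `|w (k + q) - w k| <= C * Psi q.
  suff : `|w (k + q) - w k| <= C * (Psi q - 1).
    by move=> /le_trans; apply; rewrite ler_wpM2l ?(ltW C0) // gerBl.
  move: q; apply: (@lattice_ind n) => [|q j qj h|q j qj h].
  - by rewrite addr0 subrr normr0 Psi0 subrr mulr0.
  - rewrite addrA -(subrK (w (k + q)) (w (k + q + _))) -addrA (le_trans (ler_normD _ _)) //.
    rewrite (le_trans (lerD (hC _ _) h)) // -[X in X + _]mulr1 -mulrDr.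
    by rewrite ler_wpM2l ?(ltW C0) // addrCA subrr addr0 lerBrDr Psi_up.
  - have := hC (k + (q - delta_mx 0 j)) j.
    rewrite -addrA subrK distrC => h'.
    rewrite -(subrK (w (k + q)) (w (k + _))) -addrA (le_trans (ler_normD _ _)) //.
    rewrite (le_trans (lerD h' h)) // -[X in X + _]mulr1 -mulrDr.
    by rewrite ler_wpM2l ?(ltW C0) // addrCA subrr addr0 lerBrDr Psi_down.
exists K; exists ((1 + C / d) ^+ K) => [|k q].
  by rewrite exprn_ege1 // lerDl divr_ge0 // ltW.
rewrite -!wK -!exprMn ler_expn ?(ltW (w0 _)) //.
have := le_trans (ler_norm _) (lip k q); rewrite lerBlDr => /le_trans; apply.
rewrite -mulrA mulrDl mul1r addrC lerD //.
  by rewrite ler_peMl ?Psi_ge1 // ltW.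
rewrite (_ : C / d * (Psi q * w k) = C * Psi q * (w k / d)); last by ring.
rewrite ler_peMr ?mulr_ge0 ?(ltW C0) ?(ltW (Psi_gt0 _)) //.
by rewrite ler_pdivlMr // mul1r.
Qed.

(** Peetre's inequality. The root of the weight is Lipschitz and bounded below, so
   a translation by [q] multiplies it by at most a constant times [Psi q];
   exchanging [k] and [k + q] covers the negative powers. *)
Lemma Lambda_temperate (s : R) : exists K : nat, exists2 C : R, 0 < C &
  forall k q : 'rV[int]_n, Lambda (k + q) `^ s <= C * Psi q ^+ K * Lambda k `^ s.
Proof.
have [K [C C1 hC]] := Lambda_temperate_pos.
have C0 : 0 < C by exact: lt_le_trans C1.
pose N := (Num.truncn (K%:R * `|s|)).+1.
have hN : K%:R * `|s| <= N%:R by apply/ltW/truncnS_gt.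
have main k q : Lambda (k + q) `^ `|s| <= C `^ `|s| * Psi q ^+ N * Lambda k `^ `|s|.
  apply: (@le_trans _ _ ((C * Psi q ^+ K * Lambda k) `^ `|s|)).
    apply: ge0_ler_powR; rewrite ?nnegrE ?(ltW (Lambda_gt0 _)) //.
    by rewrite !mulr_ge0 ?(ltW (Lambda_gt0 _)) ?(ltW (PsiX_gt0 _ _)) ?ltW.
  rewrite !powRM ?mulr_ge0 ?(ltW (Lambda_gt0 _)) ?(ltW (PsiX_gt0 _ _)) ?(ltW C0) //.
  rewrite ler_wpM2r ?powR_ge0 // ler_wpM2l ?powR_ge0 //.
  rewrite -!powR_mulrn ?(ltW (Psi_gt0 _)) // -powRrM.
  by rewrite ler_powR ?Psi_ge1.
exists N; exists (C `^ `|s|) => [|k q]; first by rewrite powR_gt0.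
have [s0|s0] := leP 0 s; first by have := main k q; rewrite ger0_norm.
have := main (k + q) (- q); rewrite addrK PsiN (ltr0_norm s0) (powRN (Lambda k)).
rewrite (powRN (Lambda (k + q))); set A := Lambda k `^ s; set B := _ `^ s.
have A0 : 0 < A by rewrite powR_gt0 ?Lambda_gt0.
have B0 : 0 < B by rewrite powR_gt0 ?Lambda_gt0.
by rewrite ler_pdivlMr // mulrC ler_pdivrMr.
Qed.

End Peetre.

(** * Absolutely convergent sums over the lattice *)

Section Sums.
Context {R : realType} {n : nat}.
Local Notation Zn := 'rV[int]_n.
Implicit Types (f g : Zn -> R[i]) (w h : Zn -> R) (s : seq Zn).
Local Open Scope classical_set_scope.

(** Bounds on finite partial sums are all that the arguments below use of
   summability. *)
Definition sum_le w (B : R) : Prop :=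
  (forall k, 0 <= w k) /\ forall s, uniq s -> \sum_(k <- s) w k <= B.

Lemma sum_le_ge0 w B : sum_le w B -> 0 <= B.
Proof. by case=> _ /(_ [::] isT); rewrite big_nil. Qed.

Lemma sum_le_scale w B (c : R) : 0 <= c -> sum_le w B ->
  sum_le (fun k => c * w k) (c * B).
Proof.
move=> c0 [w0 wB]; split=> [k|s us]; first by rewrite mulr_ge0.
by rewrite -mulr_sumr ler_wpM2l // wB.
Qed.

(** If the partial sum over [s0] is within [e] of the supremum, any disjoint
   finite set contributes at most [e]. *)
Lemma sum_tail w B : sum_le w B -> forall e : R, 0 < e ->
  exists2 s0, uniq s0 &
    forall s, uniq s -> ~~ has (mem s0) s -> \sum_(k <- s) w k <= e.
Proof.
move=> [w0 wB] e e0.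
pose E : set R := [set x | exists2 s, uniq s & x = \sum_(k <- s) w k].
have hE : has_sup E.
  split; first by exists 0; exists [::]; rewrite ?big_nil.
  by exists B => x [s us ->]; exact: wB.
have [_ [s0 us0 ->] hs0] := sup_adherent e0 hE.
exists s0 => // s us ss0.
have := ub_le_sup (proj2 hE) (_ : E (\sum_(k <- s0 ++ s) w k)) .
rewrite big_cat /= => H; rewrite -(lerD2l (\sum_(k <- s0) w k)).
apply: (le_trans (H _)); last by rewrite -lerBlDr ltW.
by exists (s0 ++ s); rewrite ?cat_uniq ?us0 ?us ?ss0 ?big_cat.
Qed.

Lemma esum_dom w h (s0 : seq Zn) (B e : R) : sum_le w B -> 0 <= e ->
  (forall s, uniq s -> ~~ has (mem s0) s -> \sum_(k <- s) w k <= e) ->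
  (forall k, 0 <= h k <= w k) ->
  forall s, uniq s -> {subset s0 <= s} ->
  `|fine (\esum_(k in [set: Zn]) (h k)%:E) - \sum_(k <- s) h k| <= e.
Proof.
move=> [w0 wB] e0 tail hw s us s0s.
have h0 k : 0 <= h k by have /andP[] := hw k.
have lb : ((\sum_(k <- s) h k)%:E <= \esum_(k in [set: Zn]) (h k)%:E)%E.
  apply: esum_ge; exists [set` s]; first by split=> //; exact: finite_seq.
  by rewrite -fsbig_seq // sumEFin.
have ub : (\esum_(k in [set: Zn]) (h k)%:E <= (\sum_(k <- s) h k + e)%:E)%E.
  apply: ub_ereal_sup => _ [A [fA _] <-].
  rewrite fsbig_finite //= sumEFin lee_fin.
  rewrite (bigID (mem s)) /= lerD //.
    rewrite -big_filter; set t := [seq i <- _ | _]; have tu : uniq t by rewrite filter_uniq ?finmap.fset_uniq.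
    have ts : {subset t <= s} by move=> k; rewrite mem_filter => /andP[].
    have -> : \sum_(i <- t) h i = \sum_(i <- s | i \in t) h i.
      rewrite -[RHS]big_filter; apply: perm_big; apply: uniq_perm => //.
        exact: filter_uniq.
      move=> k; rewrite [RHS]mem_filter.
      by apply/idP/andP => [kt|[]//]; split=> //; apply: ts.
    by rewrite big_mkcond; apply: ler_sum => k _; case: ifP.
  rewrite -big_filter; apply: le_trans (tail _ _ _).
  - by apply: ler_sum => k _; have /andP[] := hw k.
  - by apply: filter_uniq; exact: finmap.fset_uniq.
  - apply/hasPn => k; rewrite mem_filter => /andP[ks _].
    by apply: contra ks => /s0s.
have fin : \esum_(k in [set: Zn]) (h k)%:E \is a fin_num.
  by apply: (fin_real _); rewrite (lt_le_trans _ lb) ?ltNyr // (le_lt_trans ub) ?ltry.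
rewrite -(fineK fin) !lee_fin in lb ub.
by rewrite ger0_norm ?subr_ge0 // lerBlDl.
Qed.

Lemma sumZr_dom w h (s0 : seq Zn) (B e : R) : sum_le w B -> 0 <= e ->
  (forall s, uniq s -> ~~ has (mem s0) s -> \sum_(k <- s) w k <= e) ->
  (forall k, `|h k| <= w k) ->
  forall s, uniq s -> {subset s0 <= s} ->
  `|sumZr h - \sum_(k <- s) h k| <= e + e.
Proof.
move=> wB e0 tail hw s us s0s; rewrite /sumZr.
have -> : \sum_(k <- s) h k =
    \sum_(k <- s) Num.max (h k) 0 - \sum_(k <- s) Num.max (- h k) 0.
  rewrite -sumrB; apply: eq_bigr => k _.
  by case: (ltP (h k) 0) => ?; case: (ltP (- h k) 0) => ?; lra.
set E1 := fine _; set E2 := fine _; set S1 := \sum_(k <- s) _; set S2 := \sum_(k <- s) _.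
have -> : E1 - E2 - (S1 - S2) = (E1 - S1) - (E2 - S2) by ring.
have H1 := @esum_dom w (fun k => Num.max (h k) 0) s0 B e wB e0 tail.
have H2 := @esum_dom w (fun k => Num.max (- h k) 0) s0 B e wB e0 tail.
apply: le_trans (ler_normD _ _) _; rewrite normrN; apply: lerD.
  apply: H1 => // k; have := hw k; rewrite ler_norml => /andP[h1 h2].
  by case: (ltP (h k) 0) => ?; lra.
apply: H2 => // k; have := hw k; rewrite ler_norml => /andP[h1 h2].
by case: (ltP (- h k) 0) => ?; lra.
Qed.

(** Finite partial sums approximate all the families dominated by multiples of
   one summable weight, at a rate that depends on the weight only. *)
Lemma sumZ_dom w B : sum_le w B -> forall e : R, 0 < e ->
  exists2 s0, uniq s0 & forall (c : R) f, 0 <= c ->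
    (forall k, cmod (f k) <= c * w k) ->
    forall s, uniq s -> {subset s0 <= s} ->
    cmod (sumZ f - \sum_(k <- s) f k) <= c * e.
Proof.
move=> wB e e0.
(* the sum consists of four one-sided real sums *)
have e40 : 0 < e / 4 by rewrite divr_gt0.
have [s0 us0 tail] := sum_tail wB e40.
exists s0 => // c f c0 fw s us s0s.
have tail' t : uniq t -> ~~ has (mem s0) t ->
    \sum_(k <- t) c * w k <= c * (e / 4).
  by move=> ut ht; rewrite -mulr_sumr ler_wpM2l // tail.
have ce : 0 <= c * (e / 4) by rewrite mulr_ge0 // ltW.
have Re_sum : complex.Re (\sum_(k <- s) f k) = \sum_(k <- s) complex.Re (f k).
  by elim/big_rec2: _ => // k y x _ <-; rewrite ReD.
have Im_sum : complex.Im (\sum_(k <- s) f k) = \sum_(k <- s) complex.Im (f k).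
  by elim/big_rec2: _ => // k y x _ <-; rewrite ImD.
apply: le_trans (cmod_le _) _; rewrite ReD ImD ReN ImN Re_sum Im_sum /=.
have H1 := sumZr_dom (sum_le_scale c0 wB) ce tail'
  (fun k => le_trans (normRe (f k)) (fw k)) us s0s.
have H2 := sumZr_dom (sum_le_scale c0 wB) ce tail'
  (fun k => le_trans (normIm (f k)) (fw k)) us s0s.
apply: le_trans (lerD H1 H2) _; rewrite le_eqVlt; apply/orP; left; apply/eqP.
by field.
Qed.

Definition summable_by w f : Prop := forall k, cmod (f k) <= w k.

Lemma cmod_eq0_eps (z : R[i]) : (forall e : R, 0 < e -> cmod z <= e) -> z = 0.
Proof.
move=> H; apply: ComplexField.Normc.eq0_normc; apply/eqP.
rewrite -[_ == _]/(cmod z == 0) eq_le cmod_ge0 andbT.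
by apply/ler_addgt0Pr => e e0; rewrite add0r H.
Qed.

Lemma sumZ_approx1 w B f : sum_le w B -> summable_by w f ->
  forall e : R, 0 < e -> exists2 s0, uniq s0 &
    forall s, uniq s -> {subset s0 <= s} ->
    cmod (sumZ f - \sum_(k <- s) f k) <= e.
Proof.
move=> wB fw e e0; have [s0 us0 H] := sumZ_dom wB e0.
exists s0 => // s us ss; rewrite -[e]mul1r; apply: H => // k.
by rewrite mul1r.
Qed.

(** Sums are characterized by their finite approximations, which reduces linearity
   and reindexing to finite sums. *)
Lemma sumZ_eq w B f (z : R[i]) : sum_le w B -> summable_by w f ->
  (forall e : R, 0 < e -> exists s0 : seq Zn,
    forall s, uniq s -> {subset s0 <= s} -> cmod (z - \sum_(k <- s) f k) <= e) ->
  sumZ f = z.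
Proof.
move=> wB fw H; apply/eqP; rewrite -subr_eq0; apply/eqP.
apply: cmod_eq0_eps => e e0; have e20 : 0 < e / 2 by rewrite divr_gt0.
have [s1 us1 H1] := sumZ_approx1 wB fw e20; have [s2 H2] := H _ e20.
pose s := undup (s1 ++ s2).
have s1s : {subset s1 <= s} by move=> k; rewrite mem_undup mem_cat => ->.
have s2s : {subset s2 <= s} by move=> k; rewrite mem_undup mem_cat orbC => ->.
have h1 := H1 s (undup_uniq _) s1s; have h2 := H2 s (undup_uniq _) s2s.
rewrite -(subrKA (\sum_(k <- s) f k)) -[X in _ + X]opprB.
apply: le_trans (cmodB _ _) _; rewrite (splitr e) lerD //.
Qed.

Lemma sumZ_bound w B f : sum_le w B -> summable_by w f -> cmod (sumZ f) <= B.
Proof.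
move=> wB fw; apply/ler_addgt0Pr => e e0.
have [s us /(_ s us (fun _ => id)) H] := sumZ_approx1 wB fw e0.
rewrite -[sumZ f](subrK (\sum_(k <- s) f k)) addrC.
apply: le_trans (cmodD _ _) _; rewrite lerD //.
apply: le_trans (cmod_sum _ _ _) _; apply: le_trans (_ : \sum_(k <- s) w k <= _).
  by apply: ler_sum => k _; exact: fw.
by case: wB => _; apply.
Qed.

Lemma sumZ_lin w B f g (c : R[i]) : sum_le w B -> summable_by w f ->
  summable_by w g -> sumZ (fun k => c * f k + g k) = c * sumZ f + sumZ g.
Proof.
move=> wB fw gw; have c0 := cmod_ge0 c.
have c1 : 0 <= cmod c + 1 by rewrite addr_ge0.
apply: (sumZ_eq (sum_le_scale c1 wB)) => [k|e e0].
  apply: le_trans (cmodD _ _) _; rewrite cmodM mulrDl mul1r lerD // ler_wpM2l //.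
have d0 : 0 < e / (cmod c + 1) by rewrite divr_gt0 // ltr_wpDl.
have [s0 us0 H] := sumZ_dom wB d0; exists s0 => s us ss.
have hf := H 1 f ler01 (fun k => eq_ind_r (fun x => _ <= x) (fw k) (mul1r _)) s us ss.
have hg := H 1 g ler01 (fun k => eq_ind_r (fun x => _ <= x) (gw k) (mul1r _)) s us ss.
rewrite !mul1r in hf hg.
rewrite big_split /= -mulr_sumr opprD addrACA -mulrBr.
apply: le_trans (cmodD _ _) _; rewrite cmodM.
apply: le_trans (lerD (ler_wpM2l c0 hf) hg) _.
by rewrite -[X in _ + X]mul1r -mulrDl mulrCA divff ?mulr1 // gt_eqF // ltr_wpDl.
Qed.

Lemma sumZZ w B f (c : R[i]) : sum_le w B -> summable_by w f ->
  sumZ (fun k => c * f k) = c * sumZ f.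
Proof.
move=> wB fw; have := sumZ_lin (-1) wB fw fw; rewrite mulN1r addNr => E0.
have E1 : sumZ (fun _ : Zn => 0 : R[i]) = 0.
  by rewrite -E0; congr sumZ; apply/funext => k; rewrite mulN1r addNr.
have g0 : summable_by w (fun=> 0).
  by move=> k; rewrite cmod0; case: wB.
rewrite -[RHS]addr0 -E1 -(sumZ_lin c wB fw g0).
by congr sumZ; apply/funext => k; rewrite addr0.
Qed.

Lemma sumZB w B f g : sum_le w B -> summable_by w f ->
  summable_by w g -> sumZ (fun k => f k - g k) = sumZ f - sumZ g.
Proof.
move=> wB fw gw; rewrite -[- sumZ g]mulN1r addrC -(sumZ_lin (-1) wB gw fw).
by congr sumZ; apply/funext => k; rewrite mulN1r addrC.
Qed.

Lemma sumZ_fubini_approx (w1 w2 : Zn -> R) (B1 B2 e : R) : sum_le w1 B1 ->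
  sum_le w2 B2 -> 0 < e ->
  exists s1 s2 : seq Zn, [/\ uniq s1, uniq s2 & forall t1 t2 : seq Zn,
   uniq t1 -> uniq t2 -> {subset s1 <= t1} -> {subset s2 <= t2} ->
   forall a : Zn -> Zn -> R[i], (forall k l, cmod (a k l) <= w1 k * w2 l) ->
   cmod (sumZ (fun k => sumZ (a k)) - \sum_(k <- t1) \sum_(l <- t2) a k l)
     <= (B1 + B2) * e].
Proof.
move=> w1B w2B e0; have [s1 us1 H1] := sumZ_dom w1B e0.
have [s2 us2 H2] := sumZ_dom w2B e0; exists s1; exists s2; split=> //.
move=> t1 t2 ut1 ut2 st1 st2 a ha.
have [w10 w1s] := w1B; have B20 := sum_le_ge0 w2B.
have hA k : cmod (sumZ (a k)) <= B2 * w1 k.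
  by rewrite mulrC; apply: (sumZ_bound (sum_le_scale (w10 k) w2B)) => l; exact: ha.
rewrite -(subrKA (\sum_(k <- t1) sumZ (a k))) mulrDl addrC.
apply: le_trans (cmodD _ _) _; apply: lerD; last exact: H1.
rewrite -sumrB; apply: le_trans (cmod_sum _ _ _) _.
apply: (@le_trans _ _ (\sum_(k <- t1) w1 k * e)).
  by apply: ler_sum => k _; apply: H2 => // l; exact: ha.
by rewrite -mulr_suml ler_wpM2r ?(ltW e0) // w1s.
Qed.

(** Fubini's theorem for families dominated by a product of summable weights:
   both iterated sums are approximated by the same finite double sums. *)
Lemma sumZ_exchange (w1 w2 : Zn -> R) (B1 B2 : R) (a : Zn -> Zn -> R[i]) :
  sum_le w1 B1 -> sum_le w2 B2 ->
  (forall k l, cmod (a k l) <= w1 k * w2 l) ->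
  sumZ (fun k => sumZ (a k)) = sumZ (fun l => sumZ (a^~ l)).
Proof.
move=> w1B w2B ha; apply/eqP; rewrite -subr_eq0; apply/eqP.
apply: cmod_eq0_eps => e e0; pose D := 2 * (B1 + B2) + 1.
have D0 : 0 < D.
  by rewrite ltr_wpDl // mulr_ge0 // addr_ge0 // (sum_le_ge0 w1B, sum_le_ge0 w2B).
have d0 : 0 < e / D by rewrite divr_gt0.
have [s1 [s2 [us1 us2 H]]] := sumZ_fubini_approx w1B w2B d0.
have [r2 [r1 [ur2 ur1 H']]] := sumZ_fubini_approx w2B w1B d0.
pose t1 := undup (s1 ++ r1); pose t2 := undup (s2 ++ r2).
have sub1 (s r : seq Zn) : {subset s <= undup (s ++ r)}.
  by move=> k ks; rewrite mem_undup mem_cat ks.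
have sub2 (s r : seq Zn) : {subset r <= undup (s ++ r)}.
  by move=> k ks; rewrite mem_undup mem_cat ks orbT.
have h := H t1 t2 (undup_uniq _) (undup_uniq _) (sub1 _ _) (sub1 _ _) a ha.
have ha' k l : cmod (a^~ k l) <= w2 k * w1 l by rewrite mulrC.
have h' := H' t2 t1 (undup_uniq _) (undup_uniq _) (sub2 _ _) (sub2 _ _) (fun l k => a k l) ha'.
rewrite exchange_big /= in h'.
rewrite -(subrKA (\sum_(k <- t1) \sum_(l <- t2) a k l)) -[X in _ + X]opprB.
apply: le_trans (cmodB _ _) _; apply: le_trans (lerD h h') _.
have -> : (B1 + B2) * (e / D) + (B2 + B1) * (e / D) = (D - 1) * (e / D).
  by rewrite /D; ring.
by rewrite mulrCA ler_piMr ?(ltW e0) // ler_pdivrMr // mul1r gerBl.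
Qed.

End Sums.

Section SummableWeight.
Context {R : realType}.

(** Telescoping: [(x + 1) ^- 2 <= x^-1 - (x + 1)^-1], on both sides of the origin. *)
Lemma sum_inv_sq (L : nat) :
  \sum_(i < (2 * L).+1) (1 + `|(i%:Z - L%:Z)%:~R|) ^- 2 <= 3 - 2 / (1 + L%:R) :> R.
Proof.
elim: L => [|L IH].
  rewrite big_ord_recl big_ord0 /= subrr normr0 !addr0 expr1n invr1; lra.
have -> : (2 * L.+1).+1 = (2 * L).+3 by rewrite mulnS.
rewrite big_ord_recl big_ord_recr /=.
have E (i : 'I_(2 * L).+1) : ((bump 0 i)%:Z - L.+1%:Z) = i%:Z - L%:Z.
  by rewrite /bump leq0n; lia.
under eq_bigr do rewrite E.
have -> : (bump 0 (2 * L).+1)%:Z - L.+1%:Z = L.+1%:Z by rewrite /bump leq0n; lia.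
rewrite sub0r intrN normrN !ger0_norm ?ler0z //.
have h : 0 < 1 + L%:R :> R by rewrite ltr_pwDl.
rewrite -pmulrn -(natr1 L); set x := 1 + L%:R in IH h *.
have -> : 1 + (L%:R + 1) = x + 1 by rewrite /x; ring.
apply: le_trans (_ : (x + 1)^-2 + (3 - 2 / x + (x + 1) ^- 2) <= _).
  by rewrite lerD2l lerD2r.
rewrite -subr_ge0.
have -> : 3 - 2 / (x + 1) - ((x + 1) ^- 2 + (3 - 2 / x + (x + 1) ^- 2)) =
  2 / (x * (x + 1) ^+ 2).
  by field; rewrite !gt_eqF // ltr_wpDr.
by rewrite divr_ge0 // mulr_ge0 ?exprn_ge0 ?addr_ge0 // ltW.
Qed.

(** A finite set of lattice points lies in a box, over which the sum of a product
   is the product of the one-dimensional sums. *)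
Lemma sum_Psi (n : nat) :
  sum_le (fun k : 'rV[int]_n => (Psi k ^- 2 : R)) (3 ^+ n).
Proof.
split=> [k|s us]; first by rewrite invr_ge0 exprn_ge0 // ltW // Psi_gt0.
pose L := (\max_(k <- s) \max_j `|k 0%R j|)%N.
have hL k j : k \in s -> (`|k 0%R j| <= L)%N.
  move=> ks; apply: leq_trans (leq_bigmax_seq (F := fun k : 'rV[int]_n => (\max_j `|k 0%R j|)%N) k ks isT).
  exact: (leq_bigmax (F := fun j => `|k 0%R j|%N)).
pose pt (a : {ffun 'I_n -> 'I_(2 * L).+1}) : 'rV[int]_n := \row_j ((a j)%:Z - L%:Z).
have pt_inj : injective pt.
  move=> a b /rowP ab; apply/ffunP => j; apply/val_inj; have := ab j.
  by rewrite !mxE => /addIr [].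
pose bx := [seq pt a | a <- enum {: {ffun 'I_n -> 'I_(2 * L).+1}}].
have ubx : uniq bx by rewrite map_inj_uniq ?enum_uniq.
have sbx : {subset s <= bx}.
  move=> k ks; apply/mapP; exists [ffun j => inord (absz (k 0 j + L%:Z))].
    by rewrite mem_enum.
  apply/rowP => j; rewrite mxE ffunE inordK; have := hL k j ks; move: (k 0 j) => z; lia.
have -> : \sum_(k <- s) Psi k ^- 2 = \sum_(k <- bx | k \in s) (Psi k ^- 2 : R).
  rewrite -[RHS]big_filter; apply: perm_big; apply: uniq_perm => //.
    exact: filter_uniq.
  move=> k; rewrite [RHS]mem_filter.
  by apply/idP/andP => [ks|[]//]; split=> //; apply: sbx.
apply: (@le_trans _ _ (\sum_(k <- bx) Psi k ^- 2)).
  rewrite big_mkcond; apply: ler_sum => k _; case: ifP => // _.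
  by rewrite invr_ge0 exprn_ge0 // ltW // Psi_gt0.
rewrite /bx big_map big_enum /=.
pose F (j : 'I_n) (i : 'I_(2 * L).+1) : R := (1 + `|(i%:Z - L%:Z)%:~R|) ^- 2.
have -> : \sum_a Psi (pt a) ^- 2 = \sum_(a : {ffun 'I_n -> 'I_(2 * L).+1}) \prod_j F j (a j).
  apply: eq_bigr => a _; rewrite /Psi -prodrXl -prodfV; apply: eq_bigr => j _.
  by rewrite mxE.
rewrite -(bigA_distr_bigA F).
have -> : (3 : R) ^+ n = \prod_(j < n) 3 by rewrite prodr_const card_ord.
apply: ler_prod => j _; rewrite sumr_ge0 => [|i _] /=; last first.
  by rewrite invr_ge0 exprn_ge0 // addr_ge0.
by apply: le_trans (sum_inv_sq L) _; rewrite gerBl divr_ge0 // addr_ge0.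
Qed.

End SummableWeight.

(** * Integration over the torus *)

Section Continuity.
Context {R : realType}.
Local Open Scope classical_set_scope.

Lemma continuous_rV (T : topologicalType) (n : nat) (F : T -> 'rV[R]_n) :
  (forall j, continuous (fun z => F z 0 j)) -> continuous F.
Proof.
move=> cF z A /= [P hP PA].
apply: filterS (_ : nbhs z (fun z' => forall j, P 0 j (F z' 0 j))).
  by move=> z' hz'; apply: PA => i j; rewrite ord1.
apply: filter_forall => j; exact: (cF j z _ (hP 0 j)).
Qed.

Lemma continuous_coord (n : nat) (j : 'I_n) :
  continuous (fun x : 'rV[R]_n => x 0 j).
Proof. exact: coord_continuous. Qed.

Lemma continuous_comp2 (S T U : topologicalType) (f : S -> T) (g : T -> U) :
  continuous f -> continuous g -> continuous (fun z => g (f z)).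
Proof. by move=> cf cg z; apply: continuous_comp; [exact: cf|exact: cg]. Qed.

Lemma continuous_row_mx (T : topologicalType) (n : nat) (f : T -> R)
    (g : T -> 'rV[R]_n) : continuous f -> continuous g ->
  continuous (fun z => row_mx (const_mx (f z) : 'rV[R]_1) (g z) : 'rV[R]_(1 + n)).
Proof.
move=> cf cg; apply: continuous_rV => j.
rewrite (_ : (fun z => _) = if fintype.split j is inr i then fun z => g z 0 i else f).
  case: (fintype.split j) => [//|i].
  exact: continuous_comp2 cg (@continuous_coord _ i).
by apply/funext => z; rewrite mxE; case: (fintype.split j) => i //; rewrite mxE.
Qed.

Lemma continuous_fst (T U : topologicalType) : continuous (@fst T U).
Proof. by move=> z; exact: cvg_fst. Qed.

Lemma continuous_snd (T U : topologicalType) : continuous (@snd T U).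
Proof. by move=> z; exact: cvg_snd. Qed.

Lemma continuous_pair (S T U : topologicalType) (f : S -> T) (g : S -> U) :
  continuous f -> continuous g -> continuous (fun z => (f z, g z)).
Proof. by move=> cf cg z; apply: cvg_pair; [exact: cf|exact: cg]. Qed.

Lemma continuous_id1 (T : topologicalType) : continuous (fun z : T => z).
Proof. by move=> z; exact: cvg_id. Qed.

Lemma continuous_const (S T : topologicalType) (c : T) :
  continuous (fun _ : S => c).
Proof. by move=> z; exact: cvg_cst. Qed.

Lemma continuousRD (T : topologicalType) (f g : T -> R) :
  continuous f -> continuous g -> continuous (fun z => f z + g z).
Proof. by move=> cf cg z; apply: cvgD; [exact: cf|exact: cg]. Qed.

Lemma continuousRM (T : topologicalType) (f g : T -> R) :
  continuous f -> continuous g -> continuous (fun z => f z * g z).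
Proof. by move=> cf cg z; apply: cvgM; [exact: cf|exact: cg]. Qed.

Lemma continuousRN (T : topologicalType) (f : T -> R) :
  continuous f -> continuous (fun z => - f z).
Proof. by move=> cf z; apply: cvgN; exact: cf. Qed.

Lemma continuousRB (T : topologicalType) (f g : T -> R) :
  continuous f -> continuous g -> continuous (fun z => f z - g z).
Proof. by move=> cf cg z; apply: cvgB; [exact: cf|exact: cg]. Qed.

End Continuity.

Section UnitInterval.
Context {R : realType}.
Local Open Scope classical_set_scope.
Implicit Types (f g : R -> R) (c : R).

Definition int01 f : R := \int[@lebesgue_measure R]_(t in `[0, 1]%classic) f t.

Lemma integrable01 f : continuous f ->
  (@lebesgue_measure R).-integrable `[0, 1] (EFin \o f).
Proof.
move=> cf; apply: continuous_compact_integrable; first exact: segment_compact.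
exact: continuous_subspaceT.
Qed.

Lemma int01D f g : continuous f -> continuous g ->
  int01 (fun t => f t + g t) = int01 f + int01 g.
Proof. by move=> cf cg; apply: RintegralD => //; exact: integrable01. Qed.

Lemma int01Z c f : continuous f -> int01 (fun t => c * f t) = c * int01 f.
Proof. by move=> cf; apply: RintegralZl => //; exact: integrable01. Qed.

Lemma int01_cst c : int01 (fun=> c) = c.
Proof.
rewrite /int01 Rintegral_cst //= lebesgue_measure_itv /= lte_fin ltr01.
by rewrite oppr0 addr0 mulr1.
Qed.

Lemma int01_le f g : continuous f -> continuous g ->
  (forall t, 0 <= t <= 1 -> f t <= g t) -> int01 f <= int01 g.
Proof.
by move=> cf cg fg; apply: le_Rintegral => //; exact: integrable01.
Qed.

Lemma int01_bound f c : continuous f ->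
  (forall t, 0 <= t <= 1 -> `|f t| <= c) -> `|int01 f| <= c.
Proof.
move=> cf fc; rewrite ler_norml; apply/andP; split.
  rewrite -[leLHS](int01_cst (- c)); apply: int01_le => // [|t /fc].
    exact: continuous_const.
  by rewrite ler_norml => /andP[].
rewrite -[leRHS](int01_cst c); apply: int01_le => // [|t /fc].
  exact: continuous_const.
by rewrite ler_norml => /andP[].
Qed.

Lemma int01B f g : continuous f -> continuous g ->
  int01 (fun t => f t - g t) = int01 f - int01 g.
Proof. by move=> cf cg; apply: RintegralB => //; exact: integrable01. Qed.

(** Compactness of the interval makes the integrand uniformly close to its
   value at a nearby parameter. *)
Lemma int01_continuous (T : topologicalType) (G : T -> R -> R) :
  continuous (fun z : T * R => G z.1 z.2) -> continuous (fun z => int01 (G z)).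
Proof.
move=> cG z0.
have cGz z : continuous (G z).
  apply: (@continuous_comp2 _ _ _ (fun t => (z, t)) _ _ cG).
  apply: continuous_pair; last by move=> t; exact: cvg_id.
  by move=> t; exact: cvg_cst.
apply/cvgrPdist_le => /= e e0.
have : \forall z \near z0, `[0, 1]%classic `<=` (fun t => `|G z0 t - G z t| <= e).
  have /compact_near_coveringP := @segment_compact R 0 1; apply => t _.
  have e2 : 0 < e / 2 by rewrite divr_gt0.
  have := cG (z0, t) => /cvgrPdist_le /(_ _ e2) /= [[A B]] /= [A0 B0] AB.
  exists (B, A) => //= -[t' z] /= [Bt' Az].
  have h1 := AB (z, t') (conj Az Bt'); have h2 := AB (z0, t') (conj (nbhs_singleton A0) Bt').
  rewrite /= in h1 h2; rewrite distrC in h2.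
  rewrite -(subrKA (G z0 t)) (splitr e).
  by apply: le_trans (ler_normD _ _) _; exact: lerD.
apply: filterS => z hz; rewrite -int01B //.
apply: int01_bound; first exact: continuousRB.
by move=> t t01; apply: hz; rewrite /= in_itv.
Qed.

Lemma int01_derive f F : continuous f ->
  (forall t : R, is_derive t (1 : R) F (f t)) -> int01 f = F 1 - F 0.
Proof.
move=> cf dF; rewrite /int01 /Rintegral (@continuous_FTC2 _ f F) //.
- exact: continuous_subspaceT.
- have cF t : {for t, continuous F}.
    by apply: differentiable_continuous; apply/derivable1_diffP; apply: ex_derive.
  split => //.
  + by apply: cvg_at_right_filter; exact: cF.
  + by apply: cvg_at_left_filter; exact: cF.
- by move=> t _; rewrite derive1E; exact: derive_val.
Qed.

(** Caratheodory's form of differentiability. It turns differentiation under the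
   integral sign into the continuity of an integral with parameters. *)
Lemma is_derive_incr F (Phi : R -> R -> R) :
  continuous (fun z : R * R => Phi z.1 z.2) ->
  (forall t s, F (t + s) - F t = s * Phi t s) ->
  forall t : R, is_derive t (1 : R) F (Phi t 0).
Proof.
move=> cPhi hF t.
have lim : (fun s => s^-1 *: ((F \o shift t) (s *: (1 : R)) - F t)) @ 0^' --> Phi t 0.
  apply: (@cvg_trans _ ((Phi t) @ 0^')).
    apply: near_eq_cvg; near=> s.
    rewrite /= [s *: 1]mulr1 [s + t]addrC hF [_ *: _]mulKf //.
    by near: s; exact: nbhs_dnbhs_neq.
  apply: cvg_within_filter.
  apply: (@continuous_comp2 _ _ _ (fun s => (t, s)) _ _ cPhi 0).
  apply: continuous_pair; last by move=> ?; exact: cvg_id.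
  by move=> ?; exact: cvg_cst.
split; first by apply/cvg_ex; exists (Phi t 0).
exact: cvg_lim lim.
Unshelve. all: by end_near. Qed.

End UnitInterval.

Section TorusReal.
Context {R : realType}.
Local Open Scope classical_set_scope.

Definition slice (n : nat) (w : 'rV[R]_n.+1 -> R) (t : R) (y : 'rV[R]_n) : R :=
  w (row_mx (const_mx t : 'rV[R]_1) y : 'rV[R]_(1 + n)).

Lemma torus_int_rS (n : nat) (w : 'rV[R]_n.+1 -> R) :
  torus_int_r w = int01 (fun t => torus_int_r (slice w t)).
Proof. by []. Qed.

Lemma continuous_slice (n : nat) (w : 'rV[R]_n.+1 -> R) : continuous w ->
  continuous (fun z : R * 'rV[R]_n => slice w z.1 z.2).
Proof.
move=> cw; apply: (@continuous_comp2 _ _ _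
  (fun z : R * 'rV[R]_n => row_mx (const_mx z.1 : 'rV[R]_1) z.2 : 'rV[R]_n.+1) w) => //.
by apply: continuous_row_mx; [exact: continuous_fst|exact: continuous_snd].
Qed.

Lemma continuous_slice1 (n : nat) (w : 'rV[R]_n.+1 -> R) t : continuous w ->
  continuous (slice w t).
Proof.
move=> cw; apply: (@continuous_comp2 _ _ _ (fun y => (t, y)) _ _ (continuous_slice cw)).
apply: continuous_pair; last exact: continuous_id1.
exact: continuous_const.
Qed.

(** The parameter space is arbitrary so that the induction can move the first
   coordinate of the torus into it. *)
Lemma torus_continuous (n : nat) (T : topologicalType) (w : T -> 'rV[R]_n -> R) :
  continuous (fun z : T * 'rV[R]_n => w z.1 z.2) ->
  continuous (fun z => torus_int_r (w z)).
Proof.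
elim: n T w => [|n IH] T w cw.
  have c0 : continuous (fun z : T => (z, 0 : 'rV[R]_0)).
    by apply: continuous_pair; [exact: continuous_id1|exact: continuous_const].
  exact: (continuous_comp2 c0 cw).
apply: (@int01_continuous _ _ (fun z t => torus_int_r (slice (w z) t))).
apply: (IH (T * R)%type (fun zt => slice (w zt.1) zt.2)).
apply: (@continuous_comp2 _ _ _ (fun z : T * R * 'rV[R]_n => (z.1.1,
  row_mx (const_mx z.1.2 : 'rV[R]_1) z.2 : 'rV[R]_n.+1)) _ _ cw).
apply: continuous_pair.
  exact: continuous_comp2 (@continuous_fst _ _) (@continuous_fst _ _).
apply: continuous_row_mx; last exact: continuous_snd.
exact: continuous_comp2 (@continuous_fst _ _) (@continuous_snd _ _).
Qed.

Lemma torus_slice_continuous (n : nat) (w : 'rV[R]_n.+1 -> R) : continuous w ->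
  continuous (fun t => torus_int_r (slice w t)).
Proof. by move=> cw; apply: torus_continuous; exact: continuous_slice. Qed.

Lemma torus_rD (n : nat) (f g : 'rV[R]_n -> R) : continuous f -> continuous g ->
  torus_int_r (fun x => f x + g x) = torus_int_r f + torus_int_r g.
Proof.
elim: n f g => // n IH f g cf cg.
rewrite !torus_int_rS -int01D; try exact: torus_slice_continuous.
by congr int01; apply/funext => t; rewrite -IH //; exact: continuous_slice1.
Qed.

Lemma torus_rZ (n : nat) (c : R) (f : 'rV[R]_n -> R) : continuous f ->
  torus_int_r (fun x => c * f x) = c * torus_int_r f.
Proof.
elim: n f => // n IH f cf.
rewrite !torus_int_rS -int01Z; last exact: torus_slice_continuous.
by congr int01; apply/funext => t; rewrite -IH //; exact: continuous_slice1.
Qed.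

Lemma torus_rN (n : nat) (f : 'rV[R]_n -> R) : continuous f ->
  torus_int_r (fun x => - f x) = - torus_int_r f.
Proof.
move=> cf; rewrite -mulN1r -torus_rZ //.
by congr torus_int_r; apply/funext => x; rewrite mulN1r.
Qed.

Lemma torus_rB (n : nat) (f g : 'rV[R]_n -> R) : continuous f -> continuous g ->
  torus_int_r (fun x => f x - g x) = torus_int_r f - torus_int_r g.
Proof.
move=> cf cg; rewrite -torus_rN // -torus_rD //; exact: continuousRN.
Qed.

Lemma torus_r_cst (n : nat) (c : R) : torus_int_r (fun _ : 'rV[R]_n => c) = c.
Proof.
elim: n => // n IH; rewrite torus_int_rS -[RHS]int01_cst.
by congr int01; apply/funext => t; exact: IH.
Qed.

Definition cube (n : nat) (x : 'rV[R]_n) : Prop := forall j, 0 <= x 0 j <= 1.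

Lemma cube_row_mx (n : nat) (t : R) (y : 'rV[R]_n) : 0 <= t <= 1 -> cube y ->
  cube (row_mx (const_mx t : 'rV[R]_1) y : 'rV[R]_n.+1).
Proof.
move=> t01 cy j; rewrite /row_mx mxE.
by case: (fintype.split (j : 'I_(1 + n))) => i; rewrite ?mxE.
Qed.

Lemma torus_r_bound (n : nat) (f : 'rV[R]_n -> R) (c : R) : continuous f ->
  (forall x, cube x -> `|f x| <= c) -> `|torus_int_r f| <= c.
Proof.
elim: n f => [|n IH] f cf fc; first by apply: fc => -[].
rewrite torus_int_rS; apply: int01_bound; first exact: torus_slice_continuous.
move=> t t01; apply: IH; first exact: continuous_slice1.
by move=> y cy; apply: fc; exact: cube_row_mx.
Qed.

Lemma row_mx_step0 (n : nat) (t s : R) (y : 'rV[R]_n) :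
  row_mx (const_mx t : 'rV[R]_1) y + s *: delta_mx 0 (lshift n (0 : 'I_1)) =
  row_mx (const_mx (t + s)) y.
Proof.
rewrite delta_mx_lshift scale_row_mx scaler0 add_row_mx addr0; congr row_mx.
by apply/rowP => k; rewrite !mxE !ord1 eqxx mulr1.
Qed.

Lemma row_mx_stepS (n : nat) (i : 'I_n) (t s : R) (y : 'rV[R]_n) :
  row_mx (const_mx t : 'rV[R]_1) y + s *: delta_mx 0 (rshift 1 i) =
  row_mx (const_mx t) (y + s *: delta_mx 0 i).
Proof. by rewrite delta_mx_rshift scale_row_mx scaler0 add_row_mx addr0. Qed.

(** In the outermost variable, the integral over the other ones is differentiable
   and periodic, so that its derivative has integral zero; any other variable is
   handled slice by slice. The increments are given with a continuous quotient
   [D] because [D x 0] then passes under the integral sign by the mere continuity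
   of integrals with parameters. *)
Lemma torus_r_deriv (n : nat) (j : 'I_n) (w : 'rV[R]_n -> R) (D : 'rV[R]_n -> R -> R) :
  continuous w ->
  continuous (fun z : 'rV[R]_n * R => D z.1 z.2) ->
  (forall (x : 'rV[R]_n) s, w (x + s *: delta_mx 0 j) - w x = s * D x s) ->
  (forall x : 'rV[R]_n, w (x + delta_mx 0 j) = w x) ->
  torus_int_r (fun x => D x 0) = 0.
Proof.
elim: n j w D => [[]//|n IH] j w D cw cD hD per.
have cDs s : continuous (D^~ s).
  apply: (@continuous_comp2 _ _ _ (fun x => (x, s)) _ _ cD).
  apply: continuous_pair; first exact: continuous_id1.
  exact: continuous_const.
rewrite torus_int_rS; have [j0|[i ij]] : j = lshift n (0 : 'I_1) \/ exists i : 'I_n, j = rshift 1 i.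
  have := @splitK 1 n j; case: (fintype.split (j : 'I_(1 + n))) => i /= <-; [left|right; by exists i].
  by rewrite ord1.
- have row_step t s (y : 'rV[R]_n) : (row_mx (const_mx t : 'rV[R]_1) y : 'rV[R]_n.+1) + s *: delta_mx 0 j
      = row_mx (const_mx (t + s) : 'rV[R]_1) y.
    by rewrite j0; exact: row_mx_step0.
  pose Phi t s := torus_int_r (fun y => D (row_mx (const_mx t : 'rV[R]_1) y : 'rV[R]_n.+1) s).
  have cPhi : continuous (fun z : R * R => Phi z.1 z.2).
    apply: (@torus_continuous n (R * R)%type (fun z y => D (row_mx (const_mx z.1 : 'rV[R]_1) y : 'rV[R]_n.+1) z.2)).
    apply: (@continuous_comp2 _ _ _ (fun z : R * R * 'rV[R]_n =>
      (row_mx (const_mx z.1.1 : 'rV[R]_1) z.2 : 'rV[R]_n.+1, z.1.2)) _ _ cD).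
    apply: continuous_pair; last exact: continuous_comp2 (@continuous_fst _ _) (@continuous_snd _ _).
    apply: continuous_row_mx; last exact: continuous_snd.
    exact: continuous_comp2 (@continuous_fst _ _) (@continuous_fst _ _).
  pose F t := torus_int_r (slice w t).
  have hF t s : F (t + s) - F t = s * Phi t s.
    rewrite /F /Phi -torus_rB; try exact: continuous_slice1.
    rewrite -torus_rZ; last exact: (@continuous_slice1 n (D^~ s)).
    by congr torus_int_r; apply/funext => y; rewrite /slice -hD row_step.
  have dF := is_derive_incr cPhi hF.
  rewrite (@int01_derive _ (Phi^~ 0) F) //; last first.
    exact: (@torus_slice_continuous n (D^~ 0)).
  have -> : F 1 = F 0; last by rewrite subrr.
  congr torus_int_r; apply/funext => y; rewrite /slice -[1]add0r -row_step scale1r.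
  exact: per.
- have row_step t s (y : 'rV[R]_n) : (row_mx (const_mx t : 'rV[R]_1) y : 'rV[R]_n.+1) + s *: delta_mx 0 j
      = row_mx (const_mx t : 'rV[R]_1) (y + s *: delta_mx 0 i).
    by rewrite ij; exact: row_mx_stepS.
  rewrite -[RHS](int01_cst 0); congr int01; apply/funext => t.
  apply: (IH i (slice w t) (fun y s => D (row_mx (const_mx t : 'rV[R]_1) y : 'rV[R]_n.+1) s)).
  + exact: continuous_slice1.
  + apply: (@continuous_comp2 _ _ _ (fun z : 'rV[R]_n * R =>
      (row_mx (const_mx t : 'rV[R]_1) z.1 : 'rV[R]_n.+1, z.2)) _ _ cD).
    apply: continuous_pair; last exact: continuous_snd.
    by apply: continuous_row_mx; [exact: continuous_const|exact: continuous_fst].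
  + by move=> y s; rewrite -hD /slice row_step.
  + by move=> y; rewrite /slice -[delta_mx 0 i]scale1r -row_step scale1r per.
Qed.

Lemma is_derive_line (n : nat) (w : 'rV[R]_n -> R) (x v : 'rV[R]_n) (r d : R) :
  is_derive (x + r *: v) v w d -> is_derive r (1 : R) (fun r => w (x + r *: v)) d.
Proof.
move=> [dw <-].
have E : (fun h : R => h^-1 *: (((fun r => w (x + r *: v)) \o shift r) (h *: (1 : R))
    - w (x + r *: v))) =
    (fun h : R => h^-1 *: ((w \o shift (x + r *: v)) (h *: v) - w (x + r *: v))).
  apply/funext => h /=; congr (_ *: (w _ - _)).
  by rewrite [h *: 1]mulr1 scalerDl addrCA.
by split; rewrite /derivable /derive E.
Qed.

(** Hadamard's lemma supplies the continuous difference quotient. *)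
Lemma torus_r_partial (n : nat) (j : 'I_n) (w w' : 'rV[R]_n -> R) :
  continuous w -> continuous w' ->
  (forall x, is_derive x (delta_mx 0 j) w (w' x)) ->
  (forall x : 'rV[R]_n, w (x + delta_mx 0 j) = w x) ->
  torus_int_r w' = 0.
Proof.
move=> cw cw' dw per.
pose D x s := int01 (fun r => w' (x + (s * r) *: delta_mx 0 j)).
have cline : continuous (fun z : 'rV[R]_n * R * R => w' (z.1.1 + (z.1.2 * z.2) *: delta_mx 0 j)).
  apply: (@continuous_comp2 _ _ _ (fun z : 'rV[R]_n * R * R => z.1.1 + (z.1.2 * z.2) *: delta_mx 0 j) w') => //.
  apply: continuous_rV => i.
  rewrite (_ : (fun z => _) = fun z : 'rV[R]_n * R * R => z.1.1 0 i + z.1.2 * z.2 * (delta_mx 0 j : 'rV[R]_n) 0 i).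
    apply: continuousRD.
      apply: continuous_comp2 (@continuous_coord _ _ i).
      exact: continuous_comp2 (@continuous_fst _ _) (@continuous_fst _ _).
    apply: continuousRM; last exact: continuous_const.
    apply: continuousRM; last exact: continuous_snd.
    exact: continuous_comp2 (@continuous_fst _ _) (@continuous_snd _ _).
  by apply/funext => z; rewrite !mxE.
have cD : continuous (fun z : 'rV[R]_n * R => D z.1 z.2).
  exact: (@int01_continuous R ('rV[R]_n * R)%type (fun z r => w' (z.1 + (z.2 * r) *: delta_mx 0 j)) cline).
have hD x s : w (x + s *: delta_mx 0 j) - w x = s * D x s.
  have cr : continuous (fun r => w' (x + (s * r) *: delta_mx 0 j)).
    apply: (@continuous_comp2 _ _ _ (fun r => (x, s, r)) _ _ cline).
    apply: continuous_pair; last exact: continuous_id1.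
    exact: continuous_const.
  have dg (r : R) : is_derive r (1 : R) (fun r => w (x + (s * r) *: delta_mx 0 j))
      (s * w' (x + (s * r) *: delta_mx 0 j)).
    rewrite mulrC.
    apply: (@is_derive1_comp R (fun r => w (x + r *: delta_mx 0 j)) (fun r => s * r)).
      exact: is_derive_line (dw _).
    by rewrite -[X in is_derive _ _ _ X]mulr1; exact: is_deriveZ.
  rewrite /D -int01Z // (int01_derive _ dg) ?mulr1 ?mulr0 ?scale0r ?addr0 //.
  by apply: continuousRM => //; exact: continuous_const.
apply: etrans (torus_r_deriv cw cD hD per).
congr torus_int_r; apply/funext => x; rewrite /D -[LHS]int01_cst.
by congr int01; apply/funext => r; rewrite mul0r scale0r addr0.
Qed.

End TorusReal.

(** * Uniqueness of Fourier coefficients *)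

Section OneDimension.
Context {R : realType}.
Local Open Scope classical_set_scope.
Implicit Types (h q : R -> R).

Lemma int01_ge_bump h (B c x0 d : R) : continuous h -> 0 <= d -> d <= x0 -> x0 + d <= 1 ->
  (forall t, 0 <= t <= 1 -> - B <= h t) ->
  (forall t, `|t - x0| <= d -> c <= h t) ->
  - B + (c + B) * (2 * d) <= int01 h.
Proof.
move=> ch d0 dx xd hB hc; pose J : set R := `[x0 - d, x0 + d]%classic.
have mJ : measurable J by exact: measurable_itv.
have iJ : (@lebesgue_measure R).-integrable `[0, 1] (EFin \o \1_J).
  apply: (@integrableS _ _ _ _ setT) => //; exact: integrable_indic_itv.
have icJ : (@lebesgue_measure R).-integrable `[0, 1] (EFin \o (fun t => (c + B) * \1_J t)).
  by rewrite (_ : _ \o _ = (fun t => (c + B)%:E * (\1_J t)%:E)%E) //; exact: integrableZl.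
have iB : (@lebesgue_measure R).-integrable `[0, 1] (EFin \o (fun=> - B)).
  by apply: integrable01; exact: continuous_const.
have <- : \int[@lebesgue_measure R]_(t in `[0, 1]) (- B + (c + B) * \1_J t) =
    - B + (c + B) * (2 * d).
  rewrite RintegralD // RintegralZl //; congr (_ + _ * _); first exact: int01_cst.
  rewrite /Rintegral integral_indic // (_ : J `&` _ = J); last first.
    apply/setIidPl => t; rewrite /J /= !in_itv /= => /andP[h1 h2].
    by apply/andP; split; lra.
  rewrite /J /= lebesgue_measure_itv /= lte_fin; case: ltP => h1 /=; lra.
apply: le_Rintegral => //.
- exact: (integrableD _ iB icJ).
- exact: integrable01.
- move=> t; rewrite /= in_itv /= => t01; rewrite indicE.
  case: (boolP (t \in J)) => tJ; last by rewrite mulr0 addr0 hB.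
  rewrite mulr1 (_ : - B + (c + B) = c); last by ring.
  apply: hc.
  by move: tJ; rewrite inE /J /= in_itv /= ler_norml => /andP[h1 h2]; apply/andP; split; lra.
Qed.

Lemma bernoulli (y : R) (N : nat) : 0 <= y -> 1 + N%:R * y <= (1 + y) ^+ N.
Proof.
move=> y0; elim: N => [|N IH]; first by rewrite mul0r addr0 expr0.
rewrite exprS -natr1; apply: le_trans (_ : (1 + y) * (1 + N%:R * y) <= _).
  have : 0 <= N%:R * y * y by rewrite !mulr_ge0.
  set x := N%:R * y; have -> : (N%:R + 1) * y = x + y by rewrite /x; ring.
  by rewrite (_ : (1 + y) * (1 + x) = 1 + (x + y) + x * y); [lra|ring].
by rewrite ler_wpM2l // addr_ge0.
Qed.

Definition cosm (a : int) (t : R) := cos (2 * pi * (a%:~R * t)).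
Definition sinm (a : int) (t : R) := sin (2 * pi * (a%:~R * t)).

Lemma continuous_lin (c : R) : continuous (fun t : R => c * t).
Proof. by apply: continuousRM; [exact: continuous_const|exact: continuous_id1]. Qed.

Lemma continuous_cosm a : continuous (cosm a).
Proof.
apply: (@continuous_comp2 _ _ _ (fun t : R => 2 * pi * (a%:~R * t)) _ _ (@continuous_cos R)).
by apply: continuousRM; [exact: continuous_const|exact: continuous_lin].
Qed.

Lemma continuous_sinm a : continuous (sinm a).
Proof.
apply: (@continuous_comp2 _ _ _ (fun t : R => 2 * pi * (a%:~R * t)) _ _ (@continuous_sin R)).
by apply: continuousRM; [exact: continuous_const|exact: continuous_lin].
Qed.

Definition null_moments h : Prop :=
  forall a, int01 (fun t => h t * cosm a t) = 0 /\ int01 (fun t => h t * sinm a t) = 0.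

Lemma null_moments_mul h (A B C : R) : continuous h -> null_moments h ->
  null_moments (fun t => h t * (A * cosm 1 t + B * sinm 1 t + C)).
Proof.
move=> ch hm a.
have c1 u : continuous (fun t => h t * cosm u t) by apply: continuousRM => //; exact: continuous_cosm.
have s1 u : continuous (fun t => h t * sinm u t) by apply: continuousRM => //; exact: continuous_sinm.
have lin (c1' c2 c3 c4 c5 : R) (f1 f2 f3 f4 f5 : R -> R) :
    continuous f1 -> continuous f2 -> continuous f3 -> continuous f4 -> continuous f5 ->
    int01 (fun t => c1' * f1 t + c2 * f2 t + c3 * f3 t + c4 * f4 t + c5 * f5 t) =
    c1' * int01 f1 + c2 * int01 f2 + c3 * int01 f3 + c4 * int01 f4 + c5 * int01 f5.
  move=> k1 k2 k3 k4 k5.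
  have k (c : R) (f : R -> R) : continuous f -> continuous (fun t : R => c * f t).
    by move=> kf; apply: continuousRM => //; exact: continuous_const.
  by rewrite !int01D ?int01Z //; do ?[apply: continuousRD]; exact: k.
have ph u (t : R) : 2 * pi * ((a + u)%:~R * t) = 2 * pi * (a%:~R * t) + 2 * pi * (u%:~R * t).
  by rewrite intrD; ring.
have pN (t : R) : 2 * pi * ((-1)%:~R * t) = - (2 * pi * (1%:~R * t)).
  by rewrite intrN; ring.
have cp t : cosm (a + 1) t = cosm a t * cosm 1 t - sinm a t * sinm 1 t.
  by rewrite /cosm ph cosD.
have cm t : cosm (a + (-1)) t = cosm a t * cosm 1 t + sinm a t * sinm 1 t.
  by rewrite /cosm ph pN cosB.
have sp t : sinm (a + 1) t = sinm a t * cosm 1 t + cosm a t * sinm 1 t.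
  by rewrite /sinm ph sinD.
have sm t : sinm (a + (-1)) t = sinm a t * cosm 1 t - cosm a t * sinm 1 t.
  by rewrite /sinm ph pN sinB.
split.
- rewrite (_ : (fun t => _) = fun t => A / 2 * (h t * cosm (a + 1) t)
    + A / 2 * (h t * cosm (a + (-1)) t) + B / 2 * (h t * sinm (a + 1) t)
    + - (B / 2) * (h t * sinm (a + (-1)) t) + C * (h t * cosm a t)).
    by rewrite lin // !(hm _).1 !(hm _).2 !mulr0 !addr0.
  by apply/funext => t; rewrite cp cm sp sm; field.
- rewrite (_ : (fun t => _) = fun t => A / 2 * (h t * sinm (a + 1) t)
    + A / 2 * (h t * sinm (a + (-1)) t) + B / 2 * (h t * cosm (a + (-1)) t)
    + - (B / 2) * (h t * cosm (a + 1) t) + C * (h t * sinm a t)).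
    by rewrite lin // !(hm _).1 !(hm _).2 !mulr0 !addr0.
  by apply/funext => t; rewrite cp cm sp sm; field.
Qed.

Lemma cos_abs (s : R) : cos (2 * pi * s) = cos (2 * pi * `|s|).
Proof. by case: (ger0P s) => // _; rewrite mulrN cosN. Qed.

Lemma cos_mono (x y : R) : 0 <= x -> x < y -> y <= 2^-1 ->
  cos (2 * pi * y) < cos (2 * pi * x).
Proof.
move=> x0 xy y2; have pi0 := @pi_gt0 R; rewrite ltr_cos ?in_itv /=.
- by rewrite ltr_pM2l // mulr_gt0.
- by apply/andP; split; nra.
- by apply/andP; split; nra.
Qed.

Lemma cos_mono_le (x y : R) : 0 <= x -> x <= y -> y <= 2^-1 ->
  cos (2 * pi * y) <= cos (2 * pi * x).
Proof.
move=> x0; rewrite le_eqVlt => /predU1P[->//|xy] y2.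
by rewrite ltW // cos_mono.
Qed.

Lemma cos_peak (d s : R) : 0 <= d -> d <= `|s| -> `|s| <= 1 - d ->
  cos (2 * pi * s) <= cos (2 * pi * d).
Proof.
move=> d0 ds sd; rewrite cos_abs.
have [s2|s2] := leP `|s| 2^-1; first exact: cos_mono_le.
have -> : cos (2 * pi * `|s|) = cos (2 * pi * (1 - `|s|)).
  by rewrite -[LHS]cosN -[LHS]cosD2pi; congr cos; rewrite -mulr_natl; ring.
by apply: cos_mono_le; lra.
Qed.

(** Rudin's argument: a trigonometric polynomial [q] that exceeds [1] near
   [x0] and is bounded by [1] elsewhere has powers that concentrate the integral
   of [h * q ^+ N] near [x0], so that the moments cannot all vanish. *)
Lemma null_moments_le0 h : continuous h -> null_moments h ->
  forall t, 0 <= t <= 1 -> h t <= 0.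
Proof.
move=> ch hm t1 t1b; rewrite leNgt; apply/negP => ht1.
pose e := h t1 / 2; have e0 : 0 < e by rewrite divr_gt0.
have [r r0 hr] : exists2 r : R, 0 < r <= 4^-1 & forall t, `|t1 - t| < r -> e <= h t.
  have := ch t1 => /cvgrPdist_lt /(_ _ e0) /nbhs_ballP[r /= r0 hr].
  exists (Num.min r 4^-1) => [|t]; first by rewrite lt_min r0 invr_gt0 ltr0n ge_min lexx orbT.
  rewrite lt_min => /andP[tr _]; have := hr t tr; rewrite /= ltr_norml => /andP[h1 h2].
  by rewrite /e in h1 h2 *; lra.
have /andP[r1 r4] := r0; have /andP[t10 t11] := t1b.
(* the centre [x0] is moved off [t1] to keep the whole peak inside the interval *)
pose d := r / 4; have d0 : 0 < d by rewrite divr_gt0.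
have [x0 [xd0 xd1 hx]] : exists x0 : R, [/\ d <= x0, x0 + d <= 1 &
    forall t, `|t - x0| <= d -> e <= h t].
  have [t12|t12] := leP t1 2^-1; [exists (t1 + r / 2)|exists (t1 - r / 2)].
    split; [rewrite /d; lra|rewrite /d; lra|move=> t; rewrite /d ler_norml => /andP[h1 h2]].
    by apply: hr; rewrite ltr_norml; apply/andP; split; lra.
  split; [rewrite /d; lra|rewrite /d; lra|move=> t; rewrite /d ler_norml => /andP[h1 h2]].
  by apply: hr; rewrite ltr_norml; apply/andP; split; lra.
have d16 : d <= 16^-1 by rewrite /d; lra.
pose k1 := cos (2 * pi * d); pose k2 := cos (2 * pi * (d / 2)).
have pi0 := @pi_gt0 R.
have k12 : k1 < k2.
  by rewrite /k1 /k2; apply: cos_mono; lra.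
pose q t := cos (2 * pi * (t - x0)) + (1 - k1).
have qE t : q t = cos (2 * pi * x0) * cosm 1 t + sin (2 * pi * x0) * sinm 1 t + (1 - k1).
  rewrite /q mulrBr cosB /cosm /sinm !mul1r; ring.
have cq : continuous q.
  rewrite (_ : q = fun t => cos (2 * pi * x0) * cosm 1 t + sin (2 * pi * x0) * sinm 1 t + (1 - k1)).
    apply: continuousRD; last exact: continuous_const.
    by apply: continuousRD; apply: continuousRM;
      do ?[exact: continuous_const|exact: continuous_cosm|exact: continuous_sinm].
  by apply/funext => t; rewrite qE.
have chN N : continuous (fun t => h t * q t ^+ N).
  elim: N => [|N IH]; first by under eq_fun do rewrite expr0 mulr1.
  by under eq_fun do rewrite exprSr mulrA; apply: continuousRM.
have hmN N : null_moments (fun t => h t * q t ^+ N).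
  elim: N => [|N IH]; first by under eq_fun do rewrite expr0 mulr1.
  have -> : (fun t => h t * q t ^+ N.+1) = fun t => h t * q t ^+ N *
      (cos (2 * pi * x0) * cosm 1 t + sin (2 * pi * x0) * sinm 1 t + (1 - k1)).
    by apply/funext => t; rewrite -qE exprSr mulrA.
  by apply: null_moments_mul; [exact: chN|exact: IH].
have [B B0 hB] : exists2 B, 0 <= B & forall t, 0 <= t <= 1 -> `|h t| <= B.
  have cn : {within `[0, 1]%classic, continuous (fun t => `|h t|)}.
    apply: continuous_subspaceT; apply: (continuous_comp2 ch).
    by move=> z; exact: norm_continuous.
  have [c _ hc] := EVT_max ler01 cn; exists `|h c|; first exact: normr_ge0.
  by move=> t t01; apply: hc; rewrite in_itv.
have int0 N : int01 (fun t => h t * q t ^+ N) = 0.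
  have := (hmN N 0).1; under eq_fun do rewrite /cosm mul0r mulr0 cos0 mulr1.
  by [].
have q1 t : `|t - x0| <= d -> 1 <= q t.
  move=> td; have : k1 <= cos (2 * pi * (t - x0)); last by rewrite /q; lra.
  by rewrite cos_abs; apply: cos_mono_le => //; lra.
have q2 t : `|t - x0| <= d / 2 -> 1 + (k2 - k1) <= q t.
  move=> td; have : k2 <= cos (2 * pi * (t - x0)); last by rewrite /q; lra.
  by rewrite cos_abs; apply: cos_mono_le => //; lra.
have q3 t : 0 <= t <= 1 -> d < `|t - x0| -> `|q t| <= 1.
  move=> /andP[t0 t1'] dt; have c1 : cos (2 * pi * (t - x0)) <= k1.
    apply: cos_peak; [exact: ltW|exact: ltW|].
    by rewrite ler_norml; apply/andP; split; lra.
  have c2 := cos_geN1 (2 * pi * (t - x0)).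
  have c3 : k1 <= 1 by exact: cos_le1.
  by rewrite /q ler_norml; apply/andP; split; lra.
pose y := k2 - k1; have y0 : 0 < y by rewrite subr_gt0.
have key N : e * (1 + N%:R * y) * d <= B.
  have qN t : 1 + (k2 - k1) <= q t -> 1 + N%:R * y <= q t ^+ N.
    move=> qt; apply: le_trans (bernoulli N (ltW y0)) _.
    by rewrite ler_expn // addr_ge0 // ltW.
  have lower : forall t, 0 <= t <= 1 -> - B <= h t * q t ^+ N.
    move=> t t01; have [td|td] := leP `|t - x0| d.
      apply: le_trans (_ : 0 <= _); first by rewrite oppr_le0.
      rewrite mulr_ge0 ?exprn_ge0 //; first exact: le_trans (ltW e0) (hx _ td).
      exact: le_trans ler01 (q1 _ td).
    suff : `|h t * q t ^+ N| <= B by rewrite ler_norml => /andP[].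
    rewrite normrM normrX -[B]mulr1 ler_pM ?exprn_ge0 ?hB //.
    by rewrite exprn_ile1 ?q3.
  have bump t : `|t - x0| <= d / 2 -> e * (1 + N%:R * y) <= h t * q t ^+ N.
    move=> td; rewrite ler_pM //; first exact: ltW.
    - by rewrite addr_ge0 // mulr_ge0 // ltW.
    - by apply: hx; lra.
    - exact/qN/q2.
  have := int01_ge_bump (chN N) _ _ _ lower bump; rewrite int0 => H.
  have : - B + (e * (1 + N%:R * y) + B) * (2 * (d / 2)) <= 0 by apply: H; lra.
  by rewrite (_ : 2 * (d / 2) = d); [nra|field].
pose z := B / (e * y * d); pose N := (Num.truncn z).+1.
have eyd : 0 < e * y * d by rewrite !mulr_gt0.
have := truncnS_gt z; rewrite -/N => zN.
have : z < z.
  apply: lt_le_trans zN _; rewrite /z ler_pdivlMr //.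
  apply: le_trans (key N); have : 0 <= e * d by rewrite mulr_ge0 // ltW.
  by rewrite (_ : e * (1 + N%:R * y) * d = e * d + N%:R * (e * y * d)); [lra|ring].
by rewrite ltxx.
Qed.

Lemma null_moments_eq0 h : continuous h -> null_moments h ->
  forall t, 0 <= t <= 1 -> h t = 0.
Proof.
move=> ch hm t t01; apply/eqP; rewrite eq_le null_moments_le0 //=.
rewrite -oppr_le0; apply: (@null_moments_le0 (fun t => - h t)) => //.
  exact: continuousRN.
move=> a; have c1 : continuous (fun t => h t * cosm a t).
  by apply: continuousRM => //; exact: continuous_cosm.
have c2 : continuous (fun t => h t * sinm a t).
  by apply: continuousRM => //; exact: continuous_sinm.
split.
  under eq_fun do rewrite mulNr -mulN1r.
  by rewrite int01Z // (hm a).1 mulr0.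
under eq_fun do rewrite mulNr -mulN1r.
by rewrite int01Z // (hm a).2 mulr0.
Qed.

End OneDimension.

Section Characters.
Context {R : realType}.
Local Open Scope classical_set_scope.

Definition phase (n : nat) (p : 'rV[int]_n) (x : 'rV[R]_n) : R :=
  2 * pi * \sum_j (p 0 j)%:~R * x 0 j.

Lemma echarE n (p : 'rV[int]_n) (x : 'rV[R]_n) :
  echar p x = (cos (phase p x) +i* sin (phase p x))%C.
Proof. by []. Qed.

Lemma phaseDl n (p q : 'rV[int]_n) (x : 'rV[R]_n) :
  phase (p + q) x = phase p x + phase q x.
Proof.
rewrite /phase -mulrDr -big_split /=; congr (_ * _); apply: eq_bigr => j _.
by rewrite mxE intrD mulrDl.
Qed.

Lemma phaseNl n (p : 'rV[int]_n) (x : 'rV[R]_n) : phase (- p) x = - phase p x.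
Proof.
rewrite /phase -mulrN -sumrN; congr (_ * _); apply: eq_bigr => j _.
by rewrite mxE intrN mulNr.
Qed.

Lemma phaseDr n (p : 'rV[int]_n) (x y : 'rV[R]_n) :
  phase p (x + y) = phase p x + phase p y.
Proof.
rewrite /phase -mulrDr -big_split /=; congr (_ * _); apply: eq_bigr => j _.
by rewrite mxE mulrDr.
Qed.

Lemma phaseNr n (p : 'rV[int]_n) (x : 'rV[R]_n) : phase p (- x) = - phase p x.
Proof.
rewrite /phase -mulrN -sumrN; congr (_ * _); apply: eq_bigr => j _.
by rewrite mxE mulrN.
Qed.

Lemma phase_step n (p : 'rV[int]_n) (x : 'rV[R]_n) j s :
  phase p (x + s *: delta_mx 0 j) = phase p x + 2 * pi * (p 0 j)%:~R * s.
Proof.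
rewrite phaseDr -mulrA; congr (_ + _ * _).
rewrite (bigD1 j) //= big1 ?addr0 => [|i /negPf ij].
  by rewrite !mxE !eqxx mulr1.
by rewrite !mxE ij andbF !mulr0.
Qed.

Lemma phase0l n (x : 'rV[R]_n) : phase 0 x = 0.
Proof. by rewrite /phase big1 ?mulr0 // => j _; rewrite mxE mul0r. Qed.

Lemma phase_row_mx n (a : int) (p : 'rV[int]_n) (t : R) (y : 'rV[R]_n) :
  phase (row_mx (const_mx a : 'rV[int]_1) p) (row_mx (const_mx t : 'rV[R]_1) y) =
  2 * pi * (a%:~R * t) + phase p y.
Proof.
rewrite /phase big_split_ord /= big_ord1 !row_mxEl !mxE mulrDr; congr (_ + _ * _).
by apply: eq_bigr => j _; rewrite !row_mxEr.
Qed.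

Lemma continuous_phase n (p : 'rV[int]_n) : continuous (@phase n p).
Proof.
apply: continuousRM; first exact: continuous_const.
elim: (index_enum 'I_n) => [|j s IH].
  by under eq_fun do rewrite big_nil; exact: continuous_const.
under eq_fun do rewrite big_cons; apply: continuousRD => //.
by apply: continuousRM; [exact: continuous_const|exact: continuous_coord].
Qed.

Lemma continuous_cph n (p : 'rV[int]_n) : continuous (fun x => cos (phase p x)).
Proof. exact: continuous_comp2 (@continuous_phase n p) (@continuous_cos R). Qed.

Lemma continuous_sph n (p : 'rV[int]_n) : continuous (fun x => sin (phase p x)).
Proof. exact: continuous_comp2 (@continuous_phase n p) (@continuous_sin R). Qed.

(** The one-dimensional case applies to the Fourier coefficients in the last
   variables, which are continuous functions of the first one; the integrals are
   never exchanged. *)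
Lemma torus_uniqueness n (w : 'rV[R]_n -> R) : continuous w ->
  (forall p, torus_int_r (fun x => w x * cos (phase p x)) = 0 /\
             torus_int_r (fun x => w x * sin (phase p x)) = 0) ->
  forall x, cube x -> w x = 0.
Proof.
elim: n w => [|n IH] w cw hw x cx.
  have [] := hw 0; rewrite /= phase0l cos0 mulr1 => <- _.
  by congr w; apply/rowP => -[].
pose t := x 0 0; pose y : 'rV[R]_n := \row_j x 0 (lift 0 j).
have xE : x = row_mx (const_mx t : 'rV[R]_1) y.
  apply/rowP => j; rewrite /row_mx mxE.
  have := @splitK 1 n j; case: (fintype.split (j : 'I_(1 + n))) => i <-; rewrite mxE.
    by rewrite ord1 /=; congr (x 0 _); apply/val_inj.
  by congr (x 0 _); apply/val_inj.
have cy : cube y by move=> j; rewrite mxE; exact: cx.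
have -> : w x = slice w t y by rewrite /slice -xE.
apply: IH => //; first exact: continuous_slice1.
move=> q.
pose Bc t := torus_int_r (fun y => slice w t y * cos (phase q y)).
pose Bs t := torus_int_r (fun y => slice w t y * sin (phase q y)).
have cBc : continuous Bc.
  apply: (@torus_continuous _ n R (fun t y => slice w t y * cos (phase q y))).
  apply: continuousRM; first exact: continuous_slice.
  exact: continuous_comp2 (@continuous_snd _ _) (@continuous_cph n q).
have cBs : continuous Bs.
  apply: (@torus_continuous _ n R (fun t y => slice w t y * sin (phase q y))).
  apply: continuousRM; first exact: continuous_slice.
  exact: continuous_comp2 (@continuous_snd _ _) (@continuous_sph n q).
have cyc t' : continuous (fun y => slice w t' y * cos (phase q y)).
  by apply: continuousRM; [exact: continuous_slice1|exact: continuous_cph].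
have cys t' : continuous (fun y => slice w t' y * sin (phase q y)).
  by apply: continuousRM; [exact: continuous_slice1|exact: continuous_sph].
have cM (f : R -> R) (c : R) : continuous f -> continuous (fun t => c * f t).
  by move=> cf; apply: continuousRM => //; exact: continuous_const.
have zc (c : R) (f : 'rV[R]_n -> R) : continuous f -> continuous (fun t => c * f t).
  by move=> cf; apply: continuousRM => //; exact: continuous_const.
have hc a : int01 (fun t => Bc t * cosm a t - Bs t * sinm a t) = 0.
  have [<- _] := hw (row_mx (const_mx a : 'rV[int]_1) q).
  rewrite torus_int_rS; congr int01; apply/funext => t'.
  rewrite mulrC [Bs t' * _]mulrC -!torus_rZ // -torus_rB; try exact: zc.
  congr torus_int_r; apply/funext => y'; rewrite /slice phase_row_mx cosD /cosm /sinm; ring.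
have hs a : int01 (fun t => Bc t * sinm a t + Bs t * cosm a t) = 0.
  have [_ <-] := hw (row_mx (const_mx a : 'rV[int]_1) q).
  rewrite torus_int_rS; congr int01; apply/funext => t'.
  rewrite mulrC [Bs t' * _]mulrC -!torus_rZ // -torus_rD; try exact: zc.
  congr torus_int_r; apply/funext => y'; rewrite /slice phase_row_mx sinD /cosm /sinm; ring.
have cosmN a t' : cosm (- a) t' = cosm a t' :> R.
  by rewrite /cosm intrN mulNr mulrN cosN.
have sinmN a t' : sinm (- a) t' = - sinm a t' :> R.
  by rewrite /sinm intrN mulNr mulrN sinN.
have k1 a : continuous (fun t => Bc t * cosm a t) by apply: continuousRM => //; exact: continuous_cosm.
have k2 a : continuous (fun t => Bs t * sinm a t) by apply: continuousRM => //; exact: continuous_sinm.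
have k3 a : continuous (fun t => Bc t * sinm a t) by apply: continuousRM => //; exact: continuous_sinm.
have k4 a : continuous (fun t => Bs t * cosm a t) by apply: continuousRM => //; exact: continuous_cosm.
have mc : null_moments Bc.
  move=> a; have := hc a; have := hc (- a); have := hs a; have := hs (- a).
  rewrite !int01B ?int01D //.
  under [X in int01 X]eq_fun do rewrite sinmN mulrN -mulN1r.
  under [X in _ + int01 X]eq_fun do rewrite cosmN.
  rewrite int01Z // => e1 e2.
  under [X in int01 X]eq_fun do rewrite cosmN.
  under [X in _ - int01 X]eq_fun do rewrite sinmN mulrN -mulN1r.
  by rewrite int01Z // => e3 e4; split; lra.
have ms : null_moments Bs.
  move=> a; have := hc a; have := hc (- a); have := hs a; have := hs (- a).
  rewrite !int01B ?int01D //.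
  under [X in int01 X]eq_fun do rewrite sinmN mulrN -mulN1r.
  under [X in _ + int01 X]eq_fun do rewrite cosmN.
  rewrite int01Z // => e1 e2.
  under [X in int01 X]eq_fun do rewrite cosmN.
  under [X in _ - int01 X]eq_fun do rewrite sinmN mulrN -mulN1r.
  by rewrite int01Z // => e3 e4; split; lra.
have t01 : 0 <= t <= 1 by exact: cx.
by split; [exact: (null_moments_eq0 cBc mc)|exact: (null_moments_eq0 cBs ms)].
Qed.

End Characters.

(** * Characters of the torus *)

Section TorusComplex.
Context {R : realType} {n : nat}.
Local Open Scope classical_set_scope.
Implicit Types (u v : 'rV[R]_n -> R[i]) (p q : 'rV[int]_n) (x y : 'rV[R]_n).

Definition ccont u : Prop :=
  continuous (fun x => complex.Re (u x)) /\ continuous (fun x => complex.Im (u x)).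

Lemma ccont_const (c : R[i]) : ccont (fun=> c).
Proof. by split; exact: continuous_const. Qed.

Lemma ccontD u v : ccont u -> ccont v -> ccont (fun x => u x + v x).
Proof.
move=> [u1 u2] [v1 v2]; split.
  by under eq_fun do rewrite ReD; exact: continuousRD.
by under eq_fun do rewrite ImD; exact: continuousRD.
Qed.

Lemma ccontM u v : ccont u -> ccont v -> ccont (fun x => u x * v x).
Proof.
move=> [u1 u2] [v1 v2]; split.
  by under eq_fun do rewrite ReM; apply: continuousRB; exact: continuousRM.
by under eq_fun do rewrite ImM; apply: continuousRD; exact: continuousRM.
Qed.

Lemma ccontZ (c : R[i]) u : ccont u -> ccont (fun x => c * u x).
Proof. by apply: ccontM; exact: ccont_const. Qed.

Lemma ccontB u v : ccont u -> ccont v -> ccont (fun x => u x - v x).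
Proof.
move=> cu cv; under eq_fun do rewrite -mulN1r.
by apply: ccontD => //; exact: ccontZ.
Qed.

Lemma ccont_sum (I : Type) (s : seq I) (F : I -> 'rV[R]_n -> R[i]) :
  (forall i, ccont (F i)) -> ccont (fun x => \sum_(i <- s) F i x).
Proof.
move=> cF; elim: s => [|i s IH].
  by under eq_fun do rewrite big_nil; exact: ccont_const.
by under eq_fun do rewrite big_cons; exact: ccontD.
Qed.

Lemma ccont_echar p : ccont (echar p).
Proof. by split; [exact: continuous_cph|exact: continuous_sph]. Qed.

Lemma torus_intD u v : ccont u -> ccont v ->
  torus_int (fun x => u x + v x) = torus_int u + torus_int v.
Proof.
move=> [u1 u2] [v1 v2]; rewrite /torus_int.
have -> : (fun x => complex.Re (u x + v x)) = fun x => complex.Re (u x) + complex.Re (v x).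
  by apply/funext => x; exact: ReD.
have -> : (fun x => complex.Im (u x + v x)) = fun x => complex.Im (u x) + complex.Im (v x).
  by apply/funext => x; exact: ImD.
by rewrite !torus_rD.
Qed.

Lemma torus_intZ (c : R[i]) u : ccont u ->
  torus_int (fun x => c * u x) = c * torus_int u.
Proof.
move=> [u1 u2]; rewrite /torus_int; case: c => a b /=.
have z (f : 'rV[R]_n -> R) (d : R) : continuous f -> continuous (fun x => d * f x).
  by move=> cf; apply: continuousRM => //; exact: continuous_const.
have -> : (fun x => complex.Re ((a +i* b)%C * u x)) =
    fun x => a * complex.Re (u x) - b * complex.Im (u x).
  by apply/funext => x; rewrite ReM.
have -> : (fun x => complex.Im ((a +i* b)%C * u x)) =
    fun x => a * complex.Im (u x) + b * complex.Re (u x).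
  by apply/funext => x; rewrite ImM.
by rewrite torus_rB ?torus_rD ?torus_rZ //; exact: z.
Qed.

Lemma torus_intB u v : ccont u -> ccont v ->
  torus_int (fun x => u x - v x) = torus_int u - torus_int v.
Proof.
move=> cu cv; rewrite -mulN1r -torus_intZ // -torus_intD //; last exact: ccontZ.
by congr torus_int; apply/funext => x; rewrite mulN1r.
Qed.

Lemma torus_int0 : torus_int (fun _ : 'rV[R]_n => 0 : R[i]) = 0.
Proof. by rewrite /torus_int /= !torus_r_cst. Qed.

Lemma torus_int_sum (I : Type) (s : seq I) (F : I -> 'rV[R]_n -> R[i]) :
  (forall i, ccont (F i)) ->
  torus_int (fun x => \sum_(i <- s) F i x) = \sum_(i <- s) torus_int (F i).
Proof.
move=> cF; elim: s => [|i s IH].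
  by under eq_fun do rewrite big_nil; rewrite big_nil torus_int0.
rewrite big_cons -IH -torus_intD //; last exact: ccont_sum.
by congr torus_int; apply/funext => x; rewrite big_cons.
Qed.

Lemma torus_int_bound u (B : R) : ccont u ->
  (forall x, cube x -> cmod (u x) <= B) -> cmod (torus_int u) <= B + B.
Proof.
move=> [u1 u2] uB; apply: le_trans (cmod_le _) _; apply: lerD.
  by apply: torus_r_bound => // x /uB; apply: le_trans; exact: normRe.
by apply: torus_r_bound => // x /uB; apply: le_trans; exact: normIm.
Qed.

Lemma cmod_echar p x : cmod (echar p x) = 1.
Proof. by rewrite echarE /cmod /= cos2Dsin2 sqrtr1. Qed.

Lemma echarDl p q x : echar (p + q) x = echar p x * echar q x.
Proof.
rewrite !echarE phaseDl cosD sinD; congr (Complex _ _).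
by rewrite addrC.
Qed.

Lemma echarDr p x y : echar p (x + y) = echar p x * echar p y.
Proof.
rewrite !echarE phaseDr cosD sinD; congr (Complex _ _).
by rewrite addrC.
Qed.

Lemma echar_opp p x : echar p (- x) = echar (- p) x.
Proof. by rewrite !echarE phaseNl phaseNr. Qed.

Lemma echar0 x : echar 0 x = 1.
Proof. by rewrite echarE phase0l cos0 sin0. Qed.

Lemma echar_periodic p : Zperiodic (echar p : 'rV[R]_n -> R[i]).
Proof.
move=> q x; rewrite echarDr -[RHS]mulr1; congr (_ * _).
have [z E] : exists z : int, phase p (map_mx intr q : 'rV[R]_n) = 2 * pi * z%:~R.
  exists (\sum_j p 0 j * q 0 j); rewrite /phase rmorph_sum /=; congr (_ * _).
  by apply: eq_bigr => j _; rewrite mxE intrM.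
have per (m : nat) : cos (2 * pi * m%:R : R) = 1 /\ sin (2 * pi * m%:R : R) = 0.
  have -> : 2 * pi * m%:R = 0 + (pi *+ 2) *+ m :> R.
    by rewrite add0r -[RHS]mulr_natr -[pi *+ 2]mulr_natl.
  by rewrite (periodicn (@cosD2pi R)) (periodicn (@sinD2pi R)) cos0 sin0.
case: z E => m E; first by have [h1 h2] := per m; rewrite echarE E -pmulrn h1 h2.
rewrite echarE E NegzE intrN mulrN; have [h1 h2] := per m.+1.
by rewrite cosN sinN -pmulrn h1 h2 oppr0.
Qed.

(** The derivative is taken by components, as in [partial]. *)
Definition cderiv x (v : 'rV[R]_n) u (d : R[i]) : Prop :=
  is_derive x v (fun y => complex.Re (u y)) (complex.Re d) /\
  is_derive x v (fun y => complex.Im (u y)) (complex.Im d).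

Lemma cderiv_partial j u u' : (forall x, cderiv x (delta_mx 0 j) u (u' x)) ->
  partial j u = u'.
Proof.
move=> H; apply/funext => x; have [[_ h1] [_ h2]] := H x.
by rewrite /partial h1 h2; case: (u' x).
Qed.

Lemma cderivM x (v : 'rV[R]_n) u1 u2 (d1 d2 : R[i]) :
  cderiv x v u1 d1 -> cderiv x v u2 d2 ->
  cderiv x v (fun y => u1 y * u2 y) (d1 * u2 x + u1 x * d2).
Proof.
move=> [h1 h2] [k1 k2]; split.
- rewrite (_ : (fun y => _) = (fun y => complex.Re (u1 y)) * (fun y => complex.Re (u2 y))
    - (fun y => complex.Im (u1 y)) * (fun y => complex.Im (u2 y))).
    apply: is_derive_eq; rewrite ReD !ReM /= /GRing.scale /=; ring.
  by apply/funext => y; rewrite ReM.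
- rewrite (_ : (fun y => _) = (fun y => complex.Re (u1 y)) * (fun y => complex.Im (u2 y))
    + (fun y => complex.Im (u1 y)) * (fun y => complex.Re (u2 y))).
    apply: is_derive_eq; rewrite ImD !ImM /= /GRing.scale /=; ring.
  by apply/funext => y; rewrite ImM.
Qed.

Lemma cderiv_lin x (v : 'rV[R]_n) u1 u2 (c d1 d2 : R[i]) :
  cderiv x v u1 d1 -> cderiv x v u2 d2 ->
  cderiv x v (fun y => c * u1 y + u2 y) (c * d1 + d2).
Proof.
move=> [h1 h2] [k1 k2]; split.
- rewrite (_ : (fun y => _) = complex.Re c *: (fun y => complex.Re (u1 y))
    - complex.Im c *: (fun y => complex.Im (u1 y)) + (fun y => complex.Re (u2 y))).
    by apply: is_derive_eq; rewrite ReD !ReM.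
  by apply/funext => y; rewrite ReD ReM.
- rewrite (_ : (fun y => _) = complex.Re c *: (fun y => complex.Im (u1 y))
    + complex.Im c *: (fun y => complex.Re (u1 y)) + (fun y => complex.Im (u2 y))).
    by apply: is_derive_eq; rewrite ImD !ImM.
  by apply/funext => y; rewrite ImD ImM.
Qed.

(** A quadratic error bound is what the summation of a Fourier series preserves,
   so that series are differentiated term by term without uniform convergence of
   difference quotients. *)
Lemma quad_is_derive (x v : 'rV[R]_n) (f : 'rV[R]_n -> R) (d K : R) :
  (forall s : R, `|f (x + s *: v) - f x - s * d| <= K * s ^+ 2) -> is_derive x v f d.
Proof.
move=> H.
have K0 : 0 <= K.
  by have := le_trans (normr_ge0 _) (H 1); rewrite expr1n mulr1.
have lim : (fun h : R => h^-1 *: ((f \o shift x) (h *: v) - f x)) @ 0^' --> d.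
  apply/cvgrPdist_le => /= e e0.
  have e1 : 0 < e / (K + 1) by rewrite divr_gt0 // ltr_wpDl.
  near=> h; have h0 : h != 0 by near: h; exact: nbhs_dnbhs_neq.
  have he : `|h| <= e / (K + 1).
    by near: h; apply: dnbhs0_le.
  rewrite /= [h *: v + x]addrC.
  have -> : d - h^-1 *: (f (x + h *: v) - f x) = - (h^-1 * (f (x + h *: v) - f x - h * d)).
    by rewrite /GRing.scale /= [h^-1 * (_ - h * d)]mulrBr mulKf // opprB.
  rewrite normrN normrM normfV ler_pdivrMl ?normr_gt0 //.
  apply: le_trans (H h) _; rewrite -(real_normK (num_real h)) expr2 mulrCA ler_wpM2l //.
  apply: le_trans (ler_wpM2l K0 he) _.
  by rewrite mulrCA ler_piMr ?(ltW e0) // ler_pdivrMr ?ltr_wpDl // mul1r lerDl.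
split; first by apply/cvg_ex; exists d.
exact: cvg_lim lim.
Unshelve. all: by end_near. Qed.

Lemma torus_int_partial j u u' : ccont u -> ccont u' ->
  (forall x, cderiv x (delta_mx 0 j) u (u' x)) ->
  (forall x, u (x + delta_mx 0 j) = u x) -> torus_int u' = 0.
Proof.
move=> [u1 u2] [v1 v2] du per; rewrite /torus_int.
rewrite (torus_r_partial u1 v1 (fun x => (du x).1)) => [|x]; last by rewrite per.
by rewrite (torus_r_partial u2 v2 (fun x => (du x).2)) => [|x]; last by rewrite per.
Qed.

End TorusComplex.

Section Exponential.
Context {R : realType}.
Implicit Types (t : R).

(* used by instance resolution in the two chain rules below *)
Let dlin t (s : R) : is_derive s (1 : R) (fun s => t * s) t.
Proof. by rewrite -[X in is_derive _ _ _ X]mulr1; exact: is_deriveZ. Qed.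

Lemma is_derive_cosZ t (s : R) :
  is_derive s (1 : R) (fun s => cos (t * s)) (- sin (t * s) * t).
Proof. exact: (@is_derive1_comp R cos (fun s => t * s)). Qed.

Lemma is_derive_sinZ t (s : R) :
  is_derive s (1 : R) (fun s => sin (t * s)) (cos (t * s) * t).
Proof. exact: (@is_derive1_comp R sin (fun s => t * s)). Qed.

Lemma continuous_cosZ t : continuous (fun s : R => cos (t * s)).
Proof. exact: continuous_comp2 (@continuous_lin R t) (@continuous_cos R). Qed.

Lemma continuous_sinZ t : continuous (fun s : R => sin (t * s)).
Proof. exact: continuous_comp2 (@continuous_lin R t) (@continuous_sin R). Qed.

Lemma cos_sub1_le t : `|cos t - 1| <= `|t|.
Proof.
have := int01_derive _ (is_derive_cosZ t); rewrite mulr1 mulr0 cos0 => <-.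
  apply: int01_bound => [|s _].
    apply: continuousRM; last exact: continuous_const.
    by apply: continuousRN; exact: continuous_sinZ.
  by rewrite normrM normrN ler_piMl // ler_norml sin_geN1 sin_le1.
apply: continuousRM; last exact: continuous_const.
by apply: continuousRN; exact: continuous_sinZ.
Qed.

Lemma sin_abs_le t : `|sin t| <= `|t|.
Proof.
have := int01_derive _ (is_derive_sinZ t); rewrite mulr1 mulr0 sin0 subr0 => <-.
  apply: int01_bound => [|s _].
    by apply: continuousRM; [exact: continuous_cosZ|exact: continuous_const].
  by rewrite normrM ler_piMl // ler_norml cos_geN1 cos_le1.
by apply: continuousRM; [exact: continuous_cosZ|exact: continuous_const].
Qed.

Lemma cos_taylor t : `|cos t - 1| <= t ^+ 2.
Proof.
have := int01_derive _ (is_derive_cosZ t); rewrite mulr1 mulr0 cos0 => <-.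
  apply: int01_bound => [|s /andP[s0 s1]].
    apply: continuousRM; last exact: continuous_const.
    by apply: continuousRN; exact: continuous_sinZ.
  rewrite normrM normrN -real_normK ?num_real // expr2 ler_wpM2r //.
  apply: le_trans (sin_abs_le _) _.
  by rewrite normrM ler_piMr // ger0_norm.
apply: continuousRM; last exact: continuous_const.
by apply: continuousRN; exact: continuous_sinZ.
Qed.

Lemma sin_taylor t : `|sin t - t| <= t ^+ 2.
Proof.
have c1 : continuous (fun s : R => cos (t * s) * t).
  by apply: continuousRM; [exact: continuous_cosZ|exact: continuous_const].
have <- : int01 (fun s : R => cos (t * s) * t - t) = sin t - t.
  rewrite int01B //; last exact: continuous_const.
  by rewrite int01_cst (int01_derive _ (is_derive_sinZ t)) // mulr1 mulr0 sin0 subr0.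
apply: int01_bound => [|s /andP[s0 s1]].
  by apply: continuousRB => //; exact: continuous_const.
rewrite -[X in _ - X]mul1r -mulrBl normrM -real_normK ?num_real // expr2 ler_wpM2r //.
by apply: le_trans (cos_sub1_le _) _; rewrite normrM ler_piMr // ger0_norm.
Qed.

Lemma echar_taylor n (p : 'rV[int]_n) (x : 'rV[R]_n) j (s : R) :
  cmod (echar p (x + s *: delta_mx 0 j) - echar p x -
        (s%:C)%C * ((0 +i* (2 * pi))%C * (p 0 j)%:~R * echar p x))
    <= 2 * (2 * pi * (p 0 j)%:~R * s) ^+ 2.
Proof.
set th := 2 * pi * (p 0 j)%:~R * s.
have E : echar p (x + s *: delta_mx 0 j) = echar p x * (cos th +i* sin th)%C.
  rewrite !echarE phase_step -/th cosD sinD; congr (Complex _ _).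
  by rewrite addrC.
have -> : (s%:C)%C * ((0 +i* (2 * pi))%C * (p 0 j)%:~R * echar p x) =
    echar p x * (0 +i* th)%C.
  rewrite mulrA mulrC; congr (_ * _); rewrite intrC /real_complex_def.
  by apply/eqP; rewrite eq_complex /= /th; apply/andP; split; apply/eqP; ring.
rewrite E -[X in _ - X - _]mulr1 -!mulrBr cmodM cmod_echar mul1r.
apply: le_trans (cmod_le _) _; rewrite !ReD !ImD !ReN !ImN /= !subr0.
have -> : 2 * th ^+ 2 = th ^+ 2 + th ^+ 2 by ring.
by rewrite lerD // ?cos_taylor ?sin_taylor.
Qed.

Lemma cderiv_echar n (p : 'rV[int]_n) (x : 'rV[R]_n) j :
  cderiv x (delta_mx 0 j) (echar p) ((0 +i* (2 * pi))%C * (p 0 j)%:~R * echar p x).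
Proof.
set d := _ * echar p x; have H s := echar_taylor p x j s; rewrite -/d in H.
pose K := 2 * (2 * pi * (p 0 j)%:~R) ^+ 2 : R.
have HK s : cmod (echar p (x + s *: delta_mx 0 j) - echar p x - (s%:C)%C * d) <= K * s ^+ 2.
  by apply: le_trans (H s) _; rewrite /K exprMn mulrA.
move: {H} d HK => d HK; split; apply: (@quad_is_derive _ _ _ _ _ _ K) => s; apply: le_trans (HK s).
  apply: le_trans (normRe _); by rewrite !ReD !ReN ReM /= mul0r subr0.
apply: le_trans (normIm _); by rewrite !ImD !ImN ImM /= mul0r addr0.
Qed.

(** Orthogonality: a character that is not constant is, up to a factor, a
   derivative along some axis of a periodic function. *)
Lemma torus_int_echar n (p : 'rV[int]_n) :
  torus_int (echar p : 'rV[R]_n -> R[i]) = (p == 0)%:R.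
Proof.
have [->|p0] := eqVneq p 0.
  rewrite /torus_int -[RHS]/(1 +i* 0)%C; congr (Complex _ _).
    by under eq_fun do rewrite echar0; exact: torus_r_cst.
  by under eq_fun do rewrite echar0; exact: torus_r_cst.
have [j pj] : exists j, p 0 j != 0.
  apply/existsP; rewrite -negb_forall; apply: contra p0 => /forallP p0.
  by apply/eqP/rowP => i; rewrite mxE; apply/eqP.
have per (x : 'rV[R]_n) : echar p (x + delta_mx 0 j) = echar p x.
  rewrite -[RHS](echar_periodic p (delta_mx 0 j)); congr (echar p (_ + _)).
  by apply/rowP => i; rewrite !mxE; case: (_ && _).
have := torus_int_partial (ccont_echar p) _ (fun x => cderiv_echar p x j) per.
rewrite torus_intZ; last exact: ccont_echar.
move=> /(_ (ccontZ _ (ccont_echar p))) /eqP; rewrite mulf_eq0 => /orP[|/eqP//].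
rewrite mulf_eq0 intr_eq0 (negPf pj) orbF eq_complex /= eqxx mulf_eq0 pnatr_eq0 /=.
by rewrite gt_eqF // pi_gt0.
Qed.

End Exponential.

(** * Fourier series *)

Section FourierSeries.
Context {R : realType} {n : nat}.
Local Open Scope classical_set_scope.
Local Notation Zn := 'rV[int]_n.
Implicit Types (u v : 'rV[R]_n -> R[i]) (p q : Zn) (x : 'rV[R]_n) (c : Zn -> R[i]).

Definition fcoef u p : R[i] := torus_int (fun x => u x * echar (- p) x).

Definition fseries c x : R[i] := sumZ (fun p => c p * echar p x).

Lemma sum_PsiC (C : R) : 0 <= C -> sum_le (fun p : Zn => C * Psi p ^- 2) (C * 3 ^+ n).
Proof. by move=> C0; apply: sum_le_scale => //; exact: sum_Psi. Qed.

Lemma rapid_bound c (M : nat) : rapid c ->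
  exists2 C : R, 0 <= C & forall p, cmod (c p) <= C * Psi p ^- M.
Proof.
move=> rc; have [C hC] := rc M; exists C => //.
by have := le_trans (cmod_ge0 _) (hC 0); rewrite Psi0 expr1n divr1.
Qed.

Lemma rapid_le c c' (K : R) (M : nat) : rapid c -> 0 <= K ->
  (forall p, cmod (c' p) <= K * Psi p ^+ M * cmod (c p)) -> rapid c'.
Proof.
move=> rc K0 h N; have [C hC] := rc (M + N)%N; exists (K * C) => p.
apply: le_trans (h p) _; rewrite -!mulrA ler_wpM2l //.
have P0 := PsiX_gt0 (R := R) p M.
apply: le_trans (ler_wpM2l (ltW P0) (hC p)) _.
by rewrite exprD invfM mulrCA mulVKf // ?gt_eqF // mulrA.
Qed.

Lemma rapidZ (a : R[i]) c : rapid c -> rapid (fun p => a * c p).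
Proof.
move=> rc; apply: (@rapid_le c _ (cmod a) 0) => // [|p]; first exact: cmod_ge0.
by rewrite expr0 mulr1 cmodM.
Qed.

Lemma rapidD c c' : rapid c -> rapid c' -> rapid (fun p => c p + c' p).
Proof.
move=> rc rc' M; have [C hC] := rc M; have [C' hC'] := rc' M; exists (C + C') => p.
by apply: le_trans (cmodD _ _) _; rewrite mulrDl lerD.
Qed.

Lemma rapidB c c' : rapid c -> rapid c' -> rapid (fun p => c p - c' p).
Proof.
move=> rc rc' M; have [C hC] := rc M; have [C' hC'] := rc' M; exists (C + C') => p.
by apply: le_trans (cmodB _ _) _; rewrite mulrDl lerD.
Qed.

Lemma rapidN c : rapid c -> rapid (fun p => c (- p)).
Proof. by move=> rc M; have [C hC] := rc M; exists C => p; rewrite -PsiN. Qed.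

Lemma fseries_dom c x (C : R) : (forall p, cmod (c p) <= C * Psi p ^- 2) ->
  summable_by (fun p => C * Psi p ^- 2) (fun p => c p * echar p x).
Proof. by move=> hC p; rewrite cmodM cmod_echar mulr1. Qed.

Lemma fseries_approx c : rapid c -> forall e : R, 0 < e -> exists s0 : seq Zn,
  forall s, uniq s -> {subset s0 <= s} ->
  forall x, cmod (fseries c x - \sum_(p <- s) c p * echar p x) <= e.
Proof.
move=> /(@rapid_bound _ 2)[C C0 hC] e e0.
have [s0 _ H] := sumZ_dom (sum_PsiC C0) e0; exists s0 => s us ss x.
rewrite -[e]mul1r; apply: H => // p; rewrite mul1r; exact: fseries_dom.
Qed.

Lemma fseries_lin (a : R[i]) c c' x : rapid c -> rapid c' ->
  fseries (fun p => a * c p + c' p) x = a * fseries c x + fseries c' x.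
Proof.
move=> /(@rapid_bound _ 2)[C C0 hC] /(@rapid_bound _ 2)[C' C0' hC'].
have w0 := sum_PsiC (addr_ge0 C0 C0').
rewrite /fseries -(sumZ_lin a w0); first by congr sumZ; apply/funext => p; rewrite mulrDl mulrA.
- apply: fseries_dom => p; apply: le_trans (hC p) _.
  by rewrite ler_wpM2r ?lerDl // invr_ge0 ltW // PsiX_gt0.
- apply: fseries_dom => p; apply: le_trans (hC' p) _.
  by rewrite ler_wpM2r ?lerDr // invr_ge0 ltW // PsiX_gt0.
Qed.

Lemma fseries0 x : fseries (fun=> 0) x = 0.
Proof.
have r0 : rapid (fun _ : Zn => 0 : R[i]) by move=> M; exists 0 => p; rewrite cmod0 mul0r.
have E := fseries_lin (-1) x r0 r0; have z0 (z : R[i]) : -1 * z + z = 0 by ring.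
rewrite [RHS]z0 in E; apply: etrans E.
by congr (fseries _ x); apply/funext => p; rewrite z0.
Qed.

Lemma fseriesZ (a : R[i]) c x : rapid c -> fseries (fun p => a * c p) x = a * fseries c x.
Proof.
move=> rc; have r0 : rapid (fun _ : Zn => 0 : R[i]) by move=> M; exists 0 => p; rewrite cmod0 mul0r.
rewrite -[RHS]addr0 -(fseries0 x) -fseries_lin //.
by congr (fseries _ x); apply/funext => p; rewrite addr0.
Qed.

Lemma fseriesD c c' x : rapid c -> rapid c' ->
  fseries (fun p => c p + c' p) x = fseries c x + fseries c' x.
Proof.
move=> rc rc'; rewrite -[fseries c x]mul1r -fseries_lin //.
by congr (fseries _ x); apply/funext => p; rewrite mul1r.
Qed.

Lemma fseriesB c c' x : rapid c -> rapid c' ->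
  fseries (fun p => c p - c' p) x = fseries c x - fseries c' x.
Proof.
move=> rc rc'; rewrite addrC -mulN1r -fseries_lin //.
by congr (fseries _ x); apply/funext => p; rewrite mulN1r addrC.
Qed.

Lemma fseries_bound c (C : R) x : 0 <= C -> (forall p, cmod (c p) <= C * Psi p ^- 2) ->
  cmod (fseries c x) <= C * 3 ^+ n.
Proof. by move=> C0 hC; apply: (sumZ_bound (sum_PsiC C0)); exact: fseries_dom. Qed.

Lemma unif_approx_continuous (T : topologicalType) (f : T -> R) :
  (forall e : R, 0 < e -> exists2 g : T -> R, continuous g &
     forall z, `|f z - g z| <= e) -> continuous f.
Proof.
move=> H z; apply/cvgrPdist_le => e e0.
have e3 : 0 < e / 3 by rewrite divr_gt0.
have [g cg hg] := H _ e3; have /cvgrPdist_le /(_ _ e3) near_g := cg z.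
near=> y; have hy : `|g z - g y| <= e / 3 by near: y; exact: near_g.
have -> : f z - f y = (f z - g z) + (g z - g y) - (f y - g y) by ring.
have -> : e = e / 3 + e / 3 + e / 3 by field.
apply: le_trans (ler_normB _ _) _; apply: lerD; last exact: hg.
by apply: le_trans (ler_normD _ _) _; apply: lerD => //; exact: hg.
Unshelve. all: by end_near. Qed.

Lemma ccont_fseries c : rapid c -> ccont (fseries c).
Proof.
move=> rc; have cs s : ccont (fun x => \sum_(p <- s) c p * echar p x).
  by apply: ccont_sum => p; apply: ccontZ; exact: ccont_echar.
split; apply: unif_approx_continuous => e e0; have [s0 H] := fseries_approx rc e0.
- exists (fun x => complex.Re (\sum_(p <- undup s0) c p * echar p x)).
    by have [] := cs (undup s0).
  move=> x; rewrite -ReN -ReD; apply: le_trans (normRe _) _.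
  by apply: H; [exact: undup_uniq|move=> p; rewrite mem_undup].
- exists (fun x => complex.Im (\sum_(p <- undup s0) c p * echar p x)).
    by have [] := cs (undup s0).
  move=> x; rewrite -ImN -ImD; apply: le_trans (normIm _) _.
  by apply: H; [exact: undup_uniq|move=> p; rewrite mem_undup].
Qed.

(** Uniform convergence of the series allows its integration term by term. *)
Lemma torus_int_fseries u c (B : R) : ccont u -> (forall x, cube x -> cmod (u x) <= B) ->
  rapid c ->
  torus_int (fun x => u x * fseries c x) =
  sumZ (fun p => c p * torus_int (fun x => u x * echar p x)).
Proof.
move=> cu uB rc.
have cue p : ccont (fun x => u x * echar p x) by apply: ccontM => //; exact: ccont_echar.
have B0 : 0 <= B.
  apply: le_trans (cmod_ge0 _) (uB 0 _) => j; rewrite mxE lexx; exact: ler01.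
have [C C0 hC] := rapid_bound 2 rc.
have wB := sum_PsiC (mulr_ge0 C0 (addr_ge0 B0 B0)).
apply/esym/(sumZ_eq wB) => [p|e e0].
  rewrite cmodM [leRHS]mulrAC; apply: ler_pM; rewrite ?cmod_ge0 //.
  apply: torus_int_bound => // x cx; rewrite cmodM cmod_echar mulr1; exact: uB.
have d0 : 0 < e / (B + B + 1) by rewrite divr_gt0 // ltr_wpDl // addr_ge0.
have [s0 H] := fseries_approx rc d0; exists s0 => s us ss.
have -> : \sum_(p <- s) c p * torus_int (fun x => u x * echar p x) =
    torus_int (fun x => u x * \sum_(p <- s) c p * echar p x).
  rewrite (_ : (fun x => _) = fun x => \sum_(p <- s) c p * (u x * echar p x)).
    rewrite torus_int_sum => [|p]; last exact: ccontZ.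
    by apply: eq_bigr => p _; rewrite torus_intZ.
  by apply/funext => x; rewrite mulr_sumr; apply: eq_bigr => p _; rewrite mulrCA.
have cs : ccont (fun x => \sum_(p <- s) c p * echar p x).
  by apply: ccont_sum => p; apply: ccontZ; exact: ccont_echar.
rewrite -torus_intB; try (apply: ccontM => //; exact: ccont_fseries).
have k : B * (e / (B + B + 1)) + B * (e / (B + B + 1)) <= e.
  rewrite -mulrDl mulrCA ler_piMr ?(ltW e0) // ler_pdivrMr ?mul1r ?lerDl //.
  by rewrite ltr_wpDl // addr_ge0.
apply: le_trans k; apply: torus_int_bound.
  apply: ccontB; apply: ccontM => //; exact: ccont_fseries.
move=> x cx; rewrite -mulrBr cmodM; apply: ler_pM; rewrite ?cmod_ge0 ?uB //.
exact: H.
Qed.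

Lemma sumZ_single c q : rapid c -> sumZ (fun p => c p * (p == q)%:R) = c q.
Proof.
move=> /(@rapid_bound _ 2)[C C0 hC]; apply: (sumZ_eq (sum_PsiC C0)) => [p|e e0].
  rewrite cmodM cmod_nat; case: eqP => _; first by rewrite mulr1.
  by rewrite mulr0 mulr_ge0 // invr_ge0 ltW // PsiX_gt0.
exists [:: q] => s us ss; rewrite (bigD1_seq q) //=; last by rewrite ss ?mem_head.
rewrite eqxx mulr1 big1 => [|p /negPf ->]; last by rewrite mulr0.
by rewrite addr0 subrr cmod0 ltW.
Qed.

Lemma fcoef_fseries c : rapid c -> fcoef (fseries c) = c.
Proof.
move=> rc; apply/funext => q; rewrite /fcoef.
under eq_fun do rewrite mulrC.
rewrite (@torus_int_fseries _ _ 1) //; first last.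
- by move=> x _; rewrite cmod_echar.
- exact: ccont_echar.
rewrite -[RHS](sumZ_single q rc); congr sumZ; apply/funext => p; congr (_ * _).
under eq_fun do rewrite -echarDl.
by rewrite torus_int_echar addrC subr_eq0.
Qed.

Lemma rapid_mulcoord c j : rapid c ->
  rapid (fun p => (0 +i* (2 * pi))%C * (p 0 j)%:~R * c p).
Proof.
move=> rc; apply: (@rapid_le c _ (cmod (0 +i* (2 * pi))%C) 1) => //.
  exact: cmod_ge0.
move=> p; rewrite !cmodM ler_wpM2r ?cmod_ge0 // ler_wpM2l ?cmod_ge0 //.
by rewrite cmod_int expr1; apply: le_trans (Psi_coord p j); rewrite lerDr.
Qed.

(** Up to a constant, the errors of the terms are at most [Psi p ^+ 2 * s ^+ 2]
   times the coefficients and remain summable. *)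
Lemma cderiv_fseries c j x : rapid c ->
  cderiv x (delta_mx 0 j) (fseries c) (fseries (fun p => (0 +i* (2 * pi))%C * (p 0 j)%:~R * c p) x).
Proof.
move=> rc; have rc' := rapid_mulcoord j rc; set c' := (X in fseries X x) in rc' *.
have [C C0 hC] := rapid_bound 4 rc.
have [C2 C20 hC2] := rapid_bound 2 rc; have [C3 C30 hC3] := rapid_bound 2 rc'.
pose D := 2 * (2 * pi) ^+ 2 * C.
have D0 : 0 <= D by rewrite /D mulr_ge0 // mulr_ge0 // sqr_ge0.
have H (s : R) : cmod (fseries c (x + s *: delta_mx 0 j) - fseries c x - (s%:C)%C * fseries c' x)
    <= D * 3 ^+ n * s ^+ 2.
  have P2 (p : Zn) : 0 <= Psi p ^- 2 :> R by rewrite invr_ge0 ltW // PsiX_gt0.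
  have C23 : 0 <= C2 + C3 by rewrite addr_ge0.
  have w23 := sum_PsiC C23.
  have d1 y : summable_by (fun p => (C2 + C3) * Psi p ^- 2) (fun p => c p * echar p y).
    by apply: fseries_dom => p; apply: le_trans (hC2 p) _; rewrite ler_wpM2r ?lerDl.
  have d2 : summable_by (fun p => (C2 + C3) * Psi p ^- 2) (fun p => c' p * echar p x).
    by apply: fseries_dom => p; apply: le_trans (hC3 p) _; rewrite ler_wpM2r ?lerDr.
  have d3 : summable_by (fun p => 2 * (C2 + C3) * Psi p ^- 2)
      (fun p => c p * echar p (x + s *: delta_mx 0 j) - c p * echar p x).
    move=> p; apply: le_trans (cmodB _ _) _; rewrite -mulrA mulr_natl mulr2n.
    by apply: lerD; exact: d1.
  have d4 : summable_by (fun p => (cmod (s%:C)%C + 2) * (C2 + C3) * Psi p ^- 2)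
      (fun p => (s%:C)%C * (c' p * echar p x)).
    move=> p; rewrite cmodM -mulrA; apply: ler_pM; rewrite ?cmod_ge0 //.
    by rewrite lerDl.
  have d3' : summable_by (fun p => (cmod (s%:C)%C + 2) * (C2 + C3) * Psi p ^- 2)
      (fun p => c p * echar p (x + s *: delta_mx 0 j) - c p * echar p x).
    move=> p; apply: le_trans (d3 p) _; rewrite -!mulrA ler_wpM2r ?mulr_ge0 //.
    by rewrite lerDr cmod_ge0.
  have w4 : sum_le (fun p : Zn => (cmod (s%:C)%C + 2) * (C2 + C3) * Psi p ^- 2)
      ((cmod (s%:C)%C + 2) * (C2 + C3) * 3 ^+ n).
    by apply: sum_PsiC; rewrite mulr_ge0 // addr_ge0 // cmod_ge0.
  rewrite /fseries -(sumZZ _ w23 d2) -(sumZB w23 (d1 _) (d1 _)) -(sumZB w4 d3' d4).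
  have -> : D * 3 ^+ n * s ^+ 2 = D * s ^+ 2 * 3 ^+ n by rewrite mulrAC.
  apply: (sumZ_bound (sum_PsiC _)); first by rewrite mulr_ge0 // sqr_ge0.
  move=> p; have -> : c p * echar p (x + s *: delta_mx 0 j) - c p * echar p x -
      (s%:C)%C * (c' p * echar p x) = c p * (echar p (x + s *: delta_mx 0 j)
      - echar p x - (s%:C)%C * ((0 +i* (2 * pi))%C * (p 0 j)%:~R * echar p x)).
    by rewrite /c'; ring.
  rewrite cmodM; apply: le_trans (ler_pM (cmod_ge0 _) (cmod_ge0 _) (hC p) (echar_taylor p x j s)) _.
  have hj : (p 0 j)%:~R ^+ 2 <= Psi p ^+ 2 :> R.
    rewrite -real_normK ?num_real // ler_expn //.
    by apply: le_trans (Psi_coord p j); rewrite lerDr.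
  have -> : C * Psi p ^- 4 * (2 * (2 * pi * (p 0 j)%:~R * s) ^+ 2) =
      D * s ^+ 2 * (Psi p ^- 4 * (p 0 j)%:~R ^+ 2) by rewrite /D; ring.
  apply: ler_wpM2l; first by rewrite mulr_ge0 // sqr_ge0.
  rewrite mulrC ler_pdivrMr ?PsiX_gt0 //; apply: le_trans hj _.
  by rewrite -[4%N]/(2 + 2)%N exprD mulKf // gt_eqF // PsiX_gt0.
move: (fseries c' x) H => d H; split; apply: (@quad_is_derive _ _ _ _ _ _ (D * 3 ^+ n)) => s;
  apply: le_trans (H s).
  by apply: le_trans (normRe _); rewrite !ReD !ReN ReM /= mul0r subr0.
by apply: le_trans (normIm _); rewrite !ImD !ImN ImM /= mul0r addr0.
Qed.

Lemma partial_fseries c j : rapid c ->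
  partial j (fseries c) = fseries (fun p => (0 +i* (2 * pi))%C * (p 0 j)%:~R * c p).
Proof. by move=> rc; apply: cderiv_partial => x; exact: cderiv_fseries. Qed.

Lemma smooth_fseries c : rapid c -> smooth (fseries c).
Proof.
move=> rc s v.
have [c' rc' ->] : exists2 c', rapid c' & v = fseries c'.
  rewrite /v; elim: s {v} => [|j s [c' rc' IH]] /=; first by exists c.
  exists (fun p => (0 +i* (2 * pi))%C * (p 0 j)%:~R * c' p).
    exact: rapid_mulcoord.
  by rewrite IH partial_fseries.
have [c1 c2] := ccont_fseries rc'; split=> // j x.
by have [h1 h2] := cderiv_fseries j x rc'; split; exact: ex_derive.
Qed.

Lemma Zperiodic_fseries c : Zperiodic (fseries c).
Proof.
move=> q x; congr sumZ; apply/funext => p; congr (_ * _); exact: echar_periodic.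
Qed.

Lemma twopi_neq0 : (0 +i* (2 * pi))%C != 0 :> R[i].
Proof.
by rewrite eq_complex /= eqxx mulf_eq0 pnatr_eq0 /= gt_eqF // pi_gt0.
Qed.

Lemma cmod_falling (z : int) (l : nat) :
  cmod (falling z%:~R l : R[i]) <= l`!%:R * (1 + `|z%:~R|) ^+ l.
Proof.
elim: l => [|l IH]; first by rewrite /falling big_ord0 cmod1 mul1r expr0.
rewrite fallingS cmodM factS natrM exprSr [_%:R * _]mulrC mulrACA.
apply: ler_pM; rewrite ?cmod_ge0 //.
apply: le_trans (cmodB _ _) _; rewrite cmod_int cmod_nat -natr1.
have := normr_ge0 (z%:~R : R); have := ler0n R l; nra.
Qed.

Lemma rapid_falling c j l : rapid c -> rapid (fun p => falling (p 0 j)%:~R l * c p).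
Proof.
move=> rc; apply: (@rapid_le c _ (l`!%:R) l) => // p.
rewrite cmodM ler_wpM2r ?cmod_ge0 //; apply: le_trans (cmod_falling _ _) _.
by rewrite ler_wpM2l // ler_expn ?Psi_coord // addr_ge0.
Qed.

Lemma Dfall1_fseries c j l : rapid c ->
  Dfall1 j l (fseries c) = fseries (fun p => falling (p 0 j)%:~R l * c p).
Proof.
move=> rc; elim: l => [|l IH].
  by congr fseries; apply/funext => p; rewrite /falling big_ord0 mul1r.
have rl := rapid_falling j l rc.
apply/funext => x; rewrite /= IH partial_fseries //.
rewrite -(fseriesZ _ x (rapid_mulcoord j rl)) -(fseriesZ _ x rl).
rewrite -fseriesB; [|by apply: rapidZ; exact: rapid_mulcoord|exact: rapidZ].
congr (fseries _ x); apply/funext => p; rewrite fallingS.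
by rewrite -!mulrA mulKf ?twopi_neq0 //; ring.
Qed.

Lemma Dfall_fseries c (b : 'I_n -> nat) : rapid c ->
  Dfall b (fseries c) = fseries (fun p => pfall p b * c p) /\ rapid (fun p => pfall p b * c p).
Proof.
move=> rc; rewrite /Dfall /pfall.
have -> : (fun p : Zn => (\prod_j falling (p 0 j)%:~R (b j)) * c p) =
    (fun p => (\prod_(j <- enum 'I_n) falling (p 0 j)%:~R (b j)) * c p).
  by apply/funext => p; rewrite big_enum.
elim: (enum 'I_n) => [|j s [IH rs]] /=.
  have -> : (fun p : Zn => (\prod_(j <- [::]) falling (p 0 j)%:~R (b j)) * c p) = c.
    by apply/funext => p; rewrite big_nil mul1r.
  by [].
rewrite IH Dfall1_fseries //.
have -> : (fun p : Zn => (\prod_(i <- j :: s) falling (p 0 i)%:~R (b i)) * c p) =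
  (fun p => falling (p 0 j)%:~R (b j) * ((\prod_(i <- s) falling (p 0 i)%:~R (b i)) * c p)).
  by apply/funext => p; rewrite big_cons mulrA.
by split=> //; exact: rapid_falling.
Qed.

End FourierSeries.

(** * Fourier inversion *)

Section FourierInversion.
Context {R : realType} {n : nat}.
Local Open Scope classical_set_scope.
Local Notation Zn := 'rV[int]_n.
Implicit Types (u v : 'rV[R]_n -> R[i]) (p q : Zn) (x : 'rV[R]_n) (c : Zn -> R[i]).

Lemma smooth_ccont u : smooth u -> ccont u.
Proof. by move=> /(_ [::])[]. Qed.

Lemma smooth_cderiv u j x : smooth u -> cderiv x (delta_mx 0 j) u (partial j u x).
Proof.
move=> /(_ [::])[_ _ /(_ j x)[h1 h2]]; split; split=> //.
Qed.

Lemma smooth_partial u j : smooth u -> smooth (partial j u).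
Proof. by move=> su s; have := su (rcons s j); rewrite foldr_rcons. Qed.

Lemma smooth_lin (a : R[i]) u v : smooth u -> smooth v -> smooth (fun x => a * u x + v x).
Proof.
move=> su sv s w.
have [u' [v' [su' sv' ->]]] : exists u' v', [/\ smooth u', smooth v' &
    w = fun x => a * u' x + v' x].
  rewrite /w; elim: s {w} => [|j s [u' [v' [su' sv' IH]]]] /=; first by exists u, v.
  exists (partial j u'), (partial j v'); split; try exact: smooth_partial.
  rewrite IH; apply: cderiv_partial => x.
  by apply: cderiv_lin; exact: smooth_cderiv.
have [c1 c2] : ccont (fun x => a * u' x + v' x).
  by apply: ccontD; [apply: ccontZ; exact: smooth_ccont|exact: smooth_ccont].
split=> // j x.
have [h1 h2] := cderiv_lin a (smooth_cderiv j x su') (smooth_cderiv j x sv').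
by split; exact: ex_derive.
Qed.

Lemma smoothZ (a : R[i]) u : smooth u -> smooth (fun x => a * u x).
Proof.
move=> su; have -> : (fun x => a * u x) = fun x => (a - 1) * u x + u x.
  by apply/funext => x; ring.
exact: smooth_lin.
Qed.

Lemma smoothB u v : smooth u -> smooth v -> smooth (fun x => u x - v x).
Proof.
move=> su sv; have -> : (fun x => u x - v x) = fun x => -1 * v x + u x.
  by apply/funext => x; ring.
exact: smooth_lin.
Qed.

Lemma Zperiodic_partial u j : Zperiodic u -> Zperiodic (partial j u).
Proof.
move=> pu q x; rewrite /partial /derive.
have E (f : R[i] -> R) : (fun h : R => h^-1 *: (((fun y => f (u y)) \o shift (x + map_mx intr q))
      (h *: delta_mx 0 j) - f (u (x + map_mx intr q)))) =
    (fun h : R => h^-1 *: (((fun y => f (u y)) \o shift x) (h *: delta_mx 0 j) - f (u x))).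
  by apply/funext => h /=; rewrite addrA !pu.
by rewrite !E.
Qed.

Lemma Dfall1_smooth u j l : smooth u -> Zperiodic u ->
  smooth (Dfall1 j l u) /\ Zperiodic (Dfall1 j l u).
Proof.
move=> su pu; elim: l => //= l [sl pl]; split.
  by apply: smoothB; apply: smoothZ => //; exact: smooth_partial.
by move=> q x; rewrite pl (Zperiodic_partial j pl).
Qed.

Lemma Zperiodic_step u j x : Zperiodic u -> u (x + delta_mx 0 j) = u x.
Proof.
move=> pu; rewrite -[RHS](pu (delta_mx 0 j)); congr (u (_ + _)).
by apply/rowP => i; rewrite !mxE; case: (_ && _).
Qed.

(** Integration by parts: the derivative of [u] times a character has integral
   zero. *)
Lemma fcoef_partial u j p : smooth u -> Zperiodic u ->
  fcoef (partial j u) p = (0 +i* (2 * pi))%C * (p 0 j)%:~R * fcoef u p.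
Proof.
move=> su pu; pose e : 'rV[R]_n -> R[i] := echar (- p).
pose k : R[i] := (0 +i* (2 * pi))%C * ((- p) 0 j)%:~R.
have ce : ccont e by exact: ccont_echar.
have cu := smooth_ccont su; have cu' := smooth_ccont (smooth_partial j su).
have d x : cderiv x (delta_mx 0 j) (fun y => u y * e y)
    (partial j u x * e x + u x * (k * e x)).
  by apply: cderivM; [exact: smooth_cderiv|exact: cderiv_echar].
have cd : ccont (fun x => partial j u x * e x + u x * (k * e x)).
  by apply: ccontD; apply: ccontM => //; exact: ccontZ.
have per x : u (x + delta_mx 0 j) * e (x + delta_mx 0 j) = u x * e x.
  by rewrite (Zperiodic_step _ _ pu) /e (Zperiodic_step _ _ (echar_periodic _)).
have := torus_int_partial (ccontM cu ce) cd d per.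
rewrite torus_intD; [|exact: ccontM|by apply: ccontM => //; exact: ccontZ].
have -> : (fun x => u x * (k * e x)) = fun x => k * (u x * e x).
  by apply/funext => x; rewrite mulrCA.
rewrite torus_intZ; last exact: ccontM.
move=> /eqP; rewrite addr_eq0 => /eqP; rewrite -/(fcoef _ _) -/(fcoef _ _) => ->.
by rewrite /k mxE intrN mulrN mulNr opprK.
Qed.

Lemma fcoef_lin (a b : R[i]) u v p : ccont u -> ccont v ->
  fcoef (fun x => a * u x - b * v x) p = a * fcoef u p - b * fcoef v p.
Proof.
move=> cu cv; have ce := ccont_echar (R := R) (- p).
rewrite /fcoef -!torus_intZ -?torus_intB; try (do ?[exact: ccontM|apply: ccontZ]).
by congr torus_int; apply/funext => x; rewrite mulrBl !mulrA.
Qed.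

Lemma fcoef_Dfall1 u j l p : smooth u -> Zperiodic u ->
  fcoef (Dfall1 j l u) p = falling (p 0 j)%:~R l * fcoef u p.
Proof.
move=> su pu; elim: l => [|l IH]; first by rewrite /falling big_ord0 mul1r.
have [sl pl] := Dfall1_smooth j l su pu.
rewrite /= fcoef_lin; [|apply: smooth_ccont; exact: smooth_partial|exact: smooth_ccont].
rewrite fcoef_partial // IH fallingS -!mulrA mulKf ?twopi_neq0 //; ring.
Qed.

Lemma fcoef_Dfall u b p : smooth u -> Zperiodic u ->
  [/\ smooth (Dfall b u), Zperiodic (Dfall b u) & fcoef (Dfall b u) p = pfall p b * fcoef u p].
Proof.
move=> su pu; rewrite /Dfall /pfall -big_enum.
elim: (enum 'I_n) => [|j s [ss ps IH]] /=; first by rewrite big_nil mul1r.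
have [s1 p1] := Dfall1_smooth j (b j) ss ps.
by split=> //; rewrite fcoef_Dfall1 // IH big_cons mulrA.
Qed.

Lemma fcoef_bound u p (B : R) : ccont u -> (forall x, cube x -> cmod (u x) <= B) ->
  cmod (fcoef u p) <= B + B.
Proof.
move=> cu uB; apply: torus_int_bound; first by apply: ccontM => //; exact: ccont_echar.
by move=> x cx; rewrite cmodM cmod_echar mulr1; exact: uB.
Qed.

(** When [|z| >= 2 M] every factor of the falling power is at least half of [z]
   in modulus; the remaining [z] are finitely many. *)
Lemma falling_ge (M : nat) : exists2 C : R, 0 < C &
  forall z : int, (1 + `|z%:~R|) ^+ M <= C * (1 + cmod (falling z%:~R M : R[i])).
Proof.
have aux (L : nat) : (L <= M)%N -> forall z : int, 2 * M%:R <= `|z%:~R| :> R ->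
    `|z%:~R| ^+ L <= 2 ^+ L * cmod (falling z%:~R L : R[i]).
  elim: L => [|L IH] LM z hz; first by rewrite !expr0 /falling big_ord0 cmod1 mul1r.
  rewrite fallingS cmodM !exprSr mulrACA; apply: ler_pM; rewrite ?exprn_ge0 ?IH ?(ltnW LM) //.
  have h1 : `|z%:~R| <= cmod (z%:~R - L%:R : R[i]) + L%:R.
    rewrite -cmod_int -(cmod_nat L); apply: le_trans (cmodD _ _).
    by rewrite subrK.
  have h2 : L%:R <= M%:R :> R by rewrite ler_nat ltnW.
  by lra.
pose C := (1 + 2 * M%:R) ^+ M + 4 ^+ M : R.
exists C; first by rewrite ltr_pwDl ?exprn_ge0 // exprn_gt0 // ltr_pwDl // mulr_ge0.
move=> z; have f0 := cmod_ge0 (falling z%:~R M : R[i]).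
have [hz|hz] := leP (2 * M%:R) `|z%:~R : R|; last first.
  apply: le_trans (_ : (1 + 2 * M%:R) ^+ M <= _).
    by rewrite ler_expn ?addr_ge0 // lerD2l ltW.
  apply: le_trans (_ : C * 1 <= _); first by rewrite mulr1 lerDl exprn_ge0.
  rewrite ler_wpM2l ?lerDl // addr_ge0 ?exprn_ge0 // addr_ge0 // mulr_ge0 //.
case: (posnP M) => [M0|M0].
  rewrite M0 expr0 /C M0 !expr0; have := cmod_ge0 (falling z%:~R 0 : R[i]); lra.
have z1 : 1 <= `|z%:~R : R|.
  apply: le_trans hz; have : 1 <= M%:R :> R by rewrite ler1n.
  lra.
apply: le_trans (_ : (2 * `|z%:~R|) ^+ M <= _).
  by rewrite ler_expn ?addr_ge0 //; lra.
rewrite exprMn; apply: le_trans (ler_wpM2l _ (aux M (leqnn _) z hz)) _.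
  by rewrite exprn_ge0.
rewrite mulrA -exprMn; have -> : 2 * 2 = 4 :> R by ring.
rewrite /C mulrDl mulrDr mulr1 mulrDr mulr1.
have : 0 <= (1 + 2 * M%:R) ^+ M :> R by rewrite exprn_ge0 // addr_ge0 // mulr_ge0.
have : 0 <= 4 ^+ M :> R by rewrite exprn_ge0.
set D := (4 ^+ M : R); set A := ((1 + 2 * M%:R) ^+ M : R) => D0 A0.
by have := mulr_ge0 A0 f0; lra.
Qed.

(** Expanding the product over the coordinates leaves falling powers with all
   exponents [0] or [M]. *)
Lemma Psi_le_pfall (M : nat) : exists2 C : R, 0 < C & forall p,
  Psi p ^+ M <= C * \sum_(J : {set 'I_n})
     cmod (pfall p (fun j => if j \in J then 0%N else M) : R[i]).
Proof.
have [C C0 hC] := falling_ge M; exists (C ^+ n); first by rewrite exprn_gt0.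
move=> p; rewrite /Psi -prodrXl.
apply: le_trans (_ : \prod_j (C * (1 + cmod (falling (p 0 j)%:~R M : R[i]))) <= _).
  by apply: ler_prod => j _; rewrite hC exprn_ge0 // addr_ge0.
rewrite big_split /= prodr_const card_ord ler_wpM2l ?exprn_ge0 ?(ltW C0) //.
rewrite bigA_distr; apply: ler_sum => J _; rewrite /pfall cmod_prod.
apply: ler_prod => j _; case: (j \in J) => /=; last by rewrite cmod_ge0 lexx.
by rewrite /falling big_ord0 cmod1 ler01 lexx.
Qed.

(** The constant depends on [M] only; applied at each lattice point [k], this turns
   the symbol estimates into estimates of the coefficients that are uniform in
   [k]. *)
Lemma fcoef_decay (M : nat) : exists2 C : R, 0 < C &
  forall u (B : R), smooth u -> Zperiodic u ->
  (forall (J : {set 'I_n}) x, cube x ->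
     cmod (Dfall (fun j => if j \in J then 0%N else M) u x) <= B) ->
  forall p, cmod (fcoef u p) <= C * B * Psi p ^- M.
Proof.
have [C C0 hC] := Psi_le_pfall M; pose K : R := #|{set 'I_n}|%:R.
exists (C * K * 2).
  by rewrite !mulr_gt0 // ltr0n; apply/card_gt0P; exists (finset.set0).
move=> u B su pu hB p; rewrite ler_pdivlMr ?PsiX_gt0 //.
apply: le_trans (ler_wpM2l (cmod_ge0 _) (hC p)) _.
rewrite mulrCA -!mulrA ler_wpM2l ?(ltW C0) // mulr_sumr.
apply: le_trans (_ : \sum_(J : {set 'I_n}) (B + B) <= _).
  apply: ler_sum => J _; rewrite mulrC -cmodM.
  have [s1 p1 <-] := fcoef_Dfall (fun j => if j \in J then 0%N else M) p su pu.
  by apply: fcoef_bound; [exact: smooth_ccont|exact: hB].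
rewrite sumr_const (_ : B + B = 2 * B); last by ring.
by rewrite -[leLHS]mulr_natl lexx.
Qed.

Lemma cube_compact : compact [set x : 'rV[R]_n | cube x].
Proof.
apply: bounded_closed_compact.
  exists 1; split; first exact: num_real.
  move=> r r1 x cx; rewrite /= /Num.norm /= mx_normrE.
  apply: bigmax_le => [|i _]; first by rewrite (le_trans ler01) // ltW.
  rewrite ord1; have /andP[h1 h2] := cx i.2.
  rewrite ger0_norm // (le_trans h2) // ltW //.
have -> : [set x : 'rV[R]_n | cube x] = \bigcap_j ((fun x : 'rV[R]_n => x 0 j) @^-1` `[0, 1]%classic).
  apply/seteqP; split => [x cx j _|x cx j]; first by rewrite /= in_itv; exact: cx.
  by have := cx j I; rewrite /= in_itv.
apply: closed_bigI => j _; apply: closed_comp; last exact: itv_closed.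
by move=> x _; exact: continuous_coord.
Qed.

Lemma ccont_cube_bounded u : ccont u -> exists B : R, forall x, cube x -> cmod (u x) <= B.
Proof.
move=> [c1 c2].
have cn (f : 'rV[R]_n -> R) : continuous f -> exists B, forall x, cube x -> `|f x| <= B.
  move=> cf0; have cn : {within [set x : 'rV[R]_n | cube x], continuous (fun x => `|f x|)}.
    apply: continuous_subspaceT; apply: (continuous_comp2 cf0).
    by move=> z; exact: norm_continuous.
  have ne : [set x : 'rV[R]_n | cube x] !=set0.
    by exists 0 => j; rewrite mxE lexx; exact: ler01.
  have [z _ hz] := EVT_max_rV ne cube_compact cn; exists `|f z| => x cx.
  by apply: hz; rewrite inE.
have [B1 h1] := cn _ c1; have [B2 h2] := cn _ c2; exists (B1 + B2) => x cx.
by apply: le_trans (cmod_le _) _; apply: lerD; [exact: h1|exact: h2].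
Qed.

Lemma fcoef_rapid u : smooth u -> Zperiodic u -> rapid (fcoef u).
Proof.
move=> su pu M; have [C C0 hC] := fcoef_decay M.
have bd (J : {set 'I_n}) : exists B : R, forall x, cube x ->
    cmod (Dfall (fun j => if j \in J then 0%N else M) u x) <= B.
  apply: ccont_cube_bounded; apply: smooth_ccont.
  by have [] := fcoef_Dfall (fun j => if j \in J then 0%N else M) 0 su pu.
have [B hB] := choice bd.
exists (C * \sum_J `|B J|) => p; apply: hC => // J x cx.
apply: le_trans (hB J x cx) _; apply: le_trans (ler_norm _) _.
by rewrite (bigD1 J) //= lerDl sumr_ge0.
Qed.

(** The coefficients at [p] and [- p] together determine the moments of the real
   and of the imaginary part against cosines and sines. *)
Lemma fcoef_eq0 u : ccont u -> Zperiodic u -> (forall p, fcoef u p = 0) ->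
  forall x, u x = 0.
Proof.
move=> [c1 c2] pu hu.
have k1 p : continuous (fun x => complex.Re (u x) * cos (phase p x)).
  by apply: continuousRM => //; exact: continuous_cph.
have k2 p : continuous (fun x => complex.Im (u x) * sin (phase p x)).
  by apply: continuousRM => //; exact: continuous_sph.
have k3 p : continuous (fun x => complex.Re (u x) * sin (phase p x)).
  by apply: continuousRM => //; exact: continuous_sph.
have k4 p : continuous (fun x => complex.Im (u x) * cos (phase p x)).
  by apply: continuousRM => //; exact: continuous_cph.
have hp p : [/\ torus_int_r (fun x => complex.Re (u x) * cos (phase p x)) =
      torus_int_r (fun x => complex.Im (u x) * sin (phase p x)) &
    torus_int_r (fun x => complex.Re (u x) * sin (phase p x)) =
      - torus_int_r (fun x => complex.Im (u x) * cos (phase p x))].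
  have := hu (- p); rewrite /fcoef /torus_int opprK => /eqP.
  rewrite eq_complex /= => /andP[/eqP h1 /eqP h2]; split.
    apply/eqP; rewrite -subr_eq0 -torus_rB //; apply/eqP; rewrite -[RHS]h1.
    by congr torus_int_r; apply/funext => x; rewrite ReM echarE.
  apply/eqP; rewrite -addr_eq0 -torus_rD //; apply/eqP; rewrite -[RHS]h2.
  by congr torus_int_r; apply/funext => x; rewrite ImM echarE.
have fl (f : 'rV[R]_n -> R) p : torus_int_r (fun x => f x * cos (phase (- p) x)) =
    torus_int_r (fun x => f x * cos (phase p x)).
  by congr torus_int_r; apply/funext => x; rewrite phaseNl cosN.
have fls (f : 'rV[R]_n -> R) p : continuous (fun x => f x * sin (phase p x)) ->
    torus_int_r (fun x => f x * sin (phase (- p) x)) =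
    - torus_int_r (fun x => f x * sin (phase p x)).
  move=> cf0; rewrite -torus_rN //.
  by congr torus_int_r; apply/funext => x; rewrite phaseNl sinN mulrN.
have oncube x : cube x -> u x = 0.
  move=> cx; have h1 : complex.Re (u x) = 0.
    apply: (torus_uniqueness c1) => // p; have [e1 e2] := hp p; have [] := hp (- p).
    by rewrite !fl !fls // => e3 e4; split; lra.
  have h2 : complex.Im (u x) = 0.
    apply: (torus_uniqueness c2) => // p; have [e1 e2] := hp p; have [] := hp (- p).
    by rewrite !fl !fls // => e3 e4; split; lra.
  by move: h1 h2; case: (u x) => a b /= -> ->.
(* periodicity brings any point into the cube *)
move=> x; pose q : Zn := \row_j Num.floor (x 0 j).
rewrite -(subrK (map_mx intr q) x) pu; apply: oncube => j.
have h1 := real_floor_le (num_real (x 0 j)); have h2 := real_floorD1_gt (num_real (x 0 j)).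
rewrite intrD in h2; rewrite !mxE; apply/andP; split; lra.
Qed.

(** The difference of the two sides is continuous and its Fourier coefficients
   vanish. *)
Lemma fseries_fcoef u : smooth u -> Zperiodic u -> u = fseries (fcoef u).
Proof.
move=> su pu; have rc := fcoef_rapid su pu.
apply/funext => x; apply/eqP; rewrite -subr_eq0; apply/eqP.
move: x; apply: fcoef_eq0.
- by apply: ccontB; [exact: smooth_ccont|exact: ccont_fseries].
- by move=> q x; rewrite pu Zperiodic_fseries.
- move=> p; have := @fcoef_lin 1 1 u (fseries (fcoef u)) p (smooth_ccont su) (ccont_fseries rc).
  rewrite !mul1r fcoef_fseries // subrr => <-.
  by congr (fcoef _ p); apply/funext => x; rewrite !mul1r.
Qed.

End FourierInversion.

(** * Symbol classes on the Fourier side *)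

Section Families.
Context {R : realType} {n : nat}.
Variables (mu : R) (Lambda : 'rV[int]_n -> R) (hL : weight_function mu Lambda).
Variables (rho : R) (rho0 : 0 < rho).
Local Notation Zn := 'rV[int]_n.
Implicit Types (m : R) (c F G : Zn -> Zn -> R[i]) (s t : seq 'I_n) (k p q : Zn).

(** A family [F p k] stands for the symbol with Fourier coefficients [F p k]
   in [x]. All derivatives in [x] are bounded together by the rapid decay in
   [p]. *)
Definition bnd m (w : nat) F : Prop :=
  forall M : nat, exists2 C : R, 0 <= C &
    forall p k, cmod (F p k) <= C * Lambda k `^ (m - rho * w%:R) * Psi p ^- M.

Lemma PsiV_ge0 p (M : nat) : 0 <= Psi p ^- M :> R.
Proof. by rewrite invr_ge0 ltW // PsiX_gt0. Qed.

Lemma bnd_le m w F G : bnd m w F -> (forall p k, cmod (G p k) <= cmod (F p k)) ->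
  bnd m w G.
Proof.
move=> bF GF M; have [C C0 hC] := bF M; exists C => // p k.
exact: le_trans (GF p k) (hC p k).
Qed.

Lemma bndD m w F G : bnd m w F -> bnd m w G -> bnd m w (fun p k => F p k + G p k).
Proof.
move=> bF bG M; have [C C0 hC] := bF M; have [D D0 hD] := bG M.
exists (C + D) => [|p k]; first exact: addr_ge0.
by apply: le_trans (cmodD _ _) _; rewrite !mulrDl lerD.
Qed.

Lemma bndB m w F G : bnd m w F -> bnd m w G -> bnd m w (fun p k => F p k - G p k).
Proof.
move=> bF bG; apply: bndD => //; apply: bnd_le bG _ => p k.
by rewrite cmodN.
Qed.

Lemma bndS m w F : bnd m w.+1 F -> bnd m w F.
Proof.
move=> bF M; have [C C0 hC] := bF M; have [c c0 hc] := Lambda_lb hL.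
exists (C * c `^ (- rho)) => [|p k]; first by rewrite mulr_ge0 ?powR_ge0.
apply: le_trans (hC p k) _; rewrite ler_wpM2r ?PsiV_ge0 // -mulrA ler_wpM2l //.
have -> : m - rho * w.+1%:R = - rho + (m - rho * w%:R) by rewrite -natr1; ring.
rewrite [Lambda k `^ (- rho + _)]powRD; last by rewrite (gt_eqF (Lambda_gt0 hL k)) implybT.
rewrite ler_wpM2r ?powR_ge0 // (powRN (Lambda k)) (powRN c).
rewrite lef_pV2 ?posrE ?powR_gt0 ?(Lambda_gt0 hL) //.
apply: ge0_ler_powR; rewrite ?nnegrE ?(ltW rho0) //; first exact: ltW.
exact/ltW/(Lambda_gt0 hL).
Qed.

Lemma bnd_rapid m w F k : bnd m w F -> rapid (F^~ k).
Proof. by move=> bF M; have [C C0 hC] := bF M; exists (C * Lambda k `^ (m - rho * w%:R)). Qed.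

(** Differences may be taken before or after the multiplication by the
   monomial; [mixed s t s'] is the intermediate form in which the word [s] is
   outside and the word [s'] is inside. *)
Definition mixed c s t s' p : Zn -> R[i] :=
  diffw s (fun k => kmon t k * diffw (t ++ s') (c p) k).

(** Class M as it is defined: the differences act on the product by the monomial. *)
Definition Mouter m c : Prop :=
  forall s t, uniq t -> bnd m (size s) (mixed c s t [::]).

(** The form in which class M is used: it bounds differences of the coefficients
   themselves, which are what a Newton remainder is made of. *)
Definition Minner m c : Prop :=
  forall s t, uniq t -> bnd m (size s) (mixed c [::] t s).

Lemma diffw0 s : diffw s (fun _ : Zn => 0 : R[i]) = fun=> 0.
Proof. by elim: s => //= j s ->; apply/funext => k; rewrite /diff1 subrr. Qed.

Lemma mixed_rcons c s t s' i p k : uniq t ->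
  mixed c (rcons s i) t s' p k = mixed c s t (i :: s') p k +
    (if i \in t then mixed c s (rem i t) (i :: s') p k
                     + mixed c s (rem i t) (i :: i :: s') p k else 0).
Proof.
move=> ut; rewrite /mixed -cats1 diffw_cat /= diff1_kmon // diffwD.
have -> : diff1 i (diffw (t ++ s') (c p)) = diffw (t ++ i :: s') (c p).
  rewrite -[diff1 i _]/(diffw (i :: t ++ s') (c p)); apply: diffw_perm.
  by rewrite -cat1s perm_catCA.
congr (_ + _); case: ifP => it; last by rewrite diffw0.
have E1 : diffw (t ++ s') (c p) = diffw (rem i t ++ i :: s') (c p).
  apply: diffw_perm; rewrite perm_sym -cat1s perm_catCA catA perm_cat2r /=.
  by rewrite perm_sym perm_to_rem.
have E2 : diffw (t ++ i :: s') (c p) = diffw (rem i t ++ i :: i :: s') (c p).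
  apply: diffw_perm; rewrite perm_sym -[i :: i :: s']cat1s perm_catCA catA perm_cat2r /=.
  by rewrite perm_sym perm_to_rem.
rewrite E1 E2.
rewrite (_ : (fun k => _) = fun k => kmon (rem i t) k * diffw (rem i t ++ i :: s') (c p) k
   + kmon (rem i t) k * diffw (rem i t ++ i :: i :: s') (c p) k); last first.
  by apply/funext => k'; rewrite mulrDr.
by rewrite diffwD.
Qed.

Lemma bnd_ext m w F G : bnd m w F -> (forall p k, G p k = F p k) -> bnd m w G.
Proof. by move=> bF GF; apply: bnd_le bF _ => p k; rewrite GF. Qed.

Lemma bnd0 m w : bnd m w (fun _ _ => 0).
Proof.
by move=> M; exists 0 => // p k; rewrite cmod0 !mul0r.
Qed.

Lemma Minner_mixed m c : Minner m c -> forall s t s', uniq t ->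
  bnd m (size s + size s') (mixed c s t s').
Proof.
move=> hc; elim/last_ind => [|s i IH] t s' ut; first exact: hc.
rewrite size_rcons addSnnS.
pose F p k := mixed c s t (i :: s') p k + (if i \in t then mixed c s (rem i t) (i :: s') p k
  + mixed c s (rem i t) (i :: i :: s') p k else 0).
apply: (@bnd_ext m _ F) => [|p k]; last exact: mixed_rcons.
rewrite /F; apply: bndD; first exact: (IH t (i :: s')).
case: (boolP (i \in t)) => it; last exact: bnd0.
apply: bndD; first by apply: (IH (rem i t) (i :: s')); exact: rem_uniq.
apply: bndS; rewrite -addnS; apply: (IH (rem i t) (i :: i :: s')); exact: rem_uniq.
Qed.

Lemma Minner_Mouter m c : Minner m c -> Mouter m c.
Proof. by move=> hc s t ut; have := Minner_mixed hc s [::] ut; rewrite addn0. Qed.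

(** Induction on the length of the monomial, then on the number of differences
   inside; the error terms of the Leibniz rule have shorter monomials. *)
Lemma Mouter_Minner m c : Mouter m c -> Minner m c.
Proof.
move=> hc; suff H (r : nat) s t s' : (size t <= r)%N -> uniq t ->
    bnd m (size s + size s') (mixed c s t s').
  by move=> s t ut; exact: (H (size t) [::] t s).
elim: r s t s' => [|r IHr] s t s'.
  case: t => // _ _; elim: s' s => [|i s' IH] s; first by rewrite addn0; exact: hc.
  rewrite -addSnnS -(size_rcons s i); apply: bnd_ext (IH (rcons s i)) _ => p k.
  by rewrite mixed_rcons //= addr0.
elim: s' s => [|i s' IH] s tr ut; first by rewrite addn0; exact: hc.
have E p k : mixed c s t (i :: s') p k = mixed c (rcons s i) t s' p k -
    (if i \in t then mixed c s (rem i t) (i :: s') p k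
                     + mixed c s (rem i t) (i :: i :: s') p k else 0).
  by rewrite mixed_rcons // addrK.
apply: bnd_ext E; apply: bndB.
  by rewrite -addSnnS -(size_rcons s i); exact: IH.
case: (boolP (i \in t)) => it; last exact: bnd0.
have tr' : (size (rem i t) <= r)%N by rewrite size_rem //; case: (t) it tr.
apply: bndD; first by apply: (IHr s (rem i t) (i :: s')) => //; exact: rem_uniq.
apply: bndS; rewrite -addnS; apply: (IHr s (rem i t) (i :: i :: s')) => //.
exact: rem_uniq.
Qed.

Definition kmon1 t k : R := \prod_(j <- t) (1 + `|(k 0 j)%:~R|).

Lemma kmon1_ge0 t k : 0 <= kmon1 t k.
Proof. by apply: prodr_ge0 => j _; rewrite addr_ge0. Qed.

(** The factors [1 + |k_j|] are preferred to [k_j] because they are comparable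
   under translations of [k]. *)
Lemma Minner_kmon1 m c : Minner m c -> forall s t, uniq t ->
  bnd m (size s) (fun p k => (kmon1 t k)%:C%C * diffw (t ++ s) (c p) k).
Proof.
move=> hc s t ut; suff H t2 t1 s' : uniq (t1 ++ t2) -> bnd m (size s')
    (fun p k => (kmon1 t2 k)%:C%C * (kmon t1 k * diffw (t1 ++ t2 ++ s') (c p) k)).
  by apply: bnd_ext (H t [::] s ut) _ => p k; rewrite /kmon big_nil mul1r.
elim: t2 t1 s' => [|j t2 IH] t1 s' ut12.
  rewrite cats0 in ut12; apply: bnd_ext (hc s' t1 ut12) _ => p k.
  by rewrite /kmon1 big_nil mul1r.
have u1 : uniq (t1 ++ t2).
  by move: ut12; rewrite -cat1s uniq_catCA cat_uniq => /and3P[].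
have u2 : uniq ((j :: t1) ++ t2) by move: ut12; rewrite -cat1s uniq_catCA.
have B1 := bndS (IH t1 (j :: s') u1); have B2 := IH (j :: t1) s' u2.
move=> M; have [C1 C10 h1] := B1 M; have [C2 C20 h2] := B2 M.
exists (C1 + C2) => [|p k]; first exact: addr_ge0.
have E1 : diffw (t1 ++ (j :: t2) ++ s') (c p) = diffw (t1 ++ t2 ++ j :: s') (c p).
  apply: diffw_perm; rewrite perm_cat2l /= -cat1s perm_sym -[j :: s']cat1s.
  by rewrite perm_catCA.
have E2 : diffw (t1 ++ (j :: t2) ++ s') (c p) = diffw ((j :: t1) ++ t2 ++ s') (c p).
  by apply: diffw_perm; rewrite /= -cat1s perm_catCA.
rewrite !mulrDl; apply: le_trans (lerD (h1 p k) (h2 p k)); rewrite -E1 -E2 !cmodM !cmod_real.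
rewrite /kmon1 big_cons -/(kmon1 t2 k) /kmon big_cons -/(kmon t1 k) cmodM cmod_int.
rewrite normrM ger0_norm ?addr_ge0 // (ger0_norm (kmon1_ge0 _ _)).
by rewrite le_eqVlt; apply/orP; left; apply/eqP; ring.
Qed.

Lemma kmon_kmon1 t k q : uniq t ->
  cmod (kmon t k : R[i]) <= Psi q * kmon1 t (k + q).
Proof.
move=> ut; rewrite /kmon cmod_prod.
apply: (@le_trans _ _ (\prod_(j <- t) ((1 + `|(q 0 j)%:~R|) * (1 + `|((k + q) 0 j)%:~R|)))).
  apply: ler_prod => j _; rewrite cmod_ge0 /= cmod_int.
  have -> : (k 0 j)%:~R = ((k + q) 0 j)%:~R - (q 0 j)%:~R :> R.
    by rewrite mxE intrD addrK.
  set x : R := _%:~R; set y : R := _%:~R.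
  apply: le_trans (ler_normB _ _) _.
  have := mulr_ge0 (normr_ge0 x) (normr_ge0 y); lra.
rewrite big_split /= ler_wpM2r ?kmon1_ge0 // big_uniq //= /Psi [leRHS](bigID (mem t)) /=.
rewrite ler_peMr //; first by apply: prodr_ge0 => j _; rewrite addr_ge0.
by apply: (big_ind (fun x : R => 1 <= x)) => // [x y|j _];
   [exact: mulr_ege1 | rewrite lerDl].
Qed.

End Families.

(** * Symbols and their coefficient families *)

Section Dictionary.
Context {R : realType} {n : nat}.
Variables (mu : R) (Lambda : 'rV[int]_n -> R) (hL : weight_function mu Lambda).
Variables (rho : R) (rho0 : 0 < rho).
Local Notation Zn := 'rV[int]_n.
Implicit Types (m : R) (c : Zn -> Zn -> R[i]) (s t : seq 'I_n) (k p q : Zn)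
  (x : 'rV[R]_n) (sigma : Zn -> 'rV[R]_n -> R[i]).

Lemma fseries_diffw c s k x : (forall k, rapid (c^~ k)) ->
  rapid (fun p => diffw s (c p) k) /\
  diffw s (fun k => fseries (c^~ k) x) k = fseries (fun p => diffw s (c p) k) x.
Proof.
move=> rc; elim: s k => [|j s IH] k //=.
have [r1 e1] := IH (k + delta_mx 0 j); have [r2 e2] := IH k.
split; first exact: rapidB.
by rewrite {1}/diff1 e1 e2 -fseriesB.
Qed.

Lemma fcoef_diffw sigma s k : torus_symbol sigma ->
  [/\ smooth (fun y => diffw s (sigma^~ y) k),
      Zperiodic (fun y => diffw s (sigma^~ y) k) &
      forall p, fcoef (fun y => diffw s (sigma^~ y) k) p = diffw s (fun k => fcoef (sigma k) p) k].
Proof.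
move=> hs; elim: s k => [|j s IH] k /=; first by have [] := hs k.
have [s1 p1 c1] := IH (k + delta_mx 0 j); have [s2 p2 c2] := IH k.
split; rewrite /diff1; first exact: smoothB.
  by move=> q x; rewrite p1 p2.
move=> p; rewrite -c1 -c2; have := fcoef_lin 1 1 p (smooth_ccont s1) (smooth_ccont s2).
by rewrite !mul1r => <-; congr (fcoef _ p); apply/funext => y; rewrite !mul1r.
Qed.

Lemma fcoefZ (a : R[i]) u p : ccont u -> fcoef (fun x => a * u x) p = a * fcoef u p.
Proof.
move=> cu; have := fcoef_lin a 0 p cu cu; rewrite mul0r subr0 => <-.
by congr (fcoef _ p); apply/funext => x; rewrite mul0r subr0.
Qed.

(** Fourier coefficients commute with differences in [k], and their decay comes
   from the bounds on the derivatives in [x]. *)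
Lemma Mclass_Mouter m sigma : Mclass rho Lambda m sigma ->
  Mouter Lambda rho m (fun p k => fcoef (sigma k) p).
Proof.
move=> [hs hM] s t ut.
pose g j := j \in t; pose a j := count_mem j s.
have gt (h : Zn -> R[i]) : diffs (fun j => g j : nat) h = diffw t h.
  rewrite diffsE; apply/diffw_perm/perm_word => j.
  by rewrite count_word /g count_uniq_mem.
have kt k : (kpow k g)%:~R = kmon t k :> R[i].
  rewrite -kmon_word /kmon; apply: perm_big; apply: perm_word => j.
  by rewrite count_word /g count_uniq_mem.
pose tau k x := kmon t k * diffw t (sigma^~ x) k.
have tauE : (fun k x => (kpow k g)%:~R * diffs (fun j => g j : nat) (sigma^~ x) k) = tau.
  by apply/funext => k; apply/funext => x; rewrite kt gt.
have := hM g; rewrite tauE => -[hts hS].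
have cftau k p : fcoef (tau k) p = kmon t k * diffw t (fun k => fcoef (sigma k) p) k.
  by have [s1 _ <-] := fcoef_diffw t k hs; rewrite -fcoefZ //; exact: smooth_ccont.
have sa : size s = mlen a.
  by rewrite -size_word; apply/perm_size/perm_word => j; rewrite count_word.
move=> M; have [C C0 hC] := fcoef_decay (R := R) (n := n) M.
have hB (J : {set 'I_n}) : exists B : R, 0 < B /\ forall k x,
    cmod (Dfall (fun j => if j \in J then 0%N else M) (fun y => diffs a (tau^~ y) k) x)
    <= B * Lambda k `^ (m - rho * (mlen a)%:R).
  by have [B B0 h] := hS a (fun j => if j \in J then 0%N else M); exists B.
have [B {}hB] := choice hB.
exists (C * \sum_J B J) => [|p k].
  rewrite mulr_ge0 ?(ltW C0) // sumr_ge0 // => J _.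
  by have [B0 _] := hB J; exact: ltW.
have [s1 p1 c1] := fcoef_diffw s k hts.
have -> : mixed (fun p k => fcoef (sigma k) p) s t [::] p k =
    fcoef (fun y => diffw s (tau^~ y) k) p.
  rewrite c1 /mixed cats0; congr (diffw s _ k); apply/funext => k'.
  by rewrite cftau.
rewrite -[X in X * _]mulrA; apply: hC => // J x cx.
have -> : (fun y => diffw s (tau^~ y) k) = fun y => diffs a (tau^~ y) k.
  by apply/funext => y; rewrite diffw_count.
rewrite sa; have [B0 hBJ] := hB J.
apply: le_trans (hBJ k x) _; rewrite ler_wpM2r ?powR_ge0 //.
rewrite (bigD1 J) //= lerDl sumr_ge0 // => J' _.
by have [B0' _] := hB J'; exact: ltW.
Qed.

Lemma Mouter_symbol m c : Mouter Lambda rho m c -> forall k, rapid (c^~ k).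
Proof.
move=> hc k; have := bnd_rapid k (hc [::] [::] isT).
rewrite (_ : (fun p => _) = c^~ k) //; apply/funext => p.
by rewrite /mixed /= /kmon big_nil mul1r.
Qed.

Lemma cmod_pfall p (b : 'I_n -> nat) :
  cmod (pfall p b : R[i]) <= (mfact b)%:R * Psi p ^+ mlen b.
Proof.
rewrite /pfall cmod_prod /mfact natr_prod /Psi -prodrXl -big_split /=.
apply: ler_prod => j _; rewrite cmod_ge0; apply: le_trans (cmod_falling _ _) _.
rewrite ler_wpM2l // ler_weXn2l //; first by rewrite lerDl.
by rewrite /mlen (bigD1 j) //= leq_addr.
Qed.

(** A derivative in [x] multiplies the coefficients by a polynomial in [p], which
   rapid decay absorbs before summation. *)
Lemma Mouter_Mclass m c : Mouter Lambda rho m c ->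
  Mclass rho Lambda m (fun k x => fseries (c^~ k) x).
Proof.
move=> hc; have rc := Mouter_symbol hc.
split; first by move=> k; split; [exact: Zperiodic_fseries|exact: smooth_fseries].
move=> g; pose t := word (fun j => g j : nat); have ut : uniq t by exact: uniq_word.
pose d p k := kmon t k * diffw t (c p) k.
have dE s p k : mixed c s t [::] p k = diffw s (d p) k.
  by rewrite /mixed cats0.
have rd k : rapid (d^~ k).
  have := bnd_rapid k (hc [::] t ut); rewrite (_ : (fun p => _) = d^~ k) //.
  by apply/funext => p; rewrite (dE [::]).
have tauE : (fun k x => (kpow k g)%:~R * diffs (fun j => g j : nat) (fun k => fseries (c^~ k) x) k)
    = fun k x => fseries (d^~ k) x.
  apply/funext => k; apply/funext => x; rewrite diffsE -/t.
  have [r1 ->] := fseries_diffw t k x rc; rewrite -kmon_word -fseriesZ //.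
rewrite tauE; split; first by move=> k; split; [exact: Zperiodic_fseries|exact: smooth_fseries].
move=> a b; have := hc (word a) t ut (mlen b + 2)%N; rewrite size_word => -[C C0 hC].
exists ((mfact b)%:R * C * 3 ^+ n + 1) => [|k x].
  by rewrite ltr_wpDl // !mulr_ge0.
have -> : (fun y => diffs a (fun k => fseries (d^~ k) y) k) = fseries (fun p => diffw (word a) (d p) k).
  apply/funext => y; rewrite diffsE; exact: (fseries_diffw _ _ _ rd).2.
have [r1 _] := fseries_diffw (word a) k x rd; have [-> _] := Dfall_fseries b r1.
set LL := Lambda k `^ _; have LL0 : 0 <= LL by exact: powR_ge0.
apply: (@le_trans _ _ ((mfact b)%:R * C * LL * 3 ^+ n)).
  apply: fseries_bound; first by rewrite !mulr_ge0.
  move=> p; rewrite cmodM.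
  apply: le_trans (ler_pM (cmod_ge0 _) (cmod_ge0 _) (cmod_pfall p b) _) _.
    by rewrite -dE; exact: hC.
  rewrite -/LL exprD invfM; set P := Psi p ^+ mlen b.
  have P0 : P != 0 by rewrite gt_eqF // PsiX_gt0.
  rewrite le_eqVlt; apply/orP; left; apply/eqP.
  by field; rewrite P0 gt_eqF // Psi_gt0.
by rewrite mulrAC ler_wpM2r // lerDl.
Qed.

End Dictionary.

(** * The Newton remainder in the symbol classes *)

Section Remainder.
Context {R : realType} {n : nat}.
Variables (mu : R) (Lambda : 'rV[int]_n -> R) (hL : weight_function mu Lambda).
Variables (rho : R) (rho0 : 0 < rho).
Local Notation Zn := 'rV[int]_n.
Implicit Types (m : R) (c : Zn -> Zn -> R[i]) (s t : seq 'I_n) (k p q : Zn)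
  (f : Zn -> R[i]).

Lemma newton_widen K N p f k : (N <= K)%N -> newton N N p f k = newton K.+1 N p f k.
Proof.
case: N => [|N] NK; first by rewrite /newton !big_pred0.
rewrite /newton [RHS](reindex_onto
  (fun b : {ffun 'I_n -> 'I_N.+1} => [ffun i => inord (b i) : 'I_K.+1])
  (fun a : {ffun 'I_n -> 'I_K.+1} => [ffun i => inord (a i) : 'I_N.+1])) /=; last first.
  move=> a ha; apply/ffunP => i; rewrite !ffunE inordK ?inord_val //.
  by rewrite (leq_ltn_trans _ ha) // /mlen (bigD1 i) //= leq_addr.
have bE (b : {ffun 'I_n -> 'I_N.+1}) :
    (fun i => [ffun i => inord (b i) : 'I_K.+1] i : nat) = (fun i => b i : nat).
  by apply/funext => i; rewrite ffunE inordK // (leq_trans (ltn_ord _)) // ltnW.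
apply: eq_big => [b|b _]; last by rewrite bE.
rewrite bE (_ : [ffun i => _] = b) ?eqxx ?andbT //.
apply/ffunP => i; rewrite !ffunE inordK ?inord_val //.
by rewrite (leq_trans (ltn_ord _)) // ltnW.
Qed.

Lemma newton_rem_diffw K N p s f k :
  diffw s (newton_rem K N p f) k = newton_rem K N p (diffw s f) k.
Proof.
rewrite /newton_rem /newton diffwB diffw_shift diffw_sum; congr (_ - _).
apply: eq_bigr => a _; rewrite diffwZ !diffsE -!diffw_cat; congr (_ * _).
by congr (_ k); apply: diffw_perm; rewrite perm_catC.
Qed.

Lemma newton_remZ K N p f k (z : R[i]) :
  newton_rem K N p (fun k => z * f k) k = z * newton_rem K N p f k.
Proof.
rewrite /newton_rem /newton mulrBr mulr_sumr; congr (_ - _).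
by apply: eq_bigr => a _; rewrite !diffsE diffwZ mulrCA.
Qed.

(** The remainder at [k] involves [N]-th differences at translates [k + q]; by
   Peetre's inequality and the comparison of monomials each costs a power of
   [Psi q], hence of [Psi p], which the rapid decay in [p] pays for. *)
Lemma Minner_remainder m c N : Minner Lambda rho m c ->
  Minner Lambda rho (m - rho * N%:R) (fun p k => newton_rem N N p (c (- p)) k).
Proof.
move=> hc s t ut M.
have [L [D D0 hD]] := Lambda_temperate hL (m - rho * (N + size s)%:R).
have hex : exists2 C : R, 0 <= C & forall s' p k, size s' = N ->
    kmon1 t k * cmod (diffw (t ++ s ++ s') (c p) k)
    <= C * Lambda k `^ (m - rho * (N + size s)%:R) * Psi p ^- (M + (L + 1 + N)).
  have bw (w : N.-tuple 'I_n) : exists C : R, 0 <= C /\ forall p k,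
      kmon1 t k * cmod (diffw (t ++ s ++ w) (c p) k)
      <= C * Lambda k `^ (m - rho * (N + size s)%:R) * Psi p ^- (M + (L + 1 + N)).
    have [C C0 h] := Minner_kmon1 hL rho0 hc (s ++ w) ut (M + (L + 1 + N)).
    exists C; split=> // p k; have := h p k.
    by rewrite size_cat size_tuple [(size s + N)%N]addnC cmodM cmod_real ger0_norm // kmon1_ge0.
  have [C hC] := choice bw; exists (\sum_w C w).
    by rewrite sumr_ge0 // => w _; have [] := hC w.
  move=> s' p k sN; have := hC (Tuple (introT eqP sN)) => -[_ /(_ p k) h].
  apply: le_trans h _; rewrite -!mulrA ler_wpM2r ?mulr_ge0 ?powR_ge0 ?PsiV_ge0 //.
  rewrite (bigD1 (Tuple (introT eqP sN))) //= lerDl sumr_ge0 // => w _.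
  by have [] := hC w.
have [C C0 hC] := hex.
exists (C * D) => [|p k]; first by rewrite mulr_ge0 // ltW.
(* the monomial at the base point is a constant for the Newton remainder *)
rewrite /mixed /= newton_rem_diffw -newton_remZ /newton_rem (newton_widen _ _ _ (leqnn N)).
rewrite -/(newton_rem _ _ _ _ _).
set E := m - rho * (N + size s)%:R in hD hC *.
have -> : m - rho * N%:R - rho * (size s)%:R = E by rewrite /E natrD; ring.
pose B := C * D * Lambda k `^ E * Psi p ^- (M + (L + 1 + N)).
have B0 : 0 <= B by rewrite !mulr_ge0 ?powR_ge0 ?PsiV_ge0 ?(ltW D0).
apply: le_trans (@newton_rem_bound _ _ N N (L + 1) B k _ B0 (leqnn N) _ p) _; last first.
  rewrite /B exprD; set P1 := Psi p ^+ M; set P2 := Psi p ^+ (L + 1 + N).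
  have P10 : P1 != 0 by rewrite gt_eqF // PsiX_gt0.
  have P20 : P2 != 0 by rewrite gt_eqF // PsiX_gt0.
  rewrite le_eqVlt; apply/orP; left; apply/eqP; field.
  by rewrite P10 P20.
move=> s' q sN; rewrite diffwZ cmodM -diffw_cat.
rewrite (@diffw_perm _ _ _ (t ++ s ++ s')); last by rewrite perm_catC catA.
apply: le_trans (ler_wpM2r (cmod_ge0 _) (kmon_kmon1 k q ut)) _.
rewrite -mulrA; apply: le_trans (ler_wpM2l (ltW (Psi_gt0 q)) (hC s' (- p) (k + q) sN)) _.
rewrite PsiN; set P := Psi p ^- _.
have P0 : 0 <= P by exact: PsiV_ge0.
have -> : B * Psi q ^+ (L + 1) = Psi q * (C * (D * Psi q ^+ L * Lambda k `^ E) * P).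
  by rewrite /B -/P exprD expr1; ring.
rewrite ler_wpM2l ?(ltW (Psi_gt0 q)) // ler_wpM2r // ler_wpM2l //.
Qed.

End Remainder.

(** * Transposition *)

Section Transpose.
Context {R : realType} {n : nat}.
Local Notation Zn := 'rV[int]_n.
Implicit Types (f g c : Zn -> R[i]) (k l p q : Zn) (x : 'rV[R]_n).

Lemma sumZ_opp w B f : sum_le w B -> summable_by w f ->
  summable_by w (fun p => f (- p)) -> sumZ (fun p => f (- p)) = sumZ f.
Proof.
move=> wB fw fw'; apply: (sumZ_eq wB) => // e e0.
have [s0 us0 H] := sumZ_approx1 wB fw e0.
exists (map (@GRing.opp Zn) s0) => s us ss.
have -> : \sum_(k <- s) f (- k) = \sum_(k <- map (@GRing.opp Zn) s) f k.
  by rewrite big_map.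
apply: H; first by rewrite map_inj_uniq //; exact: oppr_inj.
move=> k ks0; rewrite -[k]opprK map_f //; apply: ss; exact: map_f.
Qed.

Lemma sumZ_opp_rapid f : rapid f -> sumZ (fun p => f (- p)) = sumZ f.
Proof.
move=> rf; have [C C0 hC] := rapid_bound 2 rf.
apply: (sumZ_opp (sum_PsiC C0)) => p; first exact: hC.
by rewrite -PsiN; exact: hC.
Qed.

Lemma fseries_opp c x : rapid c -> fseries c (- x) = fseries (fun p => c (- p)) x.
Proof.
move=> rc; rewrite /fseries -[RHS](@sumZ_opp_rapid (fun p => c (- p) * echar p x)).
  by congr sumZ; apply/funext => p; rewrite opprK echar_opp.
apply: (@rapid_le _ _ (fun p => c (- p)) _ 1 0) => //; first exact: rapidN.
by move=> p; rewrite expr0 !mul1r cmodM cmod_echar mulr1.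
Qed.

Variables (mu : R) (Lambda : Zn -> R) (hL : weight_function mu Lambda).
Variables (rho : R) (rho0 : 0 < rho) (m : R).
Variables (sigma : Zn -> 'rV[R]_n -> R[i]) (hsigma : Mclass rho Lambda m sigma).

(** Integrating the series of [fourier f] term by term exhibits the operator as a
   matrix with entries the Fourier coefficients of the symbol. *)
Lemma psdo_kernel f k : rapid f ->
  psdo sigma f k = sumZ (fun l => f l * fcoef (sigma k) (l - k)).
Proof.
move=> rf; have [hs _] := hsigma; have [pk sk] := hs k.
have cs := smooth_ccont sk; have [B hB] := ccont_cube_bounded cs.
pose u x := echar k x * sigma k x.
have cu : ccont u by apply: ccontM => //; exact: ccont_echar.
have uB x : cube x -> cmod (u x) <= B.
  by move=> cx; rewrite cmodM cmod_echar mul1r; exact: hB.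
have fE x : fourier f x = fseries (fun p => f (- p)) x.
  rewrite -fseries_opp // /fseries /fourier; congr sumZ; apply/funext => l.
  by rewrite mulrC.
rewrite /psdo (_ : (fun x => _) = fun x => u x * fseries (fun p => f (- p)) x); last first.
  by apply/funext => x; rewrite fE.
rewrite (torus_int_fseries cu uB (rapidN rf)).
pose h l := f l * fcoef (sigma k) (l - k).
rewrite -[RHS](@sumZ_opp_rapid h); last first.
  apply: (@rapid_le _ _ f _ (B + B) 0) => //.
    by rewrite addr_ge0 //; apply: le_trans (cmod_ge0 _) (hB 0 _) => j; rewrite mxE lexx; exact: ler01.
  move=> p; rewrite expr0 mulr1 cmodM mulrC ler_wpM2r ?cmod_ge0 //.
  exact: fcoef_bound.
congr sumZ; apply/funext => p; rewrite /h; congr (_ * _).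
rewrite /fcoef; congr torus_int; apply/funext => x.
by rewrite /u mulrAC mulrC -echarDl opprB opprK addrC.
Qed.

Lemma kernel_bound : exists L : nat, forall M : nat, exists2 C : R, 0 <= C &
  forall k p, cmod (fcoef (sigma k) p) <= C * Psi k ^+ L * Psi p ^- M.
Proof.
have hM := Mclass_Mouter hsigma; have [L [D D0 hD]] := Lambda_temperate hL m.
exists L => M; have [C C0 hC] := hM [::] [::] isT M.
exists (C * (D * Lambda 0 `^ m)) => [|k p].
  by rewrite !mulr_ge0 ?powR_ge0 ?(ltW D0).
have := hC p k; rewrite /mixed /= /kmon big_nil mul1r mulr0 subr0 => /le_trans; apply.
rewrite ler_wpM2r ?PsiV_ge0 // -mulrA ler_wpM2l //.
by have := hD 0 k; rewrite add0r mulrAC.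
Qed.

(** The decay of the kernel away from the diagonal and that of [f] add up, since
   [Psi k <= Psi l * Psi (l - k)]. *)
Lemma psdo_rapid f : rapid f -> rapid (psdo sigma f).
Proof.
move=> rf A; have [L hL'] := kernel_bound.
have [C C0 hC] := hL' (A + L)%N; have [D D0 hD] := rapid_bound (A + L + 2) rf.
exists (D * C * 3 ^+ n) => k; rewrite psdo_kernel //.
have P0 q (N : nat) : 0 <= Psi q ^- N :> R by exact: PsiV_ge0.
rewrite mulrAC; have w0 : 0 <= D * C / Psi k ^+ A by rewrite !mulr_ge0.
apply: (sumZ_bound (sum_PsiC w0)) => l; rewrite cmodM.
apply: le_trans (ler_pM (cmod_ge0 _) (cmod_ge0 _) (hD l) (hC k (l - k))) _.
set a := Psi l; set b := Psi (l - k); set d := Psi k.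
have a0 : 0 < a by exact: Psi_gt0.
have b0 : 0 < b by exact: Psi_gt0.
have d0 : 0 < d by exact: Psi_gt0.
have dab : d <= a * b.
  by rewrite /d -[k](subKr l); exact: PsiB.
have -> : D * a ^- (A + L + 2) * (C * d ^+ L * b ^- (A + L)) =
    D * C / d ^+ A * a ^- 2 * (d ^+ (A + L) / (a * b) ^+ (A + L)).
  by rewrite !exprD !exprMn; field; rewrite !gt_eqF // ?exprn_gt0.
apply: ler_piMr; first by rewrite mulr_ge0 // P0.
by rewrite ler_pdivrMr ?mul1r ?exprn_gt0 ?mulr_gt0 // ler_expn // ltW.
Qed.

End Transpose.

Section TransposeSymbol.
Context {R : realType} {n : nat}.
Local Notation Zn := 'rV[int]_n.
Implicit Types (f g : Zn -> R[i]) (k l p q : Zn) (x : 'rV[R]_n)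
  (sigma : Zn -> 'rV[R]_n -> R[i]).

(** Entry [(k, k + p)] of the transposed matrix is entry [(k + p, k)] of the
   matrix, that is, the coefficient of [sigma (k + p)] at [- p]. *)
Definition transpose_symbol sigma k x : R[i] :=
  fseries (fun p => fcoef (sigma (k + p)) (- p)) x.

Lemma fseries_sum (I : Type) (s : seq I) (P : pred I) (F : I -> Zn -> R[i]) x :
  (forall i, rapid (F i)) ->
  rapid (fun p => \sum_(i <- s | P i) F i p) /\
  fseries (fun p => \sum_(i <- s | P i) F i p) x = \sum_(i <- s | P i) fseries (F i) x.
Proof.
move=> rF; elim: s => [|i s [rs IH]].
  have -> : (fun p => \sum_(i <- [::] | P i) F i p) = fun=> 0.
    by apply/funext => p; rewrite big_nil.
  by rewrite fseries0 big_nil; split=> // M; exists 0 => p; rewrite cmod0 mul0r.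
rewrite big_cons; case: (boolP (P i)) => Pi; last first.
  have -> // : (fun p => \sum_(j <- i :: s | P j) F j p) = fun p => \sum_(j <- s | P j) F j p.
  by apply/funext => p; rewrite big_cons (negPf Pi).
have -> : (fun p => \sum_(j <- i :: s | P j) F j p) =
    fun p => F i p + \sum_(j <- s | P j) F j p.
  by apply/funext => p; rewrite big_cons Pi.
by rewrite fseriesD // IH; split=> //; exact: rapidD.
Qed.

Variables (mu : R) (Lambda : Zn -> R) (hL : weight_function mu Lambda).
Variables (rho : R) (rho0 : 0 < rho) (m : R).
Variables (sigma : Zn -> 'rV[R]_n -> R[i]) (hsigma : Mclass rho Lambda m sigma).

Let c p k : R[i] := fcoef (sigma k) p.

Lemma transpose_coef_rapid k : rapid (fun p => fcoef (sigma (k + p)) (- p)).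
Proof.
move=> M; have [L hL'] := kernel_bound hL hsigma.
have [C C0 hC] := hL' (L + M)%N; exists (C * Psi k ^+ L) => p.
apply: le_trans (hC _ _) _; rewrite PsiN -!mulrA ler_wpM2l //.
have P0 : 0 < Psi p :> R by exact: Psi_gt0.
have := ler_expn L (ltW (Psi_gt0 _)) (PsiD (R := R) k p); rewrite exprMn => h.
apply: le_trans (ler_wpM2r (PsiV_ge0 _ _) h) _.
rewrite exprD le_eqVlt; apply/orP; left; apply/eqP; field.
by rewrite !gt_eqF ?PsiX_gt0.
Qed.

(** Coefficient by coefficient, the expansion is Newton's formula for the shift by
   [p]: the derivative of order [a] of the reflected symbol multiplies the [p]-th
   coefficient by the falling power of [p]. *)
Lemma transpose_remainder N :
  Mclass rho Lambda (m - rho * N%:R)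
    (fun k x => transpose_symbol sigma k x -
       \sum_(a : {ffun 'I_n -> 'I_N} | (mlen (fun j => a j) < N)%N)
         (mfact (fun j => a j))%:R^-1 *
         diffs (fun j => a j)
           (fun k' => Dfall (fun j => a j) (fun y => sigma k' (- y)) x) k).
Proof.
have hM := Mclass_Mouter hsigma; have hin := Mouter_Minner hL rho0 hM.
have hr := Minner_Mouter hL rho0 (Minner_remainder hL rho0 N hin).
have rc k : rapid (c^~ k) by exact: (Mouter_symbol hM).
have rcN k : rapid (fun p => c (- p) k) by exact: (rapidN (rc k)).
apply: (eq_ind _ (Mclass rho Lambda _) (Mouter_Mclass hr)).
apply/funext => k; apply/funext => x; apply/esym.
have sE k' : (fun y => sigma k' (- y)) = fseries (fun p => c (- p) k').
  have [hs _] := hsigma; have [pk sk] := hs k'.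
  apply/funext => y; rewrite {1}(fseries_fcoef sk pk) fseries_opp //; exact: rc.
have term (a : {ffun 'I_n -> 'I_N}) :
    rapid (fun p => newton_coef p (fun j => a j) * diffs (fun j => a j) (c (- p)) k) /\
    (mfact (fun j => a j))%:R^-1 * diffs (fun j => a j)
      (fun k' => Dfall (fun j => a j) (fun y => sigma k' (- y)) x) k =
    fseries (fun p => newton_coef p (fun j => a j) * diffs (fun j => a j) (c (- p)) k) x.
  pose b j : nat := a j; pose d p k' := pfall p b * c (- p) k'.
  have rd k' : rapid (d^~ k') by exact: (Dfall_fseries b (rcN k')).2.
  have [r1 e1] := fseries_diffw (word b) k x rd.
  have E : (fun p => newton_coef p b * diffs b (c (- p)) k) =
      fun p => (mfact b)%:R^-1 * diffw (word b) (d p) k.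
    by apply/funext => p; rewrite /newton_coef diffsE /d diffwZ mulrA.
  rewrite -/b E; split; first exact: rapidZ.
  rewrite fseriesZ // -e1 diffsE; congr (_ * diffw _ _ k).
  by apply/funext => k'; rewrite sE (Dfall_fseries b (rcN k')).1.
have [rs es] := @fseries_sum _ (index_enum {ffun 'I_n -> 'I_N})
  (fun a => (mlen (fun j => a j) < N)%N)
  (fun a p => newton_coef p (fun j => a j) * diffs (fun j => a j) (c (- p)) k) x
  (fun a => (term a).1).
rewrite /newton_rem fseriesB; [|exact: transpose_coef_rapid|exact: rs].
congr (_ - _); rewrite /newton es; apply: eq_bigr => a _.
by rewrite (term a).2.
Qed.

(** This is the remainder of order zero. *)
Lemma transpose_Mclass : Mclass rho Lambda m (transpose_symbol sigma).
Proof.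
have := transpose_remainder 0; rewrite mulr0 subr0.
rewrite (_ : (fun k x => _) = transpose_symbol sigma) //.
by apply/funext => k; apply/funext => x; rewrite big_pred0 // subr0.
Qed.

(** Both kernels are matrices transposed to each other; the pairing is a double
   series, dominated by a product. *)
Lemma transpose_pairing f g : rapid f -> rapid g ->
  sumZ (fun k => psdo (transpose_symbol sigma) f k * g k) =
  sumZ (fun k => f k * psdo sigma g k).
Proof.
move=> rf rg; have ht := transpose_Mclass.
have [L hL'] := kernel_bound hL hsigma; have [C C0 hC] := hL' 0%N.
have [D D0 hD] := rapid_bound (L + 2) rf; have [E E0 hE] := rapid_bound 2 rg.
have P0 q (N : nat) : 0 <= Psi q ^- N :> R by exact: PsiV_ge0.
have cfT k p : fcoef (transpose_symbol sigma k) p = fcoef (sigma (k + p)) (- p).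
  by rewrite /transpose_symbol (fcoef_fseries (transpose_coef_rapid k)).
pose a l k := f l * fcoef (sigma l) (k - l) * g k.
have dom l k : cmod (a l k) <= (D * C * Psi l ^- 2) * (E * Psi k ^- 2).
  rewrite /a 2!cmodM; apply: ler_pM; rewrite ?mulr_ge0 ?cmod_ge0 //.
  apply: le_trans (ler_pM (cmod_ge0 _) (cmod_ge0 _) (hD l) (hC l (k - l))) _.
  rewrite expr0 invr1 mulr1 exprD le_eqVlt; apply/orP; left; apply/eqP.
  by field; rewrite !gt_eqF ?PsiX_gt0 ?Psi_gt0.
have wl := sum_PsiC (n := n) (mulr_ge0 D0 C0); have wk := sum_PsiC (n := n) E0.
have rowk k : summable_by (fun l => D * C * Psi l ^- 2)
    (fun l => f l * fcoef (sigma l) (k - l)).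
  move=> l; rewrite cmodM.
  apply: le_trans (ler_pM (cmod_ge0 _) (cmod_ge0 _) (hD l) (hC l (k - l))) _.
  rewrite expr0 invr1 mulr1 exprD le_eqVlt; apply/orP; left; apply/eqP.
  by field; rewrite !gt_eqF ?PsiX_gt0 ?Psi_gt0.
have E1 k : psdo (transpose_symbol sigma) f k * g k = sumZ (a^~ k).
  rewrite (psdo_kernel ht) // mulrC -(sumZZ (g k) wl).
    congr sumZ; apply/funext => l; rewrite /a cfT mulrC.
    by rewrite [k + _]addrC subrK opprB.
  by move=> l; rewrite cfT [k + _]addrC subrK opprB; exact: rowk.
have E2 l : f l * psdo sigma g l = sumZ (a l).
  rewrite (psdo_kernel hsigma) // -(sumZZ (f l) (sum_PsiC (n := n) (mulr_ge0 (mulr_ge0 C0 (ltW (PsiX_gt0 l L))) E0))).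
    by congr sumZ; apply/funext => k; rewrite /a mulrA mulrAC.
  move=> k; rewrite cmodM [leLHS]mulrC -[leRHS]mulrA.
  apply: ler_pM; [exact: cmod_ge0|exact: cmod_ge0| |exact: hE].
  by apply: le_trans (hC l (k - l)) _; rewrite expr0 invr1 mulr1.
rewrite (_ : (fun k => psdo _ f k * g k) = fun k => sumZ (a^~ k)); last exact/funext.
rewrite (_ : (fun k => f k * _) = fun l => sumZ (a l)); last exact/funext.
by rewrite (sumZ_exchange wl wk dom).
Qed.

End TransposeSymbol.

Theorem theorem4p4 (R : realType) (n : nat)
    (mu : R) (Lambda : 'rV[int]_n -> R)
    (hLambda : weight_function mu Lambda)
    (rho : R) (hrho : 0 < rho <= mu^-1)
    (m : R) (sigma : 'rV[int]_n -> 'rV[R]_n -> R[i])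
    (hsigma : Mclass rho Lambda m sigma) :
  exists sigmat : 'rV[int]_n -> 'rV[R]_n -> R[i],
    [/\ is_transpose (psdo sigma) (psdo sigmat),
        Mclass rho Lambda m sigmat &
        forall N : nat, Mclass rho Lambda (m - rho * N%:R)
          (fun k x => sigmat k x -
             \sum_(a : {ffun 'I_n -> 'I_N} | (mlen (fun j => a j) < N)%N)
               (mfact (fun j => a j))%:R^-1 *
               diffs (fun j => a j)
                 (fun k' => Dfall (fun j => a j) (fun y => sigma k' (- y)) x)
                 k)].
Proof.
have /andP[rho0 _] := hrho.
exists (transpose_symbol sigma); split.
- have ht := transpose_Mclass hLambda rho0 hsigma; split.
  + by move=> f /rapidP rf; apply/rapidP; exact: (psdo_rapid hLambda hsigma).
  + by move=> f /rapidP rf; apply/rapidP; exact: (psdo_rapid hLambda ht).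
  + by move=> f g /rapidP rf /rapidP rg; exact: (transpose_pairing hLambda rho0 hsigma).
- exact: (transpose_Mclass hLambda rho0 hsigma).
- by move=> N; exact: (transpose_remainder hLambda rho0 hsigma).
Qed.
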